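(* Let $n\ge3$ and $k\in\{1,\dots,[n/2],n\}$, and let $h$ be the greatest common divisor of $k$ and $n$. Suppose that $\sigma_k(\mu)$ changes sign at $\mu_0$ and that $\sigma_j(\mu_0)\ne0$ for the other $j\in[1,n/2]\cap h\mathbb{N}$ (that is, those with $j\neq k$). Then there is a bifurcation of relative equilibria from $(\bar a,\mu_0)$ with maximal symmetry $\tilde D_h$; that is, there are relative equilibria $(x,\mu)$ with $x\in E_h\setminus\{\bar a\}$ arbitrarily close to $(\bar a,\mu_0)$, and the local bifurcation lies in $E_h\setminus\bigcup_{H}E^{H}$, the union being over the groups $H=\tilde D_p$ ($p\mid n$) strictly containing $\tilde D_h$, where $E^{H}$ is the fixed-point space of $H$.
   Context: Identify $\mathbb{R}^2$ with $\mathbb{C}$, put $\zeta=2\pi/n$, $J=\begin{pmatrix}0&-1\\1&0\end{pmatrix}$, and fix $\alpha\ge1$. For $\mu\in\mathbb{R}$ let $m_0=\mu$, $m_1=\dots=m_n=1$. For $x=(x_0,\dots,x_n)\in\mathbb{R}^{2(n+1)}$ set $$V(x,\mu)=\frac{\omega}{2}\sum_{j=0}^n m_j\|x_j\|^2+\sum_{0\le i<j\le n}m_im_j\,\phi_\alpha(\|x_j-x_i\|),\quad \phi_\alpha'(r)=-r^{-\alpha},\quad \omega=\mu+s_1,\quad s_1=\frac1{2^\alpha}\sum_{j=1}^{n-1}\frac1{\sin^{\alpha-1}(j\zeta/2)} .$$ Relative equilibria are the critical points of $V(\cdot,\mu)$; $\bar a=(0,e^{i\zeta},\dots,e^{ni\zeta})$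 is one for every $\mu$. For $h$ dividing $n$, $\tilde D_h$ is the group generated by the two maps $x\mapsto y$ given by $y_0=e^{-2\pi i/h}x_0,\ y_j=e^{-2\pi i/h}x_{j+n/h}$ and $y_0=\bar x_0,\ y_j=\bar x_{n-j}$ ($1\le j\le n$, indices modulo $n$ in $\{1,\dots,n\}$); $E_h\subset\mathbb{R}^{2(n+1)}$ is its fixed-point space. Blocks: let $v_1=\frac1{\sqrt2}(1,i)^T$, $v_{n-1}=\frac1{\sqrt2}(1,-i)^T$. For $k\in\{2,\dots,n-2,n\}$ let $T_k:\mathbb{C}^2\to\mathbb{C}^{2(n+1)}$, $T_k(z)=(0,n^{-1/2}e^{(ikI+J)\zeta}z,\dots,n^{-1/2}e^{n(ikI+J)\zeta}z)$; for $k\in\{1,n-1\}$ let $T_k:\mathbb{C}^3\to\mathbb{C}^{2(n+1)}$, $T_k(\alpha',w)=(v_k\alpha',n^{-1/2}e^{(ikI+J)\zeta}w,\dots,n^{-1/2}e^{n(ikI+J)\zeta}w)$ with $\alpha'\in\mathbb{C}$, $w\in\mathbb{C}^2$. The images of the $T_k$ are invariant under the Hessian $D_x^2V(\bar a,\mu)$, and the Hermitian matrix $B_k=B_k(\mu)$ is defined by $D_x^2V(\bar a,\mu)T_k(z)=T_k(B_kz)$. With $e_1=(1,0)^T$, set $\sigma_k(\mu)=\operatorname{sgn}(e_1^TB_ke_1)$ for $k\in\{n,n/2\}$ ($k=n/2$ only if $n$ is even) and $\sigma_k(\mu)=\operatorname{sgn}(\det B_k)$ for integers $k\in[1,n/2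)$.
   Formalization: For k=1, μ0=−s_1, only existence of relative equilibria outside the E^H near (ā,μ0) is proved; the claim that all local ones lie outside them excludes this case, where it fails: at μ=−s_1 (ω=0) all dilated polygons ℓā are relative equilibria with symmetry D̃_n. *)

(* Defs.v *)
From mathcomp Require Import all_boot all_order all_algebra.
From mathcomp Require Import all_classical all_reals all_analysis.
From mathcomp Require Import complex.

Set Implicit Arguments.
Unset Strict Implicit.
Unset Printing Implicit Defensive.

Import Order.TTheory GRing.Theory Num.Theory.
Import numFieldNormedType.Exports.

Local Open Scope classical_set_scope.
Local Open Scope ring_scope.
Local Open Scope complex_scope.

(* The element (x_0, ..., x_n) of R^(2(n+1)) is the matrix whose row j is
   x_j; row 0 is the central body. *)
Notation config R n := ('M[R]_(n.+1, 2)).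
Notation cconfig R n := ('M[R[i]]_(n.+1, 2)).

Section Defs.
Variable R : realType.

Definition cis (t : R) : R[i] := cos t +i* sin t.

Definition zeta (n : nat) : R := 2 * pi / n%:R.

Definition pt n (x : config R n) (j : 'I_n.+1) : R[i] := x j 0 +i* x j 1.

Definition config_of n (f : 'I_n.+1 -> R[i]) : config R n :=
  \matrix_(j, c) (if c == 0 then complex.Re (f j) else complex.Im (f j)).

Definition abar (n : nat) : config R n :=
  config_of (fun j : 'I_n.+1 => if j == 0 then 0 else cis (j%:R * zeta n)).

Definition mass n (mu : R) (j : 'I_n.+1) : R := if j == 0 then mu else 1.

(* normc is the R-valued modulus; `|_| on R[i] is R[i]-valued. *)
Definition body_norm n (x : config R n) (j : 'I_n.+1) : R :=
  ComplexField.Normc.normc (pt x j).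

Definition body_dist n (x : config R n) (i j : 'I_n.+1) : R :=
  ComplexField.Normc.normc (pt x j - pt x i).

Definition s1 (alpha : R) (n : nat) : R :=
  (2 `^ alpha)^-1 *
  \sum_(1 <= j < n) (sin (j%:R * zeta n / 2) `^ (alpha - 1))^-1.

Definition V (phi : R -> R) (alpha : R) (n : nat) (mu : R) (x : config R n)
    : R :=
  (mu + s1 alpha n) / 2 * \sum_j mass mu j * body_norm x j ^+ 2 +
  \sum_(i < n.+1) \sum_(j < n.+1 | (i < j)%N)
     mass mu i * mass mu j * phi (body_dist x i j).

(* V is only defined off the collisions: they are excluded explicitly because
   phi is total. *)
Definition rel_equilibrium (phi : R -> R) (alpha : R) (n : nat) (mu : R)
    (x : config R n) : Prop :=
  [/\ (forall i j, i != j -> pt x i != pt x j),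
      differentiable (V phi alpha mu) x &
      forall v, 'd (V phi alpha mu) x v = 0].

Inductive gen_group (T : Type) (S : set (T -> T)) : set (T -> T) :=
| gen_id : gen_group S id
| gen_in f : S f -> gen_group S f
| gen_comp f g : gen_group S f -> gen_group S g -> gen_group S (f \o g)
| gen_inv f g : gen_group S f -> cancel f g -> cancel g f -> gen_group S g.

Definition fixed_space (T : Type) (G : set (T -> T)) : set T :=
  [set x | forall g, G g -> g x = x].

(* The representative modulo n of m in {1, ..., n}. *)
Definition mod_index (n m : nat) : 'I_n.+1 :=
  inord (if (n %| m)%N then n else (m %% n)%N).

Definition rot_sym (n h : nat) (x : config R n) : config R n :=
  config_of (fun j => cis (- (2 * pi / h%:R)) *
                      pt x (if j == 0 then 0 else mod_index n (j + n %/ h))).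

Definition refl_sym (n : nat) (x : config R n) : config R n :=
  config_of (fun j => (pt x (if j == 0 then 0 else mod_index n (n - j)))^*).

Definition Dtilde (n h : nat) : set (config R n -> config R n) :=
  gen_group [set @rot_sym n h; @refl_sym n].

Definition E (n h : nat) : set (config R n) := fixed_space (@Dtilde n h).

(* The coordinates of the Hessian are ordered as (body, component). *)
Definition hess n (f : config R n -> R) (a : config R n)
    (j : 'I_n.+1) (c : 'I_2) (j' : 'I_n.+1) (c' : 'I_2) : R :=
  'D_(delta_mx j c) ('D_(delta_mx j' c') f) a.

Definition hess_act n (f : config R n -> R) (a : config R n)
    (X : cconfig R n) : cconfig R n :=
  \matrix_(j, c) \sum_j' \sum_c' (hess f a j c j' c')%:C * X j' c'.

(* exp (t J), with J the matrix of multiplication by i on the plane. *)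
Definition expJ (t : R) : 'M[R[i]]_2 :=
  \matrix_(i, j) (if i == j then (cos t)%:C
                  else if i == 0 then - (sin t)%:C else (sin t)%:C).

(* n^(-1/2) exp (j (i k I + J) zeta) w; since J commutes with I, the matrix
   exponential is exp (i j k zeta) exp (j zeta J). *)
Definition wave (n k j : nat) (w : 'cV[R[i]]_2) : 'cV[R[i]]_2 :=
  ((Num.sqrt n%:R)^-1)%:C * cis ((j * k)%:R * zeta n)
    *: (expJ (j%:R * zeta n) *m w).

Definition v1 : 'cV[R[i]]_2 :=
  ((Num.sqrt 2)^-1)%:C *: \col_c (if c == 0 then 1 else 'i).

(* T_k for k different from 1 and n - 1. *)
Definition Tk (n k : nat) (z : 'cV[R[i]]_2) : cconfig R n :=
  \matrix_(j, c) (if j == 0 then 0 else wave n k j z c 0).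

(* T_1, its argument being the column (alpha', w) of height 1 + 2. *)
Definition T1 (n : nat) (z : 'cV[R[i]]_(1 + 2)) : cconfig R n :=
  \matrix_(j, c) (if j == 0 then v1 c 0 * usubmx z 0 0
                  else wave n 1 j (dsubmx z) c 0).

(* The matrix B with D^2 f(a) (T z) = T (B z) for all z; it exists and is
   unique when T is linear and injective with range invariant under
   D^2 f(a). *)
Definition block n d (f : config R n -> R) (a : config R n)
    (T : 'cV[R[i]]_d -> cconfig R n) : 'M[R[i]]_d :=
  xget 0 [set B | forall z, hess_act f a (T z) = T (B *m z)].

Definition Bk (phi : R -> R) (alpha : R) (n k : nat) (mu : R) : 'M[R[i]]_2 :=
  block (V phi alpha mu) (abar n) (@Tk n k).

Definition B1 (phi : R -> R) (alpha : R) (n : nat) (mu : R)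
    : 'M[R[i]]_(1 + 2) :=
  block (V phi alpha mu) (abar n) (@T1 n).

(* The blocks are Hermitian, so the complex numbers below are real; the index
   k = n - 1 is not covered. *)
Definition sigma (phi : R -> R) (alpha : R) (n k : nat) (mu : R) : R :=
  if (k == n) || (k.*2 == n) then
    let e1 : 'cV[R[i]]_2 := delta_mx 0 0 in
    Num.sg (complex.Re ((e1^T *m Bk phi alpha n k mu *m e1) 0 0))
  else if k == 1%N then Num.sg (complex.Re (\det (B1 phi alpha n mu)))
  else Num.sg (complex.Re (\det (Bk phi alpha n k mu))).

Definition changes_sign (s : R -> R) (t0 : R) : Prop :=
  exists2 e, 0 < e & forall t t', t0 - e < t < t0 -> t0 < t' < t0 + e ->
    s t * s t' < 0.

End Defs.

(* Main.v *)
From HB Require Import structures.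
Require Import Defs.
From mathcomp Require Import all_boot all_order all_algebra.
From mathcomp Require Import all_classical all_reals all_analysis.
From mathcomp Require Import complex ring lra zify.
Import Order.TTheory GRing.Theory Num.Theory.
Import numFieldNormedType.Exports.
Local Open Scope classical_set_scope.
Local Open Scope ring_scope.
Set Implicit Arguments.
Unset Strict Implicit.
Unset Printing Implicit Defensive.

(** Off the collisions the relative equilibria are the zeros of the gradient of
    [V]. The rows of the gradient are the masses times the rows of a field
    which is affine in [mu], vanishes at [abar] for every [mu] and commutes with
    the linear isometries of the plane combined with permutations of the outer
    bodies; hence it preserves the fixed spaces ([rel_equilibriumP],
    [massfieldE], [massfield_abar], [field_fixed]).

    The derivative of the field at [abar] is diagonalised by the discrete
    Fourier transform taken in the frame that turns with the vertices
    ([fourier_dfield]). On the fixed space of [Dtilde h] the Fourier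
    coefficients are real and vanish at the modes that [h] does not divide
    ([fixed_fourier_real], [fixed_fourier0]). There remains, for each mode
    [j <= n / 2], a real matrix that couples [j] and [- j], together with the
    central body if [j = 1]. The blocks of the Hessian are these matrices in
    other bases ([Bk_eq], [B1_eq]), so that the hypotheses on the signs say that
    the modes other than [k] are nondegenerate ([mode_inj]). The mode 0 is
    nondegenerate when the rotation rate [mu0 + s1] is not zero; for
    [2 <= k <= n / 2] this follows from the change of sign, because the
    determinant of the block is negative where the rate vanishes
    ([det2_omega0]).

    Existence. A change of [mu] adds one and the same number to all the entries
    of a block (of the block reduced by the translations if [k = 1]), so that
    the determinant is affine in [mu], and at a change of sign it has a root
    with nonzero slope. Then the kernel in the fixed space is a line and the
    derivative in [mu] is transversal to the range ([simple_kernel_generic],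
    [simple_kernel_half], [simple_kernel_one]): this is bifurcation from a
    simple eigenvalue, proved by a contraction argument
    ([crandall_rabinowitz]). Three degenerate cases have explicit branches:
    homothetic polygons for [k = n], where the rotation rate vanishes; an
    arbitrary position of the massless central body for [k = 1] and
    [mu0 = 0]; translations of the polygon for [k = 1] and [mu0 = - s1].

    Maximality. A group [Dtilde p] strictly larger than [Dtilde h] has [p]
    not dividing [k], so that the mode [k] is absent from the intersection of
    the two fixed spaces; in particular [k] is not [n]. The derivative is
    injective on this intersection, and [abar] is the only zero of the
    field on it near [(abar, mu0)] ([isolated_zero], [isolated_symmetric]). In the case of
    the translations, where the rotation rate vanishes and this argument fails,
    the displaced central body is not fixed by any rotation. *)

(** * Strict derivatives *)

Section StrictDerivative.
Context {R : realType}.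
Implicit Types U V : normedModType R.

Definition bounded_map U V (D : U -> V) :=
  exists2 C : R, 0 <= C & forall w, `|D w| <= C * `|w|.

(** The error is controlled for pairs of points and not only against [a], so
    that the remainder is a contraction near [a]; this serves the fixed point
    arguments below. *)
Definition strict_diff U V (f : U -> V) (D : U -> V) (a : U) :=
  bounded_map D /\ forall e : R, 0 < e -> exists2 d : R, 0 < d &
    forall y y', `|y - a| < d -> `|y' - a| < d ->
      `|f y - f y' - D (y - y')| <= e * `|y - y'|.

Lemma strict_diff_lip U V (f D : U -> V) a : strict_diff f D a ->
  exists2 K : R, 0 < K & exists2 d : R, 0 < d &
    forall y y', `|y - a| < d -> `|y' - a| < d ->
      `|f y - f y'| <= K * `|y - y'|.
Proof.
move=> [[C C0 DC] sf]; have [d d0 dP] := sf 1 ltr01.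
exists (C + 1); first by lra.
exists d => // y y' yd y'd.
rewrite -[f y - f y'](subrK (D (y - y'))) (le_trans (ler_normD _ _))//.
by rewrite mulrDl [leRHS]addrC lerD// dP.
Qed.

Lemma strict_diff_near U V (f D : U -> V) a (e : R) : strict_diff f D a -> 0 < e ->
  exists2 d : R, 0 < d & forall y, `|y - a| < d -> `|f y - f a| <= e.
Proof.
move=> /strict_diff_lip[K K0 [d d0 dP]] e0; exists (Num.min d (e / K)).
  by rewrite lt_min d0 divr_gt0.
move=> y; rewrite lt_min => /andP[yd ye].
apply: (le_trans (dP y a yd _)); first by rewrite subrr normr0.
by rewrite mulrC -ler_pdivlMr// ltW.
Qed.

Lemma strict_diff_cst U V (c : V) (a : U) : strict_diff (fun=> c) (fun=> 0) a.
Proof.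
split; first by exists 0 => // w; rewrite normr0 mul0r.
by move=> e e0; exists 1 => // y y' _ _; rewrite !subrr normr0 mulr_ge0// ltW.
Qed.

Lemma strict_diff_lin U V (D : U -> V) (a : U) : bounded_map D ->
  {morph D : x y / x - y} -> strict_diff D D a.
Proof.
move=> bD DB; split=> // e e0; exists 1 => // y y' _ _.
by rewrite DB subrr normr0 mulr_ge0// ltW.
Qed.

Lemma strict_diffD U V (f g Df Dg : U -> V) a :
  strict_diff f Df a -> strict_diff g Dg a ->
  strict_diff (fun x => f x + g x) (fun w => Df w + Dg w) a.
Proof.
move=> [[C C0 hC] sf] [[C' C0' hC'] sg]; split.
  exists (C + C'); first exact: addr_ge0.
  by move=> w; rewrite mulrDl (le_trans (ler_normD _ _))// lerD.
move=> e e0; have e20 : 0 < e / 2 by rewrite divr_gt0.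
have [d d0 dP] := sf _ e20; have [d' d0' dP'] := sg _ e20.
exists (Num.min d d'); first by rewrite lt_min d0.
move=> y y'; rewrite !lt_min => /andP[yd yd'] /andP[y'd y'd'].
rewrite [X in `|X|](_ : _ = (f y - f y' - Df (y - y')) +
  (g y - g y' - Dg (y - y'))); last first.
  by rewrite [RHS]addrACA (addrACA (f y)) -!opprD.
rewrite (le_trans (ler_normD _ _))// [e in leRHS]splitr mulrDl.
by rewrite lerD ?dP ?dP'.
Qed.

Lemma strict_diff_sum U V (I : Type) (r : seq I) (P : pred I)
    (f D : I -> U -> V) a :
  (forall i, P i -> strict_diff (f i) (D i) a) ->
  strict_diff (fun x => \sum_(i <- r | P i) f i x)
    (fun w => \sum_(i <- r | P i) D i w) a.
Proof.
move=> H; elim: r => [|i r IH].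
  have := strict_diff_cst (0 : V) a.
  by congr strict_diff; apply/funext => x; rewrite big_nil.
have [Pi|Pi] := boolP (P i); last first.
  move: IH; congr strict_diff; apply/funext => x; by rewrite big_cons (negPf Pi).
have := strict_diffD (H i Pi) IH.
by congr strict_diff; apply/funext => x; rewrite big_cons Pi.
Qed.

(** The estimates for products and compositions come out with an error [K * e]
    and use [e <= 1]; a rescaling of [e] absorbs both. *)
Lemma strict_diff_small U V (f D : U -> V) a (K : R) : bounded_map D -> 0 <= K ->
  (forall e : R, 0 < e <= 1 -> exists2 d : R, 0 < d &
    forall y y', `|y - a| < d -> `|y' - a| < d ->
      `|f y - f y' - D (y - y')| <= K * e * `|y - y'|) ->
  strict_diff f D a.
Proof.
move=> bD K0 H; split=> // e e0.
have K10 : 0 < K + 1 by lra.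
have [|d d0 dP] := H (Num.min 1 (e / (K + 1))).
  by rewrite ge_min lexx lt_min ltr01 divr_gt0.
exists d => // y y' yd y'd; apply: (le_trans (dP _ _ yd y'd)).
rewrite ler_wpM2r//; apply: (@le_trans _ _ ((K + 1) * (e / (K + 1)))).
  rewrite ler_pM//; first by rewrite le_min ler01 divr_ge0// ltW.
    by lra.
  by rewrite ge_min lexx orbT.
by rewrite mulrC divfK// gt_eqF.
Qed.

Lemma strict_diffM U (f g Df Dg : U -> R) a :
  strict_diff f Df a -> strict_diff g Dg a ->
  strict_diff (fun x => f x * g x) (fun w => f a * Dg w + g a * Df w) a.
Proof.
move=> F G; have [[C C0 hC] sf] := F; have [[C' C0' hC'] sg] := G.
apply: (@strict_diff_small _ _ _ _ _ (`|f a| + `|g a| + C + C' + 2)).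
- exists (`|f a| * C' + `|g a| * C); first by rewrite addr_ge0// mulr_ge0.
  move=> w; rewrite mulrDl (le_trans (ler_normD _ _))// !normrM.
  by rewrite -!mulrA lerD// ler_wpM2l.
- by rewrite !addr_ge0.
move=> e /andP[e0 e1].
have [d1 d10 P1] := sf _ e0; have [d2 d20 P2] := sg _ e0.
have [d3 d30 P3] := strict_diff_near F e0.
have [d4 d40 P4] := strict_diff_near G e0.
exists (Num.min (Num.min d1 d2) (Num.min d3 d4)).
  by rewrite !lt_min d10 d20 d30.
move=> y y'; rewrite !lt_min => /andP[/andP[y1 y2] /andP[y3 y4]].
move=> /andP[/andP[y1' y2'] /andP[y3' y4']].
set h := y - y'.
have fy : `|f y| <= `|f a| + 1.
  by rewrite -[f y](subrK (f a)) addrC (le_trans (ler_normD _ _))// lerD// (le_trans (P3 _ y3)).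
have gy : `|g y'| <= `|g a| + 1.
  by rewrite -[g y'](subrK (g a)) addrC (le_trans (ler_normD _ _))// lerD// (le_trans (P4 _ y4')).
have -> : f y * g y - f y' * g y' - (f a * Dg h + g a * Df h) =
  f y * (g y - g y' - Dg h) + g y' * (f y - f y' - Df h)
  + ((f y - f a) * Dg h + (g y' - g a) * Df h) by ring.
apply: (le_trans (ler_normD _ _)).
apply: (@le_trans _ _ ((`|f a| + 1) * (e * `|h|) + (`|g a| + 1) * (e * `|h|)
   + (e * (C' * `|h|) + e * (C * `|h|)))); last first.
  by rewrite le_eqVlt; apply/orP; left; apply/eqP; ring.
rewrite lerD// (le_trans (ler_normD _ _))// lerD// normrM ler_pM//.
- by rewrite P2.
- by rewrite P1.
- exact: P3.
- exact: P4.
Qed.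

Lemma strict_diffZ U (f Df : U -> R) (c : R) a : strict_diff f Df a ->
  strict_diff (fun x => c * f x) (fun w => c * Df w) a.
Proof.
move=> F; have := strict_diffM (strict_diff_cst c a) F.
by congr strict_diff; apply/funext => w; rewrite mulr0 addr0.
Qed.

Lemma strict_diff_comp U (r : R -> R) (r' : R) (f Df : U -> R) a :
  strict_diff r ( *%R r') (f a) -> strict_diff f Df a ->
  strict_diff (fun x => r (f x)) (fun w => r' * Df w) a.
Proof.
move=> [_ sr] F; have [[C C0 hC] sf] := F.
apply: (@strict_diff_small _ _ _ _ _ (`|r'| + C + 1)).
- exists (`|r'| * C); first by rewrite mulr_ge0.
  by move=> w; rewrite normrM -mulrA ler_wpM2l.
- by rewrite !addr_ge0.
move=> e /andP[e0 e1].
have [d1 d10 P1] := sf _ e0; have [d2 d20 P2] := sr _ e0.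
have d220 : 0 < d2 / 2 by lra.
have [d3 d30 P3] := strict_diff_near F d220.
exists (Num.min d1 d3); first by rewrite lt_min d10.
move=> y y'; rewrite !lt_min => /andP[y1 y3] /andP[y1' y3'].
set h := y - y'.
have dh : `|f y - f y'| <= (C + 1) * `|h|.
  rewrite -[f y - f y'](subrK (Df h)) (le_trans (ler_normD _ _))//.
  rewrite [(C + 1) * _]mulrDl [X in _ <= X]addrC lerD//.
  by rewrite (le_trans (P1 _ _ y1 y1'))// ler_wpM2r.
have -> : r (f y) - r (f y') - r' * Df h =
  (r (f y) - r (f y') - r' * (f y - f y')) + r' * (f y - f y' - Df h) by ring.
apply: (le_trans (ler_normD _ _)).
apply: (@le_trans _ _ (e * ((C + 1) * `|h|) + `|r'| * (e * `|h|))); last first.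
  by rewrite le_eqVlt; apply/orP; left; apply/eqP; ring.
apply: lerD; last by rewrite normrM ler_wpM2l ?P1.
apply: (@le_trans _ _ (e * `|f y - f y'|)); last by rewrite ler_wpM2l// ltW.
by apply: P2; [have := P3 _ y3|have := P3 _ y3']; lra.
Qed.

Lemma strict_diff_mx U (m n : nat) (f D : U -> 'M[R]_(m.+1, n.+1)) a :
  (forall i j, strict_diff (fun x => f x i j) (fun w => D w i j) a) ->
  strict_diff f D a.
Proof.
move=> H.
have mxle (M : 'M[R]_(m.+1, n.+1)) (c : R) : (forall i j, `|M i j| <= c) -> `|M| <= c.
  move=> h; rewrite [`|M|]mx_normrE; apply: bigmax_le => [|[i j] _]; last exact: h.
  exact: le_trans (h ord0 ord0).
split.
  have /choice[C CP] : forall ij : 'I_m.+1 * 'I_n.+1, exists C : R,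
      0 <= C /\ forall w, `|D w ij.1 ij.2| <= C * `|w|.
    by move=> [i j]; have [[C C0 hC] _] := H i j; exists C.
  exists (\sum_ij C ij); first by apply: sumr_ge0 => ij _; have [] := CP ij.
  move=> w; apply: mxle => i j; have [C0 /(_ w) h] := CP (i, j).
  apply: (le_trans h); rewrite ler_wpM2r// (bigD1 (i, j))//= lerDl.
  by apply: sumr_ge0 => ij _; have [] := CP ij.
move=> e e0.
have /choice[d dP] : forall ij : 'I_m.+1 * 'I_n.+1, exists d : R, 0 < d /\
    forall y y', `|y - a| < d -> `|y' - a| < d ->
      `|f y ij.1 ij.2 - f y' ij.1 ij.2 - D (y - y') ij.1 ij.2| <= e * `|y - y'|.
  by move=> [i j]; have [_ /(_ _ e0)[d d0 hd]] := H i j; exists d.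
exists (\big[Num.min/1]_ij d ij).
  by apply: lt_bigmin => // ij _; have [] := dP ij.
move=> y y' yd y'd; apply: mxle => i j; rewrite !mxE.
have [_] := dP (i, j); apply.
  by apply: (lt_le_trans yd); exact: bigmin_le_cond.
by apply: (lt_le_trans y'd); exact: bigmin_le_cond.
Qed.

Lemma strict_diff_diff U V (f : U -> V) (D : {linear U -> V}) a :
  strict_diff f D a -> differentiable f a /\ 'd f a = D :> (U -> V).
Proof.
move=> sf; have [[C C0 hC] sf'] := sf.
have cD : continuous D.
  apply: bounded_linear_continuous; apply/linear_boundedP.
  by near=> r => x; rewrite (le_trans (hC x))// ler_wpM2r.
have E : f \o shift a = cst (f a) + D +o_ (0 : U) id.
  apply/eqaddoP => e e0; have [d d0 dP] := sf' _ e0.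
  apply/nbhs_normP; exists d => //= x /=; rewrite sub0r normrN => xd.
  rewrite -[(_ - _) x]/(f (x + a) - (f a + D x)) opprD addrA.
  have := dP (x + a) a; rewrite subrr normr0 addrK; exact.
have dE := diff_unique cD E.
split=> //; apply/diff_locallyP; rewrite dE; split=> //.
Unshelve. all: by end_near. Qed.

Lemma strict_diff_is_derive U V (f : U -> V) (D : {linear U -> V}) a v :
  strict_diff f D a -> is_derive a v f (D v).
Proof.
move=> /strict_diff_diff[df dE]; split; first exact: diff_derivable.
by rewrite deriveE// dE.
Qed.

(** A derivative that is continuous at a point is strict there, by the mean
    value theorem. *)
Lemma strict_diff_C1 (f f' : R -> R) (a : R) :
  (\forall x \near a, is_derive x (1 : R) f (f' x)) ->
  {for a, continuous f'} -> strict_diff f ( *%R (f' a)) a.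
Proof.
move=> /nbhs_normP[d1 /= d10 P1] cf; split.
  by exists `|f' a| => // w; rewrite normrM.
move=> e e0.
have /nbhs_normP[d2 /= d20 P2] : \forall x \near a, `|f' a - f' x| < e.
  by have /cvgrPdist_lt := cf; apply.
exists (Num.min d1 d2); first by rewrite lt_min d10.
have main : forall y y', y <= y' ->
    `|y - a| < Num.min d1 d2 -> `|y' - a| < Num.min d1 d2 ->
    `|f y' - f y - f' a * (y' - y)| <= e * `|y' - y|.
  move=> y y' yy' yd y'd.
  have I x : y <= x <= y' -> `|x - a| < Num.min d1 d2.
    by move=> xyy'; move: yd y'd; rewrite !ltr_norml; lra.
  have D x : y <= x <= y' -> is_derive x (1 : R) f (f' x).
    move=> /I xd; apply: P1 => /=; rewrite distrC.
    by apply: lt_le_trans xd _; rewrite ge_min lexx.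
  have [|||c cI ->] := @MVT_segment R f f' y y' => //.
  - by move=> x; rewrite in_itv/= => xI; apply: D; lra.
  - apply: derivable_within_continuous => x; rewrite in_itv/= => /D h.
    exact: ex_derive.
  rewrite -mulrBl normrM ler_wpM2r// distrC ltW//; apply: P2 => /=.
  rewrite distrC; apply: lt_le_trans (I c _) _; first by move: cI; rewrite in_itv.
  by rewrite ge_min lexx orbT.
move=> y y' yd y'd; have [/main|/ltW/main] := leP y' y; first exact.
move=> /(_ yd y'd); rewrite -normrN [`|y' - y|]distrC.
by congr (`|_| <= _); ring.
Qed.

End StrictDerivative.

(** * Isolated zeros and bifurcation from a simple kernel *)

Section Bifurcation.
Context {R : realType} {m n : nat}.
Local Notation U := 'M[R]_(m.+1, n.+1).

Lemma mx_linear_bounded (V : normedModType R) (f : {linear U -> V}) :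
  bounded_map f.
Proof.
exists (\sum_i \sum_j `|f (delta_mx i j)|).
  by apply: sumr_ge0 => i _; apply: sumr_ge0.
move=> w; rewrite {1}(matrix_sum_delta w) linear_sum mulr_suml.
apply: (le_trans (ler_norm_sum _ _ _)); apply: ler_sum => i _.
rewrite linear_sum mulr_suml.
apply: (le_trans (ler_norm_sum _ _ _)); apply: ler_sum => j _.
rewrite linearZ normrZ mulrC ler_wpM2l//.
rewrite [`|w|]mx_normrE; exact: (le_bigmax _ (fun ij => `|w ij.1 ij.2|) (i, j)).
Qed.

(** When [G - L] has a small Lipschitz constant on the ball of radius [r], the
    map [z |-> z - K (G z)] is a contraction of that ball, and its fixed point
    is a zero of [G]. *)
Lemma near_linear_zero (G L : U -> U) (K : {linear U -> U}) (C e r : R) :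
  0 <= r -> 0 <= C -> cancel L K -> injective K -> (forall w, `|K w| <= C * `|w|) ->
  C * e <= 1 / 2 -> C * `|G 0| <= r / 2 ->
  (forall z z', `|z| <= r -> `|z'| <= r ->
     `|G z - G z' - L (z - z')| <= e * `|z - z'|) ->
  exists2 z, `|z| <= r & G z = 0.
Proof.
move=> r0 C0 LK Kinj KC Ce G0 GL.
pose T (z : U) : U := z - K (G z).
have TB z z' : `|z| <= r -> `|z'| <= r -> `|T z - T z'| <= 1 / 2 * `|z - z'|.
  move=> zr z'r.
  have -> : T z - T z' = - K (G z - G z' - L (z - z')).
    rewrite /T !(linearB K) LK !opprB addrACA [RHS]addrACA.
    by congr (_ + _); rewrite addrC.
  rewrite normrN (le_trans (KC _))//.
  apply: (@le_trans _ _ (C * (e * `|z - z'|))); first by rewrite ler_wpM2l// GL.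
  by rewrite mulrA ler_wpM2r.
pose A : set U := [set z | `|z| <= r].
have TA : {homo T : z / A z >-> A z}.
  move=> z zr; rewrite /A/=.
  have -> : T z = (T z - T 0) + T 0 by rewrite subrK.
  rewrite (le_trans (ler_normD _ _))// [r in leRHS]splitr lerD//.
    apply: (le_trans (TB z 0 zr _)); first by rewrite normr0.
    by rewrite subr0 mulrC mul1r ler_wpM2r// ?invr_ge0.
  by rewrite /T sub0r normrN (le_trans (KC _)).
have clA : closed A.
  rewrite (_ : A = closed_ball_ Num.norm 0 r); first exact: closed_closed_ball_.
  by apply/funext => z; rewrite /A /closed_ball_ /= sub0r normrN.
have ct : is_contraction (mkfun_fun TA).
  have h : (0 <= 1 / 2 :> R) by rewrite divr_ge0.
  exists (NngNum h); split => /=; first by rewrite ltr_pdivrMr// mul1r ltr1n.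
  by move=> [z z'] [/= zr z'r]; exact: TB.
pose X : completeNormedModType R := HB.pack_for (completeNormedModType R) U.
have [|z zr zT] := @banach_fixed_point R X _ _ ct clA.
  by exists 0; rewrite /A /= normr0.
exists z => //; apply: Kinj; rewrite linear0.
have -> : K (G z) = z - T z by rewrite /T opprB addrC subrK.
by apply/eqP; rewrite subr_eq0; apply/eqP.
Qed.

(** The difference quotients of [F] at [a] along [W] lie in [W], which is
    closed. *)
Lemma strict_diff_stable (F D : U -> U) (a : U) (W : {vspace U}) :
  strict_diff F D a -> (forall (t : R) w, D (t *: w) = t *: D w) ->
  F a = 0 -> (forall x, x - a \in W -> F x \in W) ->
  forall w, w \in W -> D w \in W.
Proof.
move=> sF DZ Fa FW w wW.
have [C C0 hC] := mx_linear_bounded (projv W : {linear _ -> _}).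
suff -> : D w = projv W (D w) by exact: memv_proj.
apply/eqP; rewrite -subr_eq0 -normr_le0.
suff H e : 0 < e -> `|D w - projv W (D w)| <= (1 + C) * `|w| * e.
  apply/ler_addgt0Pr => e e0; rewrite add0r.
  have M0 : 0 < (1 + C) * `|w| + 1.
    by rewrite ltr_pwDr// mulr_ge0// addr_ge0.
  apply: (le_trans (H (e / ((1 + C) * `|w| + 1)) _)); first exact: divr_gt0.
  by rewrite mulrA ler_pdivrMr// mulrC ler_wpM2l ?ltW// ltrDl.
move=> e0; have [_ /(_ _ e0)[d d0 dP]] := sF.
pose t := d / 2 / (1 + `|w|).
have w1 : 0 < 1 + `|w| by rewrite ltr_wpDr.
have t0 : 0 < t by rewrite /t !divr_gt0.
pose y := t^-1 *: F (a + t *: w).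
have yW : y \in W.
  by rewrite memvZ// FW// addrAC subrr add0r memvZ.
have yD : `|D w - y| <= e * `|w|.
  have := dP (a + t *: w) a.
  rewrite subrr normr0 addrAC subrr add0r Fa subr0 normrZ (gtr0_norm t0) => /(_ _ d0).
  rewrite DZ => H.
  have Hd : `|F (a + t *: w) - t *: D w| <= e * (t * `|w|).
    apply: H; rewrite /t.
    apply: (@le_lt_trans _ _ (d / 2)); last by lra.
    by rewrite mulrAC ler_pdivrMr// ler_pM2l ?divr_gt0// lerDr.
  have -> : D w - y = t^-1 *: (t *: D w - F (a + t *: w)).
    by rewrite scalerBr scalerA mulVf ?gt_eqF// scale1r.
  rewrite normrZ gtr0_norm ?invr_gt0// ler_pdivrMl// distrC.
  by rewrite (le_trans Hd)// mulrCA.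
have -> : D w - projv W (D w) = (D w - y) - projv W (D w - y).
  by rewrite linearB /= (projv_id yW) opprB addrA subrK.
rewrite (le_trans (ler_normB _ _))// -mulrA mulrDl mul1r lerD//.
  by rewrite mulrC.
by rewrite (le_trans (hC _))// ler_wpM2l// mulrC.
Qed.

Lemma common_bound (a b c d e f : R) : 0 <= a -> 0 <= b -> 0 <= c -> 0 <= d -> 0 <= e ->
  0 <= f -> let B := 1 + a + b + c + d + e + f in
  [/\ 1 <= B, [/\ a <= B, b <= B & c <= B] & [/\ d <= B, e <= B & f <= B]].
Proof. by move=> a0 b0 c0 d0 e0 f0 B; split; [|split|split]; rewrite /B; lra. Qed.

(** In the rescaled problem of [crandall_rabinowitz], [B] bounds all the
    operators, [r] is the radius of the ball and [e] the precision of the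
    derivatives. This bounds the Lipschitz constant of the remainder, and
    [rescaled_origin] its size at the origin. *)
Lemma rescaled_lipschitz (B r e : R) : 1 <= B -> 0 < r -> r <= 1 -> 0 < e ->
  e * (8 * B ^+ 3) = r ->
  e * (B + 3 * B ^+ 2 + r * B ^+ 2) + r * (2 * B ^+ 3) <= 8 * B ^+ 3 * r.
Proof.
move=> B1 r0 r1 e0 er; have B0 : 0 < B by lra.
have B2 : 1 <= B ^+ 2 by rewrite exprn_ege1.
have B3 : 1 <= B ^+ 3 by rewrite exprn_ege1.
have eb : e <= r by rewrite -er ler_peMr ?ltW//; lra.
have b1 : B <= B ^+ 3 by rewrite [leRHS]exprS ler_peMr// ltW.
have b2 : B ^+ 2 <= B ^+ 3 by rewrite [leRHS]exprS ler_peMl//; lra.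
have b4 : r * B ^+ 2 <= 1 * B ^+ 2 by rewrite ler_wpM2r//; lra.
have X0 : B + 3 * B ^+ 2 + r * B ^+ 2 <= 6 * B ^+ 3 by lra.
have -> : 8 * B ^+ 3 * r = r * (6 * B ^+ 3) + r * (2 * B ^+ 3) by ring.
apply: lerD => //; apply: ler_pM => //; first exact: ltW.
by rewrite !addr_ge0// ?mulr_ge0// ?exprn_ge0// ltW.
Qed.

Lemma rescaled_origin (B r e : R) : 1 <= B -> 0 < e -> e * (8 * B ^+ 3) = r ->
  B * (e * (2 * B) + B * (e * (2 * B))) <= r / 2.
Proof.
move=> B1 e0 <-; have b2 : B ^+ 2 <= B ^+ 3 by rewrite [leRHS]exprS ler_peMl//; nra.
have -> : B * (e * (2 * B) + B * (e * (2 * B))) = e * (2 * B ^+ 2 + 2 * B ^+ 3)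
  by ring.
by rewrite -mulrA ler_pM2l//; lra.
Qed.

Section Pencil.
Variables (F0 F1 : U -> U) (D0 D1 : {linear U -> U}) (a : U) (mu0 : R).
Variable W : {vspace U}.
Hypotheses (sF0 : strict_diff F0 D0 a) (sF1 : strict_diff F1 D1 a).
Hypotheses (F0a : F0 a = 0) (F1a : F1 a = 0).

Let invertible_on_bound (A : {linear U -> U}) :
  (forall w, w \in W -> A w = 0 -> w = 0) ->
  exists2 C : R, 0 <= C & forall w, w \in W -> `|w| <= C * `|A w|.
Proof.
move=> Ainj; pose f : 'End(U) := (linfun A \o projv W)%VF.
pose K : 'End(U) := (projv W \o f^-1)%VF.
have [C C0 hC] := mx_linear_bounded (K : {linear _ -> _}).
exists C => // w wW; apply: le_trans (hC _).
have fw : A w = f w by rewrite /f !lfunE /= lfunE /= projv_id.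
suff {1}-> : w = K (A w) by [].
apply/eqP; rewrite -subr_eq0; apply/eqP; apply: Ainj.
  by rewrite rpredB// /K lfunE /= memv_proj.
rewrite linearB /=.
have -> : A (K (A w)) = f (f^-1%VF (A w)).
  by rewrite /f !lfunE /= lfunE /=; congr (A _); rewrite /K lfunE.
by rewrite fw limg_lfunVK ?subrr// memv_img// memvf.
Qed.

(** The pencil of derivatives at [mu0] is injective on the finite-dimensional
    [W], hence bounded below there, whereas the remainders and the change of
    [mu] contribute less near [a]. *)
Theorem isolated_zero :
  (forall w, w \in W -> D0 w + mu0 *: D1 w = 0 -> w = 0) ->
  exists2 d : R, 0 < d & forall x mu, x - a \in W -> `|x - a| < d ->
    `|mu - mu0| < d -> F0 x + mu *: F1 x = 0 -> x = a.
Proof.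
move=> inj.
have linA : linear (fun w => D0 w + mu0 *: D1 w).
  move=> k u w; rewrite !linearP !scalerDr !scalerA addrACA.
  by [].
pose A : {linear U -> U} := HB.pack (fun w => D0 w + mu0 *: D1 w)
  (GRing.isLinear.Build _ _ _ _ _ linA).
have [C C0 hC] := @invertible_on_bound A inj.
have [C1 C10 hC1] := mx_linear_bounded D1.
pose M := (C + 1) * (C1 + `|mu0| + 3).
have C1p : 0 < C + 1 by lra.
have M0 : 0 < M by rewrite mulr_gt0// ltr_wpDl// addr_ge0.
pose e := Num.min 1 (1 / M).
have e0 : 0 < e by rewrite lt_min ltr01 divr_gt0.
have e1 : e <= 1 by rewrite ge_min lexx.
have eM : e * M <= 1.
  by rewrite -ler_pdivlMr// ge_min lexx orbT.
clearbody e; have [_ /(_ _ e0)[d0 d00 P0]] := sF0; have [_ /(_ _ e0)[d1 d10 P1]] := sF1.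
exists (Num.min e (Num.min d0 d1)); first by rewrite !lt_min e0 d00.
move=> x mu xW; rewrite !lt_min => /andP[_ /andP[xd0 xd1]] /andP[mue _] Fx.
apply/eqP; rewrite -subr_eq0; apply/eqP; set w := x - a.
have Q0 : `|F0 x - D0 w| <= e * `|w|.
  by have := P0 x a xd0; rewrite subrr normr0 F0a subr0; exact.
have Q1 : `|F1 x - D1 w| <= e * `|w|.
  by have := P1 x a xd1; rewrite subrr normr0 F1a subr0; exact.
have Q2 : `|F1 x| <= (C1 + 1) * `|w|.
  rewrite -[F1 x](subrK (D1 w)) (le_trans (ler_normD _ _))// mulrDl addrC lerD//.
  by rewrite (le_trans Q1)// ler_wpM2r.
have Aw : `|A w| <= e * (C1 + `|mu0| + 2) * `|w|.
  have -> : A w = - (F0 x - D0 w) - mu0 *: (F1 x - D1 w) - (mu - mu0) *: F1 x.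
    apply/matrixP => i j; have /(congr1 (fun M : U => M i j)) := Fx.
    rewrite /A /= !mxE => H; move: (D0 w i j) (D1 w i j) => P Q.
    by rewrite -[LHS]subr0 -H; ring.
  apply: (le_trans (ler_normB _ _)).
  have -> : e * (C1 + `|mu0| + 2) * `|w| = (e * `|w| + `|mu0| * (e * `|w|)) + e * ((C1 + 1) * `|w|).
    by ring.
  apply: lerD.
    apply: (le_trans (ler_normB _ _)); rewrite normrN normrZ.
    by rewrite lerD// ler_wpM2l.
  by rewrite normrZ ler_pM// ltW.
have wle := hC w xW.
apply/eqP; rewrite -normr_le0; apply/negP => /negP; rewrite -ltNge => w0.
have : `|w| <= C * (e * (C1 + `|mu0| + 2) * `|w|).
  by rewrite (le_trans wle)// ler_wpM2l.
rewrite !mulrA -[leLHS]mul1r ler_pM2r// => H.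
have : C * e * (C1 + `|mu0| + 2) < e * M.
  rewrite /M; have := normr_ge0 mu0; move: `|mu0| => t t0.
  have h : C * (C1 + t + 2) < (C + 1) * (C1 + t + 3) by nra.
  by rewrite [C * e]mulrC -mulrA ltr_pM2l.
by lra.
Qed.

Hypotheses (F0W : forall x, x - a \in W -> F0 x \in W).
Hypotheses (F1W : forall x, x - a \in W -> F1 x \in W).

(** Bifurcation from a simple eigenvalue of the pencil [D0 + mu * D1]. The
    zeros are sought at [x = a + s *: (v + P z)] and [mu = mu0 + tau (P z)],
    where [P] is the projection to [W] and [s] is a small constant. After
    division by [s] the equation is a small perturbation of the linear one [D0
    w + mu0 *: D1 w + tau w *: D1 v = 0] in [w = P z], which is invertible on
    [W] by hypothesis; the term [z - P z] extends it to the whole space. A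
    contraction then gives [z]. *)
Theorem crandall_rabinowitz (v : U) (tau : {linear U -> R}) :
  v \in W -> v != 0 -> D0 v + mu0 *: D1 v = 0 ->
  (forall w, w \in W -> D0 w + mu0 *: D1 w + tau w *: D1 v = 0 -> w = 0) ->
  forall eps : R, 0 < eps -> exists x mu,
    [/\ x - a \in W, x != a, `|x - a| < eps, `|mu - mu0| < eps &
        F0 x + mu *: F1 x = 0].
Proof.
move=> vW v0 Av inj eps eps0.
pose P : 'End(U) := projv W.
have D0W := strict_diff_stable sF0 (fun t w => linearZ _ _) F0a F0W.
have D1W := strict_diff_stable sF1 (fun t w => linearZ _ _) F1a F1W.
pose L z := D0 (P z) + mu0 *: D1 (P z) + tau (P z) *: D1 v + (z - P z).
have linL : linear L.
  move=> k u w; apply/matrixP => i j.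
  rewrite /L !linearP /= !mxE. rewrite -[k *: tau _]/(k * tau _); ring.
pose LL : {linear U -> U} := HB.pack L (GRing.isLinear.Build _ _ _ _ _ linL).
pose Lf : 'End(U) := linfun LL.
have LfE z : Lf z = L z by rewrite lfunE.
have kerL : lker Lf == 0%VS.
  apply/eqP/vspaceP => z; rewrite memv0; apply/idP/eqP => [|->]; last by rewrite mem0v.
  rewrite memv_ker LfE => /eqP Lz.
  have PzW : P z \in W by rewrite memv_proj.
  have AW : D0 (P z) + mu0 *: D1 (P z) + tau (P z) *: D1 v \in W.
    by rewrite !rpredD ?rpredZ ?D0W ?D1W.
  have APz : D0 (P z) + mu0 *: D1 (P z) + tau (P z) *: D1 v = 0.
    have := congr1 P Lz; rewrite /L linearD /= linearB /= linear0.
    by rewrite (projv_id AW) projv_proj subrr addr0.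
  have Pz0 := inj _ PzW APz.
  by move: Lz; rewrite /L APz add0r Pz0 subr0.
pose K : 'End(U) := (Lf^-1)%VF.
have LK : cancel L K by move=> z; rewrite -LfE lker0_lfunK.
have Kinj : injective K by apply: can_inj (lker0_lfunVK kerL).
have [CK CK0 hK] := mx_linear_bounded (K : {linear _ -> _}).
have [CP CP0 hP] := mx_linear_bounded (P : {linear _ -> _}).
have [C1 C10 h1] := mx_linear_bounded D1.
have [Ct Ct0 ht] := mx_linear_bounded tau.
pose B := 1 + CK + CP + C1 + Ct * CP + `|mu0| + `|v|.
have CtP0 : 0 <= Ct * CP by rewrite mulr_ge0.
have [B1 [BK BP BC] [Bt Bm Bv]] : [/\ 1 <= B, [/\ CK <= B, CP <= B & C1 <= B] &
    [/\ Ct * CP <= B, `|mu0| <= B & `|v| <= B]] by exact: common_bound.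
clearbody B.
have PB z : `|P z| <= B * `|z| by rewrite (le_trans (hP z))// ler_wpM2r.
have KB z : `|K z| <= B * `|z| by rewrite (le_trans (hK z))// ler_wpM2r.
have DB z : `|D1 z| <= B * `|z| by rewrite (le_trans (h1 z))// ler_wpM2r.
have tB z : `|tau (P z)| <= B * `|z|.
  rewrite (le_trans (ht _))// (le_trans (ler_wpM2l Ct0 (hP z)))// mulrA.
  by rewrite ler_wpM2r.
have B0 : 0 < B by apply: lt_le_trans B1.
have vn0 : 0 < `|v| by rewrite normr_gt0.
(* The three bounds on [r] make the map a contraction, keep [P z] smaller than
   [v] so that the zero found differs from [a], and keep [mu] close to [mu0].
   *)
pose r := Num.min (1 / (16 * B ^+ 4)) (Num.min (`|v| / (2 * B)) (eps / (2 * B))).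
have r0 : 0 < r by rewrite !lt_min !divr_gt0 ?mulr_gt0 ?exprn_gt0.
have r1 : r * (16 * B ^+ 4) <= 1.
  by rewrite -ler_pdivlMr ?mulr_gt0 ?exprn_gt0// ge_min lexx.
have rv : r * (2 * B) <= `|v|.
  by rewrite -ler_pdivlMr ?mulr_gt0// !ge_min lexx !orbT.
have re : r * (2 * B) <= eps.
  by rewrite -ler_pdivlMr ?mulr_gt0// !ge_min lexx !orbT.
clearbody r.
pose e := r / (8 * B ^+ 3).
have e0 : 0 < e by rewrite divr_gt0 ?mulr_gt0 ?exprn_gt0.
have er : e * (8 * B ^+ 3) = r by rewrite divfK// gt_eqF ?mulr_gt0 ?exprn_gt0.
clearbody e.
have [_ /(_ _ e0)[d0 d00 P0]] := sF0; have [_ /(_ _ e0)[d1 d10 P1]] := sF1.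
(* With this [s] all the points [a + s *: (v + P z)] lie where the derivatives
   of [F0] and [F1] have the precision [e]. *)
pose s := Num.min eps (Num.min d0 d1) / (4 * B).
have s0 : 0 < s by rewrite divr_gt0 ?mulr_gt0// !lt_min eps0 d00.
have sB : s * (4 * B) = Num.min eps (Num.min d0 d1).
  by rewrite divfK// gt_eqF ?mulr_gt0.
have [se sd0 sd1] : [/\ s * (2 * B) < eps, s * (2 * B) < d0 & s * (2 * B) < d1].
  have h : s * (2 * B) < s * (4 * B) by rewrite ltr_pM2l// ltr_pM2r// ltr_nat.
  by split; rewrite (lt_le_trans h)// sB !ge_min lexx ?orbT.
clearbody s.
have B2 : 1 <= B ^+ 2 by rewrite exprn_ege1.
have r1' : r <= 1.
  apply: le_trans r1; rewrite ler_peMr ?ltW// [B ^+ 4](exprM B 2 2).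
  have : 1 <= (B ^+ 2) ^+ 2 by rewrite exprn_ege1.
  by lra.
pose y z := v + P z.
have yB z : `|z| <= r -> `|y z| <= 2 * B.
  move=> zr; rewrite (le_trans (ler_normD _ _))//.
  have := PB z; have : B * `|z| <= B * 1 by rewrite ler_pM2l// (le_trans zr).
  by lra.
have ysmall z d : `|z| <= r -> s * (2 * B) < d -> `|a + s *: y z - a| < d.
  move=> zr; apply: le_lt_trans; rewrite addrAC subrr add0r normrZ gtr0_norm//.
  by rewrite ler_pM2l// yB.
pose g (F : U -> U) z := s^-1 *: F (a + s *: y z).
have gP (F D : U -> U) d : (forall (t : R) w, D (t *: w) = t *: D w) -> F a = 0 ->
    s * (2 * B) < d ->
    (forall y y', `|y - a| < d -> `|y' - a| < d ->
      `|F y - F y' - D (y - y')| <= e * `|y - y'|) ->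
    (forall z z', `|z| <= r -> `|z'| <= r ->
      `|g F z - g F z' - D (P (z - z'))| <= e * (B * `|z - z'|)) /\
    (forall z, `|z| <= r -> `|g F z - D (y z)| <= e * (2 * B)).
  move=> DZ Fa sd FP; split=> [z z' zr z'r|z zr].
    have -> : g F z - g F z' - D (P (z - z')) =
      s^-1 *: (F (a + s *: y z) - F (a + s *: y z') - D (a + s *: y z - (a + s *: y z'))).
      rewrite /g scalerBr scalerBr -DZ; congr (_ - D _).
      rewrite opprD addrACA subrr add0r -scalerBr scalerA mulVf ?gt_eqF// scale1r.
      by rewrite /y opprD addrACA subrr add0r linearB.
    rewrite normrZ gtr0_norm ?invr_gt0// ler_pdivrMl//.
    apply: (le_trans (FP _ _ (ysmall _ _ zr sd) (ysmall _ _ z'r sd))).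
    rewrite opprD addrACA subrr add0r -scalerBr normrZ gtr0_norm// mulrCA.
    rewrite ler_pM2l// ler_pM2l//.
    by rewrite /y opprD addrACA subrr add0r -linearB PB.
  have -> : g F z - D (y z) =
    s^-1 *: (F (a + s *: y z) - F a - D (a + s *: y z - a)).
    rewrite /g Fa subr0 scalerBr -DZ; congr (_ - D _).
    by rewrite addrAC subrr add0r scalerA mulVf ?gt_eqF// scale1r.
  rewrite normrZ gtr0_norm ?invr_gt0// ler_pdivrMl//.
  apply: (le_trans (FP _ _ (ysmall _ _ zr sd) _)).
    by rewrite subrr normr0 (le_lt_trans _ sd)// ltW// !mulr_gt0.
  rewrite addrAC subrr add0r normrZ gtr0_norm// mulrCA.
  by rewrite ler_pM2l// ler_pM2l// yB.
have [G0L G0v] := gP F0 D0 d0 (fun t w => linearZ _ _) F0a sd0 P0.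
have [G1L G1v] := gP F1 D1 d1 (fun t w => linearZ _ _) F1a sd1 P1.
pose G z := g F0 z + (mu0 + tau (P z)) *: g F1 z + (z - P z).

have GL z z' : `|z| <= r -> `|z'| <= r ->
    `|G z - G z' - L (z - z')| <= 8 * B ^+ 3 * r * `|z - z'|.
  move=> zr z'r; set h := z - z'.
  have -> : G z - G z' - L h = (g F0 z - g F0 z' - D0 (P h))
    + mu0 *: (g F1 z - g F1 z' - D1 (P h))
    + (tau (P h) *: (g F1 z - D1 v) + tau (P z') *: (g F1 z - g F1 z')).
    rewrite /G /L; have -> : P h = P z - P z' by rewrite linearB.
    rewrite !(linearB tau); apply/matrixP => i j; rewrite !mxE.
    by ring.
  have q1 : `|g F1 z - D1 v| <= e * (2 * B) + B * (B * r).
    have -> : g F1 z - D1 v = (g F1 z - D1 (y z)) + D1 (P z).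
      by rewrite /y linearD opprD addrA subrK.
    rewrite (le_trans (ler_normD _ _))// lerD ?G1v//.
    rewrite (le_trans (DB _))// ler_pM2l// (le_trans (PB _))//.
    by rewrite ler_pM2l.
  have q2 : `|g F1 z - g F1 z'| <= e * (B * `|h|) + B * (B * `|h|).
    rewrite -[g F1 z - g F1 z'](subrK (D1 (P h))) (le_trans (ler_normD _ _))//.
    rewrite lerD ?G1L//.
    by rewrite (le_trans (DB _))// ler_pM2l// (le_trans (PB _)).
  have q3 : `|tau (P z')| <= B * r by rewrite (le_trans (tB _))// ler_pM2l.
  apply: (@le_trans _ _ (e * (B * `|h|) + B * (e * (B * `|h|)) +
    (B * `|h| * (e * (2 * B) + B * (B * r)) +
     B * r * (e * (B * `|h|) + B * (B * `|h|))))).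
    rewrite (le_trans (ler_normD _ _))// lerD//.
      rewrite (le_trans (ler_normD _ _))// lerD ?G0L//.
      by rewrite normrZ ler_pM// G1L.
    rewrite (le_trans (ler_normD _ _))// lerD// normrZ ler_pM//.
  have -> : e * (B * `|h|) + B * (e * (B * `|h|)) +
    (B * `|h| * (e * (2 * B) + B * (B * r)) +
     B * r * (e * (B * `|h|) + B * (B * `|h|))) =
    (e * (B + 3 * B ^+ 2 + r * B ^+ 2) + r * (2 * B ^+ 3)) * `|h| by ring.
  by rewrite ler_wpM2r// rescaled_lipschitz.
have G0B : B * `|G 0| <= r / 2.
  have -> : G 0 = (g F0 0 - D0 (y 0)) + mu0 *: (g F1 0 - D1 (y 0)).
    rewrite /G linear0 linear0 addr0 subrr addr0 scalerBr addrACA -opprD.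
    by rewrite /y linear0 addr0 Av subr0.
  have z0 : `|0 : U| <= r by rewrite normr0 ltW.
  have hh : `|g F0 0 - D0 (y 0) + mu0 *: (g F1 0 - D1 (y 0))| <=
      e * (2 * B) + B * (e * (2 * B)).
    rewrite (le_trans (ler_normD _ _))// lerD ?G0v// normrZ ler_pM//.
    exact: G1v.
  apply: (le_trans (ler_wpM2l (ltW B0) hh)).
  exact: rescaled_origin.
have KC : B * (8 * B ^+ 3 * r) <= 1 / 2.
  have -> : B * (8 * B ^+ 3 * r) = r * (16 * B ^+ 4) / 2 by field.
  by rewrite ler_pM2r ?invr_gt0.
have [z zr Gz] := @near_linear_zero G L K B (8 * B ^+ 3 * r) r (ltW r0) (ltW B0) LK Kinj KB KC G0B GL.
have aW : a + s *: y z - a \in W by rewrite addrAC subrr add0r rpredZ// rpredD// memv_proj.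
have gW : g F0 z + (mu0 + tau (P z)) *: g F1 z \in W.
  by rewrite rpredD// ?rpredZ// ?F0W ?F1W.
have gz : g F0 z + (mu0 + tau (P z)) *: g F1 z = 0.
  have := congr1 P Gz; rewrite /G linearD /= (projv_id gW) linearB /= projv_proj.
  by rewrite subrr addr0 linear0.
exists (a + s *: y z), (mu0 + tau (P z)); split => //.
- rewrite -subr_eq0 addrAC subrr add0r scaler_eq0 gt_eqF//=.
  rewrite /y addr_eq0; apply/eqP => vE.
  have : `|v| <= B * r.
    by rewrite vE normrN (le_trans (PB z))// ler_pM2l.
  have : B * r < r * (2 * B) by rewrite mulrCA [r * B]mulrC ltr_pMl ?mulr_gt0// ltr1n.
  by move=> /lt_le_trans/(_ rv) h1' /le_lt_trans/(_ h1'); rewrite ltxx.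
- exact: ysmall.
- rewrite addrAC subrr add0r (le_lt_trans (tB z))//.
  apply: (@le_lt_trans _ _ (B * r)); first by rewrite ler_pM2l.
  by apply: lt_le_trans re; rewrite mulrCA [r * B]mulrC ltr_pMl ?mulr_gt0// ltr1n.
- move/eqP: gz; rewrite /g scalerA [_ * s^-1]mulrC -scalerA -scalerDr.
  by rewrite scaler_eq0 invr_eq0 gt_eqF//= => /eqP.
Qed.

End Pencil.
End Bifurcation.

Local Open Scope complex_scope.
(** * Roots of unity and discrete Fourier coefficients *)

Section Roots.
Context {R : realType}.

Lemma cisD (s t : R) : cis (s + t) = cis s * cis t.
Proof. by rewrite /cis cosD sinD; congr (_ +i* _); ring. Qed.

Lemma cis0 : cis (0 : R) = 1.
Proof. by rewrite /cis cos0 sin0. Qed.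

Lemma cisJ (t : R) : (cis t)^* = cis (- t).
Proof. by rewrite /cis cosN sinN. Qed.

Lemma ReD (x y : R[i]) : complex.Re (x + y) = complex.Re x + complex.Re y.
Proof. by case: x; case: y. Qed.

Lemma Re_sum (I : Type) (r : seq I) (P : pred I) (F : I -> R[i]) :
  complex.Re (\sum_(i <- r | P i) F i) = \sum_(i <- r | P i) complex.Re (F i).
Proof. exact: (big_morph _ ReD). Qed.

Lemma Re_realM (x : R) (w : R[i]) : complex.Re (x%:C * w) = x * complex.Re w.
Proof. by case: w => a b /=; ring. Qed.

Lemma conjc_fix (w : R[i]) : w^* = w -> w = (complex.Re w)%:C.
Proof. by case: w => a b [] h; congr (_ +i* _); lra. Qed.

Variables (n : nat) (n0 : (0 < n)%N).

(** The vertex of index [t], for a real [t]. *)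
Definition wv (t : R) : R[i] := cis (t * zeta R n).

Let n0R : (n%:R : R) != 0. Proof. by rewrite pnatr_eq0 -lt0n. Qed.

Lemma wvD s t : wv (s + t) = wv s * wv t.
Proof. by rewrite /wv mulrDl cisD. Qed.

Lemma wv0 : wv 0 = 1. Proof. by rewrite /wv mul0r cis0. Qed.

Lemma wvJ t : (wv t)^* = wv (- t).
Proof. by rewrite /wv cisJ mulNr. Qed.

Lemma wvNM t : wv (- t) * wv t = 1.
Proof. by rewrite -wvD addNr wv0. Qed.

Lemma wv_neq0 t : wv t != 0.
Proof.
by apply/eqP => h; have /eqP := wvNM t; rewrite h mulr0 eq_sym oner_eq0.
Qed.

Lemma Re_wv t : complex.Re (wv t) = cos (t * zeta R n).
Proof. by []. Qed.

Lemma wvn : wv n%:R = 1.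
Proof.
have -> : wv n%:R = cis (pi *+ 2).
  by rewrite /wv /zeta mulrC divfK// mulr_natl.
by rewrite /cis cos2pi sin2pi.
Qed.

Lemma wv_exp t k : wv (k%:R * t) = wv t ^+ k.
Proof.
by elim: k => [|k IH]; rewrite ?mul0r ?wv0// exprSr -IH -wvD; congr wv; ring.
Qed.

(** For a real [t] this holds exactly when [t] is an integer. Modes are kept
    real so that [- k] and [k - 1] are modes too, without any reduction modulo
    [n]. *)
Definition integral_mode (t : R) := wv (n%:R * t) = 1.

Lemma mode_nat k : integral_mode k%:R.
Proof. by rewrite /integral_mode mulrC wv_exp wvn expr1n. Qed.

Lemma modeN t : integral_mode t -> integral_mode (- t).
Proof. by rewrite /integral_mode mulrN => h; rewrite -wvJ h rmorph1. Qed.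

Lemma modeD s t : integral_mode s -> integral_mode t -> integral_mode (s + t).
Proof. by rewrite /integral_mode mulrDr wvD => -> ->; rewrite mulr1. Qed.

Lemma modeB s t : integral_mode s -> integral_mode t -> integral_mode (s - t).
Proof. by move=> hs ht; apply: modeD => //; exact: modeN. Qed.

Lemma mode1 : integral_mode 1. Proof. exact: (mode_nat 1). Qed.

Lemma sin_half_gt0 l : (0 < l < n)%N -> 0 < sin (l%:R * zeta R n / 2).
Proof.
move=> /andP[l0 ln]; apply: sin_gt0_pi; rewrite /zeta.
have -> : l%:R * (2 * pi / n%:R) / 2 = l%:R / n%:R * pi :> R by field.
have n0' : (0 : R) < n%:R by rewrite ltr0n.
rewrite mulr_gt0 ?pi_gt0// ?divr_gt0 ?ltr0n//=.
by rewrite gtr_pMl ?pi_gt0// ltr_pdivrMr// mul1r ltr_nat.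
Qed.

Lemma cos_half (x : R) : cos x = 1 - 2 * sin (x / 2) ^+ 2.
Proof.
have {1}-> : x = (x / 2) *+ 2 by rewrite -mulr_natr divfK// pnatr_eq0.
by rewrite cos_mulr2n cos2sin2; ring.
Qed.

Lemma wv_eq1 k : (wv k%:R == 1) = (n %| k)%N.
Proof.
have small l : (0 < l < n)%N -> wv l%:R != 1.
  move=> hl; apply/eqP => h; have := congr1 (@complex.Re R) h.
  rewrite Re_wv cos_half /= => hc; have := sin_half_gt0 hl.
  have := hc; set s := sin _ => hc' s0.
  by have := exprn_gt0 2 s0; lra.
rewrite {1}(divn_eq k n) natrD natrM wvD.
rewrite (_ : wv _ = 1) ?mul1r; last by rewrite wv_exp wvn expr1n.
rewrite /dvdn; have [->|k0] := posnP (k %% n)%N; first by rewrite wv0 !eqxx.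
by rewrite (negPf (small _ _)) ?k0 ?ltn_pmod// gtn_eqF.
Qed.

(** ** Sums over the roots of unity *)

Definition periodic_fun (f : R -> R[i]) := forall x, f (x + n%:R) = f x.

Lemma periodic_wv t : integral_mode t -> periodic_fun (fun x => wv (x * t)).
Proof. by move=> ht x; rewrite mulrDl wvD ht mulr1. Qed.

Lemma sum_succ f x : periodic_fun f ->
  \sum_(l < n) f (x + l.+1%:R) = \sum_(l < n) f (x + l%:R).
Proof.
move=> pf; apply/eqP; rewrite -subr_eq0 -sumrB.
rewrite -(big_mkord xpredT (fun l => f (x + l.+1%:R) - f (x + l%:R))).
by rewrite (telescope_sumr (fun l => f (x + l%:R)))// pf addr0 subrr.
Qed.

Lemma sum_shift f x j : periodic_fun f ->
  \sum_(l < n) f (x - j%:R + l%:R) = \sum_(l < n) f (x + l%:R).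
Proof.
move=> pf; elim: j => [|j IH]; first by under eq_bigr do rewrite subr0.
rewrite -IH -[LHS]sum_succ//; apply: eq_bigr => l _; congr f.
by rewrite -natr1 -[l.+1%:R]natr1; ring.
Qed.

Lemma outer_sumE (f : R -> R[i]) :
  \sum_(i < n.+1 | i != 0) f i%:R = \sum_(l < n) f l.+1%:R.
Proof.
by rewrite big_mkcond big_ord_recl /= add0r; apply: eq_bigr => l _.
Qed.

Lemma outer_sum_shift f (j : nat) : periodic_fun f ->
  \sum_(i < n.+1 | i != 0) f (i%:R - j%:R) = \sum_(l < n) f l%:R.
Proof.
move=> pf; rewrite (outer_sumE (fun x => f (x - j%:R))).
transitivity (\sum_(l < n) f (0 + l%:R)); last first.
  by apply: eq_bigr => l _; rewrite add0r.
rewrite -(sum_shift 0 j pf) -[RHS]sum_succ//.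
by apply: eq_bigr => l _; congr f; ring.
Qed.

Lemma outer_sum f : periodic_fun f ->
  \sum_(i < n.+1 | i != 0) f i%:R = \sum_(l < n) f l%:R.
Proof.
by move=> pf; rewrite -(outer_sum_shift 0 pf); apply: eq_bigr => i _; rewrite subr0.
Qed.

Lemma sum_neg f : periodic_fun f ->
  \sum_(l < n) f (- l%:R) = \sum_(l < n) f l%:R.
Proof.
move=> pf; transitivity (\sum_(l < n) f (0 + l%:R)); last first.
  by apply: eq_bigr => l _; rewrite add0r.
rewrite -[RHS]sum_succ// (reindex_inj rev_ord_inj) /=.
apply: eq_bigr => l _; rewrite natrB//.
by rewrite -[in LHS]pf; congr f; rewrite -natr1; ring.
Qed.

Lemma sum_wv t : integral_mode t ->
  \sum_(l < n) wv (l%:R * t) = if wv t == 1 then n%:R else 0.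
Proof.
move=> ht; under eq_bigr do rewrite wv_exp.
case: eqP => [->|/eqP t1].
  by under eq_bigr do rewrite expr1n; rewrite sumr_const card_ord.
have /eqP := subrX1 (wv t) n.
rewrite -wv_exp ht subrr eq_sym mulf_eq0 subr_eq0 (negPf t1) /= => /eqP.
exact.
Qed.

Lemma sum_wv_outer t : integral_mode t ->
  \sum_(j < n.+1 | j != 0) wv (j%:R * t) = if wv t == 1 then n%:R else 0.
Proof.
by move=> ht; rewrite (outer_sum (periodic_wv ht)) sum_wv.
Qed.

(** The Fourier coefficient of the displacement read in the frame that turns
    with the vertices, [j |-> w j / wv j], which accounts for [t + 1] instead
    of [t]. In that frame the rotations of the group only shift the index and
    the reflection only conjugates. *)
Definition fourier (w : 'I_n.+1 -> R[i]) (t : R) : R[i] :=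
  \sum_(j < n.+1 | j != 0) wv (- (j%:R * (t + 1))) * w j.

Lemma fourier_inversion w : (forall m : nat, (m < n)%N -> fourier w m%:R = 0) ->
  forall j, j != 0 -> w j = 0.
Proof.
move=> h j0 j0n.
have : \sum_(m < n) wv (m%:R * j0%:R) * fourier w m%:R = 0.
  by apply: big1 => m _; rewrite h// mulr0.
have E (m : 'I_n) (i : 'I_n.+1) : wv (m%:R * j0%:R) * (wv (- (i%:R * (m%:R + 1))) * w i) =
    wv (m%:R * (j0%:R - i%:R)) * (wv (- i%:R) * w i).
  by rewrite mulrA [RHS]mulrA -!wvD; congr (wv _ * _); ring.
rewrite /fourier; under eq_bigr do rewrite mulr_sumr.
rewrite exchange_big /=; under eq_bigr do under eq_bigr do rewrite E.
rewrite (bigD1 j0)//= [X in _ + X]big1 ?addr0.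
  under eq_bigr do rewrite subrr mulr0 wv0 mul1r.
  rewrite sumr_const card_ord -[_ *+ n]mulr_natl => /eqP.
  by rewrite !mulf_eq0 (negPf (wv_neq0 _)) /= pnatr_eq0 gtn_eqF//= => /eqP.
move=> j /andP[jn jj0].
rewrite -mulr_suml sum_wv; last by apply: modeB; exact: mode_nat.
case: ifP => [/eqP wj|]; last by rewrite mul0r.
case/eqP: jj0.
have wle (a b : 'I_n.+1) : a != 0 -> (a <= b)%N -> wv (b%:R - a%:R) = 1 -> a = b.
  move=> a0 ab; rewrite -natrB// => /eqP; rewrite wv_eq1 => d.
  have := ltn_ord b; rewrite ltnS => bn.
  apply: val_inj => /=; apply/eqP; rewrite eqn_leq ab /= -subn_eq0.
  rewrite -leqn0 leqNgt; apply/negP => /dvdn_leq /(_ d).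
  have : (0 < a)%N by rewrite lt0n.
  lia.
have [jj|jj] := leqP j j0; first exact: wle.
apply/esym/wle => //; first exact: ltnW.
by rewrite -[LHS]conjcK wvJ opprB wj rmorph1.
Qed.

(** ** Interaction coefficients of the regular polygon *)

Variable alpha : R.
Hypothesis alpha1 : 1 <= alpha.

(** The force divided by the displacement, as a function of the squared
    distance [q]; this avoids square roots. *)
Definition rho (q : R) : R := q `^ (- ((alpha + 1) / 2)).

(** [rho] of the squared chord between two vertices [x] steps apart. *)
Definition kappa (x : R) : R := rho (2 - 2 * cos (x * zeta R n)).

(** The eigenvalue at the mode [t] of the graph Laplacian of the polygon with
    weights [kappa]. *)
Definition mode_sum (t : R) : R :=
  \sum_(l < n) kappa l%:R * (1 - cos (l%:R * t * zeta R n)).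
Local Notation smode := mode_sum.

Lemma rho_gt0 q : 0 < q -> 0 < rho q.
Proof. exact: powR_gt0. Qed.

Lemma cos_wv x : cos (x * zeta R n) = complex.Re (wv x). Proof. by []. Qed.

Lemma kappa_periodic x : kappa (x + n%:R) = kappa x.
Proof. by rewrite /kappa !cos_wv wvD wvn mulr1. Qed.

Lemma kappaN x : kappa (- x) = kappa x.
Proof. by rewrite /kappa mulNr cosN. Qed.

Lemma sum_kappa_wv t : integral_mode t ->
  \sum_(l < n) (kappa l%:R)%:C * wv (l%:R * t) =
  (\sum_(l < n) kappa l%:R - smode t)%:C.
Proof.
move=> ht.
have -> : \sum_(l < n) kappa l%:R - smode t =
    complex.Re (\sum_(l < n) (kappa l%:R)%:C * wv (l%:R * t)).
  rewrite Re_sum /smode -sumrB; apply: eq_bigr => l _.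
  by rewrite Re_realM Re_wv; ring.
apply: conjc_fix; rewrite rmorph_sum.
pose f (x : R) := (kappa x)%:C * wv (x * t).
have pf : periodic_fun f.
  by move=> x; rewrite /f kappa_periodic (periodic_wv ht).
rewrite -[RHS](sum_neg pf); apply: eq_bigr => l _.
by rewrite [LHS]rmorphM; congr (_ * _); rewrite ?kappaN ?mulNr -?wvJ//; exact: conjc_real.
Qed.

Lemma smode0 : smode 0 = 0.
Proof. by apply: big1 => l _; rewrite mulr0 mul0r cos0 subrr mulr0. Qed.

Lemma smodeN t : smode (- t) = smode t.
Proof. by apply: eq_bigr => l _; rewrite mulrN mulNr cosN. Qed.

Lemma smodeDn t : smode (t + n%:R) = smode t.
Proof.
apply: eq_bigr => l _; rewrite !cos_wv; congr (_ * (1 - complex.Re _)).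
by rewrite mulrDr wvD [X in _ * wv X]mulrC (mode_nat l) mulr1.
Qed.

Lemma kappa_chord l : (0 < l < n)%N -> 0 < 2 - 2 * cos (l%:R * zeta R n).
Proof.
move=> hl; rewrite cos_half; have := exprn_gt0 2 (sin_half_gt0 hl); lra.
Qed.

Lemma kappa_gt0 l : (0 < l < n)%N -> 0 < kappa l%:R.
Proof. by move=> hl; apply/rho_gt0/kappa_chord. Qed.

Lemma smodeE t : smode t =
  \sum_(1 <= l < n) kappa l%:R * (1 - cos (l%:R * t * zeta R n)).
Proof.
rewrite /smode.
rewrite -(big_mkord xpredT (fun l => kappa l%:R * (1 - cos (l%:R * t * zeta R n)))).
by rewrite big_ltn//= !mul0r cos0 subrr mulr0 add0r.
Qed.

Lemma smode1 : smode 1 = s1 alpha n.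
Proof.
rewrite smodeE /s1 mulr_sumr big_nat [RHS]big_nat; apply: eq_bigr => l hl.
rewrite mulr1 /kappa cos_half; have := sin_half_gt0 hl.
set s := sin _ => s0.
have -> : 2 - 2 * (1 - 2 * s ^+ 2) = (2 * s) ^+ 2 by ring.
have s20 : 0 < 2 * s by rewrite mulr_gt0.
rewrite /rho -powR_mulrn ?ltW// -powRrM.
have -> : 2 * - ((alpha + 1) / 2) = - (alpha + 1) :> R by field.
have -> : (2 * s) `^ (- (alpha + 1)) = (2 `^ alpha * 2 * (s `^ (alpha - 1) * s ^+ 2))^-1.
  rewrite powRN powRM ?ltW//; congr (_ * _)^-1.
    by rewrite powRD ?powRr1// pnatr_eq0 implybT.
  have {1}-> : alpha + 1 = alpha - 1 + 2 by ring.
  rewrite powRD; last by rewrite (gt_eqF s0) implybT.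
  by rewrite powR_mulrn// ltW.
by field; rewrite !gt_eqF ?powR_gt0.
Qed.

Lemma smode_gt0 k : ~~ (n %| k)%N -> 0 < smode k%:R.
Proof.
move=> nk.
have k1 : cos (k%:R * zeta R n) < 1.
  rewrite lt_neqAle cos_le1 andbT; apply/eqP => c1.
  have s0 : sin (k%:R * zeta R n) = 0.
    by apply/eqP; rewrite -sqrf_eq0 sin2cos2 c1 expr1n subrr.
  by move: nk; rewrite -wv_eq1 /wv /cis c1 s0 eqxx.
have n1 : (1 < n)%N.
  rewrite ltnNge; apply/negP => n1; have /eqP nE : n == 1%N by rewrite eqn_leq n1 n0.
  by move: nk; rewrite nE dvd1n.
rewrite smodeE big_ltn// ltr_pwDl//.
  by rewrite mulr_gt0 ?kappa_gt0// mul1r subr_gt0.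
rewrite big_nat; apply: sumr_ge0 => l /andP[l1 l2].
apply: mulr_ge0; last by rewrite subr_ge0 cos_le1.
by apply/ltW/kappa_gt0; rewrite l2 (ltn_trans _ l1).
Qed.

(** In the sum over the chords each term of the left-hand side is the
    corresponding term of [2 * smode t] multiplied by the cosine of the angle
    that the chord subtends. This bound makes the blocks nondegenerate where
    the rotation rate vanishes. *)
Lemma smode_second_difference t :
  `|(smode (t + 1) - smode 1) + (smode (t - 1) - smode 1)| <= 2 * smode t.
Proof.
rewrite !smodeE mulr_sumr -!sumrB -big_split /=.
apply: le_trans (ler_norm_sum _ _ _) _; rewrite [leLHS]big_nat [leRHS]big_nat.
apply: ler_sum => l hl; set x := l%:R * zeta R n.
have -> : l%:R * (t + 1) * zeta R n = l%:R * t * zeta R n + x by rewrite /x; ring.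
have -> : l%:R * (t - 1) * zeta R n = l%:R * t * zeta R n - x by rewrite /x; ring.
rewrite mulr1 -/x cosD cosB; set c := cos (l%:R * t * zeta R n).
set d := cos x; set k := kappa _.
have -> : k * (1 - (c * d - sin (l%:R * t * zeta R n) * sin x)) - k * (1 - d) +
  (k * (1 - (c * d + sin (l%:R * t * zeta R n) * sin x)) - k * (1 - d)) =
  2 * (k * (d * (1 - c))) by ring.
have k0 : 0 < k by exact: kappa_gt0.
rewrite normrM (ger0_norm (_ : 0 <= 2))// ler_pM2l// normrM gtr0_norm//.
rewrite ler_pM2l// normrM.
have c1 : 0 <= 1 - c by rewrite subr_ge0 cos_le1.
by rewrite [`|1 - c|]ger0_norm// ler_piMl// cos_max.
Qed.

End Roots.

(** * The equations of relative equilibria *)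

Section Field.
Context {R : realType} {n : nat}.
Variable alpha : R.
Implicit Types (x w : config R n) (i j : 'I_n.+1) (c : 'I_2).

Definition sqdist x i j : R := \sum_c (x j c - x i c) ^+ 2.

(** The gradient of the amended potential with respect to each body, divided
    by the mass of that body. It is linear in [(om, m)] together, so that it
    is affine in [mu]. *)
Definition field (om : R) (m : 'I_n.+1 -> R) x : config R n :=
  \matrix_(j, c) (om * x j c -
    \sum_i m i * (rho alpha (sqdist x i j) * (x j c - x i c))).

Definition rho' (q : R) : R := - ((alpha + 1) / 2) * (rho alpha q / q).

Definition dfield (om : R) (m : 'I_n.+1 -> R) x w : config R n :=
  \matrix_(j, c) (om * w j c - \sum_i m i *
    \sum_c' ((c == c')%:R * rho alpha (sqdist x i j) +
       2 * rho' (sqdist x i j) * (x j c - x i c) * (x j c' - x i c')) *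
       (w j c' - w i c')).

Definition collision_free x := forall i j, i != j -> sqdist x i j != 0.

Lemma sqdist_ge0 x i j : 0 <= sqdist x i j.
Proof. by apply: sumr_ge0 => c _; rewrite sqr_ge0. Qed.

Lemma sqdist_gt0 x i j : collision_free x -> i != j -> 0 < sqdist x i j.
Proof. by move=> cf ij; rewrite lt0r cf// sqdist_ge0. Qed.

Lemma entry_bounded j c : bounded_map (fun w : config R n => w j c).
Proof.
exists 1 => // w; rewrite mul1r [`|w|]mx_normrE.
exact: (le_bigmax _ (fun jc => `|w jc.1 jc.2|) (j, c)).
Qed.

Lemma strict_diff_entry x j c :
  strict_diff (fun w : config R n => w j c) (fun w => w j c) x.
Proof.
by apply: strict_diff_lin; [exact: entry_bounded|move=> u v; rewrite !mxE].
Qed.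

Lemma strict_diff_gap x i j c :
  strict_diff (fun w : config R n => w j c - w i c) (fun w => w j c - w i c) x.
Proof.
apply: strict_diff_lin.
  have [C C0 hC] := entry_bounded j c; have [C' C0' hC'] := entry_bounded i c.
  exists (C + C'); first exact: addr_ge0.
  by move=> w; rewrite mulrDl (le_trans (ler_normB _ _))// lerD.
by move=> u v; rewrite !mxE; ring.
Qed.

Lemma strict_diff_sqdist x i j :
  strict_diff (fun x => sqdist x i j)
    (fun w => \sum_c 2 * (x j c - x i c) * (w j c - w i c)) x.
Proof.
apply: (@strict_diff_sum _ _ _ _ _ _ (fun c (w : config R n) => (w j c - w i c) ^+ 2)) => c _.
have := strict_diffM (strict_diff_gap x i j c) (strict_diff_gap x i j c).
by congr strict_diff; apply/funext => w; rewrite ?expr2//; ring.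
Qed.

Lemma rho_continuous (q : R) : 0 < q -> {for q, continuous (rho alpha)}.
Proof.
move=> q0; apply: differentiable_continuous; apply/derivable1_diffP.
by apply: derivable_powR; rewrite in_itv/= andbT.
Qed.

Lemma strict_diff_rho (q : R) : 0 < q -> strict_diff (rho alpha) ( *%R (rho' q)) q.
Proof.
move=> q0; apply: (@strict_diff_C1 _ _ rho').
  near=> t; have t0 : 0 < t by near: t; exact: lt_nbhsr.
  apply: is_derive_eq; first exact: is_derive1_powR.
  rewrite /rho' /rho powRD; last by rewrite (gt_eqF t0) implybT.
  by rewrite powR_inv1// ltW.
apply: continuousM; first exact: cvg_cst.
by apply: continuousM; [exact: rho_continuous|apply: inv_continuous; rewrite gt_eqF].
Unshelve. all: by end_near. Qed.

Lemma strict_diff_pull x i j c : collision_free x ->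
  strict_diff (fun x => rho alpha (sqdist x i j) * (x j c - x i c))
    (fun w => \sum_c' ((c == c')%:R * rho alpha (sqdist x i j) +
       2 * rho' (sqdist x i j) * (x j c - x i c) * (x j c' - x i c')) *
       (w j c' - w i c')) x.
Proof.
move=> cf; have [->|ij] := eqVneq i j.
  have := strict_diff_cst (0 : R) x; congr strict_diff; apply/funext => w.
    by rewrite subrr mulr0.
  by rewrite big1// => c' _; rewrite [w j c' - _]subrr mulr0.
have := strict_diffM (strict_diff_comp (strict_diff_rho (sqdist_gt0 cf ij))
  (strict_diff_sqdist x i j)) (strict_diff_gap x i j c).
congr strict_diff; apply/funext => w.
under [RHS]eq_bigr do rewrite mulrDl.
rewrite big_split /=; congr (_ + _).
  rewrite (bigD1 c)//= eqxx mul1r big1 ?addr0// => c' cc'.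
  by rewrite eq_sym (negPf cc') !mul0r.
by rewrite !mulr_sumr; apply: eq_bigr => c' _; ring.
Qed.

Lemma strict_diff_field_entry om m x j c : collision_free x ->
  strict_diff (fun y => field om m y j c) (fun w => dfield om m x w j c) x.
Proof.
move=> cf.
have := strict_diffD (strict_diffZ om (strict_diff_entry x j c))
  (strict_diffZ (-1) (strict_diff_sum (index_enum _) (P := xpredT)
     (fun i _ => strict_diffZ (m i) (strict_diff_pull i j c cf)))).
by congr strict_diff; apply/funext => w; rewrite !mxE mulN1r.
Qed.

Lemma strict_diff_field om m x : collision_free x ->
  strict_diff (field om m) (dfield om m x) x.
Proof.
by move=> cf; apply: strict_diff_mx => j c; exact: strict_diff_field_entry.
Qed.

Lemma dfield_linear om m x : linear (dfield om m x).
Proof.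
move=> k u v; apply/matrixP => j c; rewrite !mxE.
set N := fun i c' => (c == c')%:R * rho alpha (sqdist x i j) +
  2 * rho' (sqdist x i j) * (x j c - x i c) * (x j c' - x i c').
have -> : \sum_i m i * \sum_c' N i c' *
      ((k *: u + v) j c' - (k *: u + v) i c') =
    k * (\sum_i m i * \sum_c' N i c' * (u j c' - u i c')) +
    \sum_i m i * \sum_c' N i c' * (v j c' - v i c').
  rewrite mulr_sumr -big_split; apply: eq_bigr => i _ /=.
  rewrite mulrCA -mulrDr; congr (_ * _).
  rewrite mulr_sumr -big_split; apply: eq_bigr => c' _ /=.
  by rewrite !mxE; ring.
by ring.
Qed.

HB.instance Definition _ om m x :=
  GRing.isLinear.Build _ _ _ _ (dfield om m x) (dfield_linear om m x).

Definition pairing (g w : config R n) : R := \sum_j \sum_c g j c * w j c.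

Lemma pairing_linear g : linear (pairing g).
Proof.
move=> k u v; rewrite -[k *: pairing g u]/(k * pairing g u) /pairing mulr_sumr -big_split.
apply: eq_bigr => j _ /=; rewrite mulr_sumr -big_split.
by apply: eq_bigr => c _ /=; rewrite !mxE; ring.
Qed.

HB.instance Definition _ g :=
  GRing.isLinear.Build _ _ _ _ (pairing g) (pairing_linear g).

Lemma pairing_delta g j c : pairing g (delta_mx j c) = g j c.
Proof.
rewrite /pairing (bigD1 j)//= (bigD1 c)//= !mxE !eqxx mulr1 !big1 ?addr0//.
  by move=> i ij; apply: big1 => c' _; rewrite !mxE (negPf ij) mulr0.
by move=> c' cc'; rewrite !mxE eqxx (negPf cc') mulr0.
Qed.

Lemma pairing_entry g j c : pairing (delta_mx j c) g = g j c.
Proof.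
by rewrite -[RHS]pairing_delta /pairing; do 2 (apply: eq_bigr => ? _); rewrite mulrC.
Qed.

Lemma collision_free_pt x :
  (forall i j, i != j -> pt x i != pt x j) <-> collision_free x.
Proof.
have E i j : (sqdist x i j == 0) = (pt x i == pt x j).
  rewrite /sqdist big_ord_recr big_ord1 /= eq_complex /=.
  rewrite paddr_eq0 ?sqr_ge0// !sqrf_eq0 !subr_eq0 eq_sym; congr (_ && _).
    by congr (_ == _); congr (x _ _); apply: val_inj.
  by rewrite eq_sym; congr (_ == _); congr (x _ _); apply: val_inj.
by split=> h i j ij; have := h i j ij; rewrite -E.
Qed.

Lemma collision_free_near x : collision_free x ->
  \forall y \near x, collision_free y.
Proof.
move=> cf; suff : \forall y \near x, forall ij : 'I_n.+1 * 'I_n.+1,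
    ij.1 != ij.2 -> sqdist y ij.1 ij.2 != 0.
  by apply: filterS => y h i j; exact: (h (i, j)).
apply: (@filter_forall _ _ (fun (ij : 'I_n.+1 * 'I_n.+1) y =>
  ij.1 != ij.2 -> sqdist y ij.1 ij.2 != 0) (nbhs x)) => -[i j] /=; have [->|ij] := eqVneq i j.
  by near=> y.
have s0 := sqdist_gt0 cf ij.
have s20 : 0 < sqdist x i j / 2 by rewrite divr_gt0.
have [d d0 dP] := strict_diff_near (strict_diff_sqdist x i j) s20.
near=> y => _; have h : `|sqdist y i j - sqdist x i j| <= sqdist x i j / 2.
  apply: dP; near: y; apply/nbhs_ballP; exists d => //= y.
  by rewrite -ball_normE /= distrC.
by move: h; rewrite ler_norml => /andP[h _]; apply/eqP => h0; lra.
Unshelve. all: by end_near. Qed.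

Variable phi : R -> R.
Hypothesis phiP : forall r : R, 0 < r -> is_derive r 1 phi (- r `^ (- alpha)).

(** This field, and not the gradient, is studied below: it is affine in [mu]
    and its linearisation is diagonalised by the Fourier transform. *)
Definition massfield (mu : R) x : config R n :=
  field (mu + s1 alpha n) (mass mu) x.

Definition gradV (mu : R) x : config R n :=
  \matrix_(j, c) (mass mu j * massfield mu x j c).

Lemma strict_diff_phi_sqrt (q : R) : 0 < q ->
  strict_diff (fun q => phi (Num.sqrt q)) ( *%R (- rho alpha q / 2)) q.
Proof.
move=> q0; apply: (@strict_diff_C1 _ _ (fun q => - rho alpha q / 2)).
  near=> t; have t0 : 0 < t by near: t; exact: lt_nbhsr.
  have st0 : 0 < Num.sqrt t by rewrite sqrtr_gt0.
  have ds := is_derive1_sqrt t0.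
  have dp := phiP st0.
  have E : rho alpha t = Num.sqrt t `^ (- alpha) * (Num.sqrt t)^-1.
    rewrite -(powR_inv1 (ltW st0)) -powRD; last by rewrite (gt_eqF st0) implybT.
    by rewrite -powR12_sqrt ?ltW// -powRrM /rho; congr (_ `^ _); field.
  have -> : - rho alpha t / 2 = (- Num.sqrt t `^ (- alpha)) * (2 * Num.sqrt t)^-1.
    by rewrite E; field; rewrite gt_eqF.
  exact: is_derive1_comp.
apply: continuousM; last exact: cvg_cst.
by apply: continuousN; exact: rho_continuous.
Unshelve. all: by end_near. Qed.

Let ltn_neq i j : (i < j)%N -> i != j.
Proof. by move=> ij; apply/eqP => h; rewrite h ltnn in ij. Qed.

Lemma strict_diff_V mu x : collision_free x ->
  strict_diff (V phi alpha mu) (pairing (gradV mu x)) x.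
Proof.
move=> cf.
have normE (y : config R n) j : body_norm y j ^+ 2 = \sum_c y j c ^+ 2.
  rewrite /body_norm /= sqr_sqrtr ?addr_ge0 ?sqr_ge0//.
  by rewrite big_ord_recr big_ord1 /=; congr (y _ _ ^+ 2 + y _ _ ^+ 2); apply: val_inj.
have distE (y : config R n) i j : body_dist y i j = Num.sqrt (sqdist y i j).
  rewrite /body_dist /= /sqdist big_ord_recr big_ord1 /=; congr (Num.sqrt (_ + _));
  by congr ((y _ _ - y _ _) ^+ 2); apply: val_inj.
have Vq := strict_diff_sum (index_enum _) (P := xpredT) (fun j _ =>
  strict_diffZ (mass mu j) (strict_diff_sum (index_enum _) (P := xpredT) (fun c _ =>
    strict_diffM (strict_diff_entry x j c) (strict_diff_entry x j c)))).
have Vp := strict_diff_sum (index_enum _) (P := xpredT) (fun i _ =>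
  strict_diff_sum (index_enum _) (P := fun j : 'I_n.+1 => (i < j)%N) (fun j (ij : (i < j)%N) =>
    strict_diffZ (mass mu i * mass mu j) (strict_diff_comp
      (strict_diff_phi_sqrt (sqdist_gt0 cf (ltn_neq ij)))
      (strict_diff_sqdist x i j)))).
have := strict_diffD (strict_diffZ ((mu + s1 alpha n) / 2) Vq) Vp.
congr strict_diff; apply/funext => w.
  rewrite /V; congr (_ * _ + _).
    by apply: eq_bigr => j _; rewrite normE.
  by apply: eq_bigr => i _; apply: eq_bigr => j _; rewrite distE.
pose a i j c := mass mu i * mass mu j * rho alpha (sqdist x i j) * (x j c - x i c).
have sqC i j : sqdist x i j = sqdist x j i.
  by apply: eq_bigr => c _; rewrite -[LHS]sqrrN opprB.
have aN i j c : a i j c = - a j i c by rewrite /a sqC; ring.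
have -> : \sum_(i < n.+1) \sum_(j < n.+1 | (i < j)%N) mass mu i * mass mu j *
    (- rho alpha (sqdist x i j) / 2 * (\sum_c 2 * (x j c - x i c) * (w j c - w i c))) =
    - \sum_j \sum_c \sum_i a i j c * w j c.
  transitivity (\sum_(i < n.+1) \sum_(j < n.+1 | (i < j)%N)
     (- \sum_c a i j c * w j c) + \sum_(i < n.+1) \sum_(j < n.+1 | (i < j)%N)
     (- \sum_c a j i c * w i c)).
    rewrite -big_split; apply: eq_bigr => i _; rewrite -big_split.
    apply: eq_bigr => j _ /=; rewrite -opprD -big_split /= mulrA mulr_sumr -sumrN.
    by apply: eq_bigr => c _; rewrite (aN j i) /a; field.
  rewrite [X in X + _](exchange_big_dep xpredT)//= -big_split /= -sumrN.
  apply: eq_bigr => j _; rewrite [X in _ = - X]exchange_big -[RHS]sumrN /=.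
  rewrite [RHS](bigID (fun i : 'I_n.+1 => (i < j)%N)) /=; congr (_ + _).
  rewrite [RHS](bigID (fun i : 'I_n.+1 => (j < i)%N)) /= [X in _ + X]big1 ?addr0.
    by apply: eq_bigl => i; case: ltngtP.
  move=> i; rewrite -leqNgt -leqNgt -eqn_leq => /eqP/val_inj ->.
  by rewrite big1 ?oppr0// => c _; rewrite /a subrr mulr0 mul0r.
rewrite /pairing mulr_sumr -sumrB; apply: eq_bigr => j _.
rewrite mulrA mulr_sumr -sumrB; apply: eq_bigr => c _.
rewrite !mxE -mulr_suml.
have -> : \sum_i a i j c = mass mu j *
    \sum_i mass mu i * (rho alpha (sqdist x i j) * (x j c - x i c)).
  by rewrite mulr_sumr; apply: eq_bigr => i _; rewrite /a; ring.
by field.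
Qed.

(** Off the collisions the potential is strictly differentiable with gradient
    [gradV], so that its critical points are the zeros of [gradV]. *)
Lemma rel_equilibriumP mu x : rel_equilibrium phi alpha mu x <->
  collision_free x /\ gradV mu x = 0.
Proof.
split=> [[/collision_free_pt cf _ dV]|[cf g0]].
  split=> //; have [_ E] := strict_diff_diff (strict_diff_V mu cf).
  apply/matrixP => j c; rewrite -pairing_delta mxE.
  by have := dV (delta_mx j c); rewrite E.
have [df E] := strict_diff_diff (strict_diff_V mu cf).
split=> //; first exact/collision_free_pt.
by move=> v; rewrite E g0 -[LHS]/(pairing 0 v) /pairing big1// => j _; rewrite big1// => c _; rewrite mxE mul0r.
Qed.

Lemma hess_V mu x j c j' c' : collision_free x ->
  hess (V phi alpha mu) x j c j' c' =
  mass mu j' * dfield (mu + s1 alpha n) (mass mu) x (delta_mx j c) j' c'.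
Proof.
move=> cf; rewrite /hess.
have nearD : \forall y \near x,
    'D_(delta_mx j' c') (V phi alpha mu) y = gradV mu y j' c'.
  near=> y; have cfy : collision_free y by near: y; exact: collision_free_near.
  have := strict_diff_is_derive (delta_mx j' c') (strict_diff_V mu cfy).
  by move=> /@derive_val ->; exact: pairing_delta.
rewrite (near_eq_derive _ nearD).
pose D : {linear config R n -> R} :=
  mass mu j' \*: (pairing (delta_mx j' c')) \o (dfield (mu + s1 alpha n) (mass mu) x).
have sD : strict_diff (fun y => gradV mu y j' c') D x.
  have := strict_diffZ (mass mu j') (strict_diff_field_entry
    (mu + s1 alpha n) (mass mu) j' c' cf).
  congr strict_diff; apply/funext => w; first by rewrite [RHS]mxE.
  by rewrite /D /= pairing_entry.
have := strict_diff_is_derive (delta_mx j c) sD.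
by move=> /@derive_val ->; rewrite /D /= pairing_entry.
Unshelve. all: by end_near. Qed.

End Field.

(** * The linearised field in complex notation *)

Section Polygon.
Context {R : realType} {n : nat}.
Variable alpha : R.
Hypothesis n0 : (0 < n)%N.
Implicit Types (x w : config R n) (i j : 'I_n.+1) (c : 'I_2).
Local Notation wv := (@wv R n).

(** The derivative of the pull of the body [i] on the body [j]. *)
Definition pull_mx x i j c c' : R :=
  (c == c')%:R * rho alpha (sqdist x i j) +
  2 * rho' alpha (sqdist x i j) * (x j c - x i c) * (x j c' - x i c').

Lemma sqdistC x i j : sqdist x i j = sqdist x j i.
Proof. by apply: eq_bigr => c _; rewrite -[LHS]sqrrN opprB. Qed.

Lemma pull_mxC x i j c c' : pull_mx x i j c c' = pull_mx x i j c' c.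
Proof. by rewrite /pull_mx eq_sym; ring. Qed.

Lemma pull_mx_sym x i j c c' : pull_mx x i j c c' = pull_mx x j i c c'.
Proof. by rewrite /pull_mx sqdistC; ring. Qed.

(** The complexification of [dfield]. *)
Definition dfieldC (om : R) (m : 'I_n.+1 -> R) x (X : cconfig R n) : cconfig R n :=
  \matrix_(j, c) (om%:C * X j c - \sum_i (m i)%:C *
    \sum_c' (pull_mx x i j c c')%:C * (X j c' - X i c')).

Lemma dfieldC_real om m x w :
  dfieldC om m x (map_mx (real_complex R) w) = map_mx (real_complex R) (dfield alpha om m x w).
Proof.
apply/matrixP => j c; rewrite !mxE rmorphB rmorphM rmorph_sum /=; congr (_ - _).
apply: eq_bigr => i _; rewrite rmorphM rmorph_sum; congr (_ * _).
by apply: eq_bigr => c' _; rewrite rmorphM rmorphB !mxE.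
Qed.

(** The masses factor out because the pull matrices are symmetric in the two
    bodies. *)
Lemma hess_actE (phi : R -> R) mu x (X : cconfig R n) :
  (forall r : R, 0 < r -> is_derive r 1 phi (- r `^ (- alpha))) ->
  collision_free x ->
  hess_act (V phi alpha mu) x X =
  \matrix_(j, c) ((mass mu j)%:C * dfieldC (mu + s1 alpha n) (mass mu) x X j c).
Proof.
move=> hphi cf; apply/matrixP => j c; rewrite !mxE.
have hessE j' c' : hess (V phi alpha mu) x j c j' c' =
   mass mu j * ((mu + s1 alpha n) * ((j' == j) && (c' == c))%:R)
   - (j' == j)%:R * (mass mu j * \sum_i mass mu i * pull_mx x i j c c')
   + mass mu j' * mass mu j * pull_mx x j j' c c'.
  rewrite (hess_V hphi)// !mxE.
  under eq_bigr => i _.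
    rewrite (bigD1 c)//= big1 ?addr0; last first.
      by move=> c1 cc1; rewrite !mxE (negPf cc1) !andbF subrr mulr0.
    rewrite -/(pull_mx x i j' c' c) !mxE eqxx !andbT mulrBr mulrBr; over.
  rewrite sumrB /=.
  have -> : \sum_i mass mu i * (pull_mx x i j' c' c * (j' == j)%:R) =
      (j' == j)%:R * \sum_i mass mu i * pull_mx x i j' c' c.
    by rewrite mulr_sumr; apply: eq_bigr => i _; ring.
  rewrite [X in _ - (_ - X)](bigD1 j)//= eqxx [X in _ - (_ - (_ + X))]big1 ?addr0; last first.
    by move=> i ij; rewrite (negPf ij) !mulr0.
  rewrite (pull_mxC _ _ _ c' c) mulr1.
  under eq_bigr do rewrite (pull_mxC _ _ _ c' c).
  by have [->|jj] := eqVneq j' j; rewrite /=; ring.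
pose S c' := \sum_i mass mu i * pull_mx x i j c c'.
have E j' c' : (hess (V phi alpha mu) x j c j' c')%:C * X j' c' =
    (mass mu j)%:C * ((mu + s1 alpha n)%:C * (((j' == j) && (c' == c))%:R * X j' c'))
    - (j' == j)%:R * ((mass mu j)%:C * ((S c')%:C * X j' c'))
    + (mass mu j)%:C * ((mass mu j')%:C * ((pull_mx x j' j c c')%:C * X j' c')).
  rewrite hessE -/(S c') (pull_mx_sym x j j').
  by rewrite rmorphD rmorphB !rmorphM !rmorph_nat /=; ring.
under eq_bigr do under eq_bigr do rewrite E.
under eq_bigr do rewrite big_split sumrB /=.
rewrite big_split sumrB /= mulrBr -addrA; congr (_ + _).
  rewrite (bigD1 j)//= (bigD1 c)//= !eqxx mul1r !big1 ?addr0//.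
    by move=> i ij; apply: big1 => c' _; rewrite (negPf ij) mul0r !mulr0.
  by move=> c' cc'; rewrite (negPf cc') andbF mul0r !mulr0.
rewrite (bigD1 j)//= [X in - (_ + X)]big1 ?addr0; last first.
  by move=> i ij; apply: big1 => c' _; rewrite (negPf ij) mul0r.
under eq_bigr do rewrite eqxx mul1r.
rewrite -mulr_sumr.
under [X in - _ + X]eq_bigr do rewrite -!mulr_sumr.
rewrite -[X in _ + X]mulr_sumr -[X in X + _]mulrN -mulrDr -[RHS]mulrN; congr (_ * _).
have -> : \sum_c' (S c')%:C * X j c' =
    \sum_i (mass mu i)%:C * \sum_c' (pull_mx x i j c c')%:C * X j c'.
  rewrite /S; under eq_bigr do rewrite rmorph_sum mulr_suml.
  rewrite exchange_big; apply: eq_bigr => i _; rewrite mulr_sumr.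
  by apply: eq_bigr => c' _; rewrite rmorphM mulrA.
rewrite -sumrN -big_split -sumrN; apply: eq_bigr => i _ /=.
rewrite -mulrN -mulrDr -mulrN; congr (_ * _).
rewrite -sumrN -big_split -sumrN; apply: eq_bigr => c' _ /=; ring.
Qed.

(** The components of a complexified vector along [(1, i)] and [(1, -i)] up to
    a factor; for a real vector they are the complex number that it represents
    and its conjugate. *)
Definition holo (X : cconfig R n) j : R[i] := X j 0 + 'i%C * X j 1.
Definition antiholo (X : cconfig R n) j : R[i] := X j 0 - 'i%C * X j 1.

(** The linearised field in complex notation. The derivative of the pull of
    one body on another is a real linear map of the plane; its complex linear
    part is a real scalar, and its antilinear part has the square of the
    separation of the two bodies as a factor. [A] and [B] stand for a
    displacement and its conjugate. *)
Definition pull_op (om : R) (m : 'I_n.+1 -> R) x (dir A B : 'I_n.+1 -> R[i]) j : R[i] :=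
  om%:C * A j - \sum_i (m i)%:C *
    ((rho alpha (sqdist x i j) + rho' alpha (sqdist x i j) * sqdist x i j)%:C * (A j - A i)
     + (rho' alpha (sqdist x i j))%:C * (dir j - dir i) ^+ 2 * (B j - B i)).

Lemma ptE x j : pt x j = (x j 0)%:C + 'i%C * (x j 1)%:C.
Proof. by rewrite [LHS]complexE. Qed.

Let ii : 'i%C * 'i%C = -1 :> R[i]. Proof. by rewrite -expr2 sqr_i. Qed.

Lemma sum2 (V : nmodType) (F : 'I_2 -> V) : \sum_c F c = F 0 + F 1.
Proof. by rewrite big_ord_recr big_ord1 /=; congr (F _ + F _); apply: val_inj. Qed.

(** One computation for [holo], with [I = i], and for [antiholo], with [I = -
    i]. *)
Let holo_gen (I : R[i]) om m x (X : cconfig R n) j : I * I = -1 ->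
  dfieldC om m x X j 0 + I * dfieldC om m x X j 1 =
  pull_op om m x (fun i => (x i 0)%:C + I * (x i 1)%:C)
    (fun i => X i 0 + I * X i 1) (fun i => X i 0 - I * X i 1) j.
Proof.
move=> I2; rewrite /pull_op !mxE mulrBr addrACA -opprD.
rewrite [X in _ - (_ + X)]mulr_sumr -big_split; congr (_ - _); first by ring.
apply: eq_bigr => i _ /=; rewrite !sum2 /pull_mx /=.
move: (rho' _ _) (rho _ _) => r' r; rewrite /sqdist sum2.
rewrite !(rmorph_nat, rmorphXn, rmorphM, rmorphB, rmorphD) /=.
move: (m i)%:C (r'%:C) (r%:C) (x j 0)%:C (x i 0)%:C (x j 1)%:C (x i 1)%:C => {}m {r'}r' {r}r a0 a1 b0 b1.
move: (X j 0) (X i 0) (X j 1) (X i 1) => u0 u1 v0 v1.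
rewrite mulrCA -mulrDr; congr (_ * _).
set a := a0 - a1; set b := b0 - b1.
have -> : a0 + I * b0 - (a1 + I * b1) = a + I * b by rewrite /a /b; ring.
have -> : u0 + I * v0 - (u1 + I * v1) = (u0 - u1) + I * (v0 - v1) by ring.
have -> : u0 - I * v0 - (u1 - I * v1) = (u0 - u1) - I * (v0 - v1) by ring.
move: (u0 - u1) (v0 - v1) => u v.
have E : r' * (a + I * b) ^+ 2 * (u - I * v) = r' * (a ^+ 2 * (u - I * v) +
  2 * I * a * b * u + I * I * (b ^+ 2 * u - 2 * a * b * v - I * b ^+ 2 * v)) by ring.
rewrite E I2. by ring.
Qed.

Lemma holo_dfieldC om m x X j :
  holo (dfieldC om m x X) j = pull_op om m x (pt x) (holo X) (antiholo X) j.
Proof.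
rewrite /holo holo_gen// /pull_op; congr (_ - _).
by apply: eq_bigr => i _; rewrite !ptE.
Qed.

Lemma antiholo_dfieldC om m x X j :
  antiholo (dfieldC om m x X) j =
  pull_op om m x (fun i => conjc (pt x i)) (antiholo X) (holo X) j.
Proof.
have -> : antiholo (dfieldC om m x X) j =
    dfieldC om m x X j 0 + (- 'i%C) * dfieldC om m x X j 1 by rewrite mulNr.
rewrite holo_gen ?mulrNN//.
have eA i : X i 0 + - 'i%C * X i 1 = antiholo X i by rewrite mulNr.
have eH i : X i 0 - - 'i%C * X i 1 = holo X i by rewrite mulNr opprK.
have eP i : (x i 0)%:C + - 'i%C * (x i 1)%:C = conjc (pt x i).
  by rewrite mulNr /pt /=; simpc.
by rewrite /pull_op eA; congr (_ - _); apply: eq_bigr => i _; rewrite !eA !eH !eP.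
Qed.

Lemma pt_dfield om m x w j :
  pt (dfield alpha om m x w) j =
  pull_op om m x (pt x) (pt w) (fun i => conjc (pt w i)) j.
Proof.
have -> : pt (dfield alpha om m x w) j =
    holo (dfieldC om m x (map_mx (real_complex R) w)) j.
  by rewrite dfieldC_real ptE /holo [map_mx _ _ j 0]mxE [map_mx _ _ j 1]mxE.
rewrite holo_dfieldC.
have eH i : holo (map_mx (real_complex R) w) i = pt w i by rewrite /holo !mxE ptE.
have eA i : antiholo (map_mx (real_complex R) w) i = conjc (pt w i).
  by rewrite /antiholo !mxE /pt /=; simpc.
by rewrite /pull_op eH; congr (_ - _); apply: eq_bigr => i _; rewrite !eH !eA.
Qed.

(** ** Linearisation at the regular polygon *)

Definition half_pred : R := (alpha - 1) / 2.
Local Notation am := half_pred.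
Definition half_succ : R := (alpha + 1) / 2.
Local Notation ap := half_succ.

Local Notation kap := (kappa n alpha).

Lemma pt_config_of (f : 'I_n.+1 -> R[i]) j : pt (config_of f) j = f j.
Proof. by rewrite /pt /config_of !mxE /=; case: (f j). Qed.

Lemma pt_abar j : pt (abar R n) j = if j == 0 then 0 else wv j%:R.
Proof. by rewrite pt_config_of. Qed.

Lemma sqdist_pt x i j : (sqdist x i j)%:C = (pt x j - pt x i) * conjc (pt x j - pt x i).
Proof. by rewrite /sqdist sum2 /pt; simpc; congr (_ +i* _); ring. Qed.

Lemma sqdist_abar i j : i != 0 -> j != 0 ->
  sqdist (abar R n) i j = 2 - 2 * cos ((i%:R - j%:R) * zeta R n).
Proof.
move=> i0 j0; apply: complexI; rewrite sqdist_pt !pt_abar (negPf i0) (negPf j0).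
rewrite [(i%:R - j%:R) * _]mulrBl cosB /wv /cis; simpc; congr (_ +i* _); last by ring.
set a := _ * zeta R n; set b := _ * zeta R n.
by have := cos2Dsin2 a; have := cos2Dsin2 b => ha hb; rewrite -!expr2 !sqrrB; lra.
Qed.

Lemma sqdist_abar0 j : j != 0 -> sqdist (abar R n) 0 j = 1.
Proof.
move=> j0; apply: complexI; rewrite sqdist_pt !pt_abar eqxx (negPf j0) subr0.
by rewrite wvJ -wvD subrr wv0.
Qed.

Lemma collision_free_abar : collision_free (abar R n).
Proof.
move=> i j ij.
have [i0|i0] := eqVneq i 0.
  by rewrite i0 sqdist_abar0 ?oner_eq0// -i0 eq_sym.
have [j0|j0] := eqVneq j 0.
  by rewrite j0 sqdistC sqdist_abar0 ?oner_eq0.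
have H (a b : 'I_n.+1) : a != 0 -> (a < b)%N -> sqdist (abar R n) a b != 0.
  move=> a0 ab; have b0 : b != 0 by apply/eqP => b0; rewrite b0 in ab.
  rewrite sqdistC sqdist_abar// -natrB ?(ltnW ab)// gt_eqF//; apply: kappa_chord => //.
  have := ltn_ord b; have : (0 < a)%N by rewrite lt0n.
  by rewrite subn_gt0 ab /=; lia.
have [|ji|/val_inj ji] := ltngtP i j; first exact: H.
  by rewrite sqdistC; exact: H.
by rewrite ji eqxx in ij.
Qed.

(** The vertices for [s = 1], and their conjugates for [s = -1]. *)
Definition dir (s : R) i : R[i] := if i == 0 then 0 else wv (s * i%:R).

Lemma dir_pt i : pt (abar R n) i = dir 1 i.
Proof. by rewrite pt_abar /dir mul1r. Qed.

Lemma dir_conj i : conjc (pt (abar R n) i) = dir (-1) i.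
Proof.
by rewrite pt_abar /dir; case: ifP => _; [exact: conjc0|rewrite wvJ mulN1r].
Qed.

Lemma rho'_chord (q : R) : 0 < q -> rho' alpha q * q = - ap * rho alpha q.
Proof. by move=> q0; rewrite /rho' -/ap; field; rewrite gt_eqF. Qed.

Lemma conjcB (u v : R[i]) : conjc (u - v) = conjc u - conjc v.
Proof. exact: rmorphB. Qed.

(** For two vertices the square of the separation is minus the squared
    distance times the product of the two vertices; this is what turns the
    antilinear part into a convolution. *)
Lemma pull_outer s A B i j : s = 1 \/ s = -1 -> i != 0 -> j != 0 ->
  (rho alpha (sqdist (abar R n) i j) + rho' alpha (sqdist (abar R n) i j) * sqdist (abar R n) i j)%:C * (A j - A i)
     + (rho' alpha (sqdist (abar R n) i j))%:C * (dir s j - dir s i) ^+ 2 * (B j - B i) =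
  - ((kap (i%:R - j%:R))%:C * (am%:C * (A j - A i) -
        ap%:C * wv (s * (i%:R + j%:R)) * (B j - B i))) :> R[i].
Proof.
move=> hs i0 j0; have [<-|ij] := eqVneq i j; first by rewrite !subrr !mulr0 addr0 subrr mulr0 oppr0.
have q0 := sqdist_gt0 collision_free_abar ij.
rewrite (rho'_chord q0) /dir (negPf i0) (negPf j0).
have -> : rho alpha (sqdist (abar R n) i j) + - ap * rho alpha (sqdist (abar R n) i j) = - (am * rho alpha (sqdist (abar R n) i j)).
  by rewrite /ap /am; field.
have qE : (sqdist (abar R n) i j)%:C =
    (wv (s * j%:R) - wv (s * i%:R)) * (wv (- (s * j%:R)) - wv (- (s * i%:R))).
  rewrite sqdist_pt !pt_abar (negPf i0) (negPf j0) conjcB !wvJ.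
  by case: hs => ->; rewrite ?mul1r ?mulN1r ?opprK // mulrC.
have -> : (wv (s * j%:R) - wv (s * i%:R)) ^+ 2 =
    - ((sqdist (abar R n) i j)%:C * wv (s * (i%:R + j%:R))).
  rewrite qE -[RHS]mulrN -mulrA expr2; congr (_ * _).
  rewrite mulrDr wvD.
  have hi := wvNM n (s * i%:R); have hj := wvNM n (s * j%:R).
  have -> : (wv (- (s * j%:R)) - wv (- (s * i%:R))) *
     - (wv (s * i%:R) * wv (s * j%:R)) =
     (wv (- (s * i%:R)) * wv (s * i%:R)) * wv (s * j%:R)
     - (wv (- (s * j%:R)) * wv (s * j%:R)) * wv (s * i%:R) by ring.
  by rewrite hi hj !mul1r.
rewrite mulrN mulrA -rmorphM (rho'_chord q0).
rewrite /kappa -sqdist_abar//; move: (rho alpha _) (am) (ap) => r a b.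
by rewrite !(rmorphM, rmorphN) /=; ring.
Qed.

Lemma pull_center s A B j : s = 1 \/ s = -1 -> j != 0 ->
  (rho alpha 1 + rho' alpha 1 * 1)%:C * (A j - A 0)
     + (rho' alpha 1)%:C * (dir s j - dir s 0) ^+ 2 * (B j - B 0) =
  - (am%:C * (A j - A 0) + ap%:C * wv (s * (2 * j%:R)) * (B j - B 0)) :> R[i].
Proof.
move=> hs j0; rewrite /dir eqxx (negPf j0) subr0 expr2 -wvD.
have -> : s * j%:R + s * j%:R = s * (2 * j%:R) by ring.
have -> : rho' alpha 1 = - ap by rewrite -[LHS]mulr1 rho'_chord// /rho powR1 mulr1.
have -> : rho alpha 1 + - ap * 1 = - am by rewrite /rho powR1 /ap /am; field.
by rewrite !rmorphN /=; ring.
Qed.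

Lemma pull_op_outer s A B mu j : s = 1 \/ s = -1 -> j != 0 ->
  pull_op (mu + s1 alpha n) (mass mu) (abar R n) (dir s) A B j =
  (mu + s1 alpha n)%:C * A j +
  \sum_(i < n.+1 | i != 0) (kap (i%:R - j%:R))%:C * (am%:C * (A j - A i) -
        ap%:C * wv (s * (i%:R + j%:R)) * (B j - B i)) +
  mu%:C * (am%:C * (A j - A 0) + ap%:C * wv (s * (2 * j%:R)) * (B j - B 0)).
Proof.
move=> hs j0; rewrite /pull_op (bigD1 0)//= opprD addrCA [RHS]addrC; congr (_ + _).
  by rewrite /mass eqxx sqdist_abar0// pull_center// mulrN opprK.
congr (_ + _); rewrite -sumrN; apply: eq_bigr => i i0.
by rewrite /mass (negPf i0) mul1r pull_outer// opprK.
Qed.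

Lemma pull_op_center s A B mu : s = 1 \/ s = -1 ->
  pull_op (mu + s1 alpha n) (mass mu) (abar R n) (dir s) A B 0 =
  (mu + s1 alpha n)%:C * A 0 +
  \sum_(i < n.+1 | i != 0) (am%:C * (A 0 - A i) + ap%:C * wv (s * (2 * i%:R)) * (B 0 - B i)).
Proof.
move=> hs; rewrite /pull_op (bigD1 0)//= !subrr !mulr0 addr0 mulr0 add0r.
congr (_ + _); rewrite -sumrN; apply: eq_bigr => i i0.
rewrite /mass (negPf i0) mul1r sqdistC sqdist_abar0//.
transitivity ((rho alpha 1 + rho' alpha 1 * 1)%:C * (A i - A 0) +
  (rho' alpha 1)%:C * (dir s i - dir s 0) ^+ 2 * (B i - B 0)); first by ring.
by rewrite pull_center//; ring.
Qed.

End Polygon.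

(** * The linearised field in Fourier coordinates *)

Section Spectrum.
Context {R : realType} {n : nat}.
Variable alpha : R.
Hypothesis n3 : (3 <= n)%N.
Implicit Types (x w : config R n) (i j : 'I_n.+1) (c : 'I_2).
Local Notation wv := (@wv R n).
Local Notation kap := (kappa n alpha).
Local Notation smode := (mode_sum n alpha).
Local Notation am := (half_pred alpha).
Local Notation ap := (half_succ alpha).
Local Notation mode := (@integral_mode R n).

Let n0 : (0 < n)%N. Proof. exact: leq_trans n3. Qed.

Let kappa_sum : R := \sum_(l < n) kap l%:R.

(** Convolution with [kap] is diagonal on the waves. *)
Lemma kap_sum t j : mode t ->
  \sum_(i < n.+1 | i != 0) (kap (i%:R - j%:R))%:C * wv (t * i%:R) =
  wv (t * j%:R) * (kappa_sum - smode t)%:C.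
Proof.
move=> ht; rewrite -(sum_kappa_wv n0 alpha ht) -(@outer_sum_shift _ _
  (fun y => (kap y)%:C * wv (y * t)) j); last first.
  by move=> y; rewrite kappa_periodic// (periodic_wv ht).
rewrite mulr_sumr; apply: eq_bigr => i _.
by rewrite mulrCA -wvD; congr (_ * wv _); ring.
Qed.

Lemma kap_sum0 j :
  \sum_(i < n.+1 | i != 0) (kap (i%:R - j%:R))%:C = kappa_sum%:C.
Proof.
have := @kap_sum 0 j (mode_nat n0 0); rewrite mul0r wv0 mul1r smode0 subr0 => <-.
by apply: eq_bigr => i _; rewrite mul0r wv0 mulr1.
Qed.

(** [blockA mu k], [blockA mu (- k)] and [blockB mu k] are the entries of the
    symmetric matrix that the linearised field induces on the pair of modes
    [k] and [- k]. *)
Definition block_diag (mu t : R) : R := ap * mu + s1 alpha n + am * smode (t + 1).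
Local Notation blockA := block_diag.
Definition block_off (mu t : R) : R := ap * (mu + s1 alpha n - smode t).
Local Notation blockB := block_off.

Lemma smode_s1 : smode 1 = s1 alpha n.
Proof. exact: (smode1 n0). Qed.

(** The antilinear part multiplies the conjugate wave, of exponent [k - s], by
    a factor that brings the exponent to [k + s], so that the amplitudes [p]
    and [q] are coupled to each other only. The sign [s = 1] serves for [holo]
    and [s = -1] for [antiholo]. *)
Lemma pull_wave mu s k p q (A B : 'I_n.+1 -> R[i]) j :
  s = 1 \/ s = -1 -> mode k -> j != 0 ->
  (forall i, i != 0 -> A i = wv ((k + s) * i%:R) * p) ->
  (forall i, i != 0 -> B i = wv ((k - s) * i%:R) * q) ->
  pull_op alpha (mu + s1 alpha n) (mass mu) (abar R n) (dir s) A B j =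
  wv ((k + s) * j%:R) * ((blockA mu (s * k))%:C * p + (blockB mu k)%:C * q)
  - mu%:C * (am%:C * A 0 + ap%:C * wv (s * (2 * j%:R)) * B 0).
Proof.
move=> hs hk j0 hA hB; rewrite pull_op_outer//.
have ms : mode s by case: hs => ->; [exact: (mode1 n0)|exact/modeN/(mode1 n0)].
have ss : smode s = s1 alpha n by case: hs => ->; rewrite ?smodeN smode_s1.
have bA : smode (s * k + 1) = smode (k + s).
  case: hs => ->; first by rewrite mul1r.
  by rewrite -[LHS]smodeN; congr smode; ring.
have sum1 : \sum_(i < n.+1 | i != 0) (kap (i%:R - j%:R))%:C * (A j - A i) =
    (smode (k + s))%:C * A j.
  rewrite (eq_bigr (fun i : 'I_n.+1 => A j * (kap (i%:R - j%:R))%:C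
     - p * ((kap (i%:R - j%:R))%:C * wv ((k + s) * i%:R)))); last first.
    by move=> i i0; rewrite (hA i)//; ring.
  rewrite sumrB -!mulr_sumr kap_sum0 kap_sum; last exact: modeD.
  by rewrite hA// rmorphB /=; ring.
have sum2 : \sum_(i < n.+1 | i != 0) (kap (i%:R - j%:R))%:C *
      (wv (s * (i%:R + j%:R)) * (B j - B i)) =
    (smode k - s1 alpha n)%:C * (wv ((k + s) * j%:R) * q).
  rewrite (eq_bigr (fun i : 'I_n.+1 => wv (k * j%:R) * q * ((kap (i%:R - j%:R))%:C * wv (s * i%:R))
     - wv (s * j%:R) * q * ((kap (i%:R - j%:R))%:C * wv (k * i%:R)))); last first.
    move=> i i0; rewrite (hB i)// (hB j)//.
    have -> : wv (s * (i%:R + j%:R)) * (wv ((k - s) * j%:R) * q - wv ((k - s) * i%:R) * q) =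
      (wv (s * (i%:R + j%:R)) * wv ((k - s) * j%:R)) * q - (wv (s * (i%:R + j%:R)) * wv ((k - s) * i%:R)) * q by ring.
    rewrite -!wvD.
    have -> : s * (i%:R + j%:R) + (k - s) * j%:R = k * j%:R + s * i%:R by ring.
    have -> : s * (i%:R + j%:R) + (k - s) * i%:R = s * j%:R + k * i%:R by ring.
    by rewrite !wvD; ring.
  rewrite sumrB -!mulr_sumr !kap_sum// ss.
  have -> : wv ((k + s) * j%:R) = wv (k * j%:R) * wv (s * j%:R) by rewrite -wvD mulrDl.
  by rewrite !rmorphB /=; ring.
rewrite (eq_bigr (fun i : 'I_n.+1 => am%:C * ((kap (i%:R - j%:R))%:C * (A j - A i))
   - ap%:C * ((kap (i%:R - j%:R))%:C * (wv (s * (i%:R + j%:R)) * (B j - B i))))); last first.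
  by move=> i _; ring.
rewrite sumrB -!mulr_sumr sum1 sum2 /blockA /blockB bA hA// hB//.
have wE : wv (s * (2 * j%:R)) * wv ((k - s) * j%:R) = wv ((k + s) * j%:R).
  by rewrite -wvD; congr wv; ring.
have -> : ap = am + 1 by rewrite /half_succ /half_pred; field.
move: (am) (s1 alpha n) (smode k) (smode (k + s)) => a S1 Sk Sks.
move: wE; move: (wv (s * (2 * j%:R))) (wv ((k - s) * j%:R)) (wv ((k + s) * j%:R)) => w1 w2 w3 <-.
rewrite !(rmorphD, rmorphM, rmorphB, rmorph1) /=; ring.
Qed.

Lemma conjcD (u v : R[i]) : conjc (u + v) = conjc u + conjc v.
Proof. exact: rmorphD. Qed.

Lemma conjcM (u v : R[i]) : conjc (u * v) = conjc u * conjc v.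
Proof. exact: rmorphM. Qed.

Lemma conjc_sum (I : Type) (r : seq I) (P : pred I) (F : I -> R[i]) :
  conjc (\sum_(i <- r | P i) F i) = \sum_(i <- r | P i) conjc (F i).
Proof. exact: rmorph_sum. Qed.

Lemma fourier_conj (w : 'I_n.+1 -> R[i]) t :
  conjc (fourier w (- t)) = \sum_(j < n.+1 | j != 0) wv (- (j%:R * (t - 1))) * conjc (w j).
Proof.
rewrite conjc_sum; apply: eq_bigr => j _; rewrite conjcM wvJ.
by congr (wv _ * _); ring.
Qed.

Lemma pt_dfield_dir om m w j :
  pt (dfield alpha om m (abar R n) w) j =
  pull_op alpha om m (abar R n) (dir 1) (pt w) (fun i => conjc (pt w i)) j.
Proof.
by rewrite pt_dfield /pull_op; congr (_ - _); apply: eq_bigr => i _; rewrite !dir_pt.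
Qed.

(** The central body enters the modes [1] and [- 1] only, because the sums of
    the powers of the vertices vanish at the other modes. *)
Lemma fourier_dfield mu w t : mode t ->
  fourier (pt (dfield alpha (mu + s1 alpha n) (mass mu) (abar R n) w)) t =
  (blockA mu t)%:C * fourier (pt w) t + (blockB mu t)%:C * conjc (fourier (pt w) (- t))
  - mu%:C * (am%:C * pt w 0 * (if wv (t + 1) == 1 then n%:R else 0)
             + ap%:C * conjc (pt w 0) * (if wv (t - 1) == 1 then n%:R else 0)).
Proof.
move=> ht.
have m1 : mode 1 := mode1 n0.
have mt1 : mode (t + 1) by exact: modeD.
have mtm : mode (t - 1) by exact: modeB.
rewrite fourier_conj.
pose A := pt w; pose B i := conjc (pt w i).
have kapS t' : mode t' -> forall i, \sum_(j < n.+1 | j != 0)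
    (kap (i%:R - j%:R))%:C * wv (- (j%:R * t')) = wv (- (i%:R * t')) * (kappa_sum - smode t')%:C.
  move=> ht' i; rewrite -smodeN [- (i%:R * t')](_ : _ = - t' * i%:R); last by ring.
  rewrite -kap_sum; last exact: modeN.
  apply: eq_bigr => j _; rewrite -kappaN; congr ((kap _)%:C * wv _); ring.
have sum1 : \sum_(j < n.+1 | j != 0) wv (- (j%:R * (t + 1))) *
      (\sum_(i < n.+1 | i != 0) (kap (i%:R - j%:R))%:C * (A j - A i)) =
    (smode (t + 1))%:C * fourier A t.
  rewrite (eq_bigr (fun j : 'I_n.+1 => kappa_sum%:C * (wv (- (j%:R * (t + 1))) * A j)
     - \sum_(i < n.+1 | i != 0) A i * ((kap (i%:R - j%:R))%:C * wv (- (j%:R * (t + 1)))))); last first.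
    move=> j j0; rewrite -(kap_sum0 j) mulr_suml mulr_sumr -sumrB.
    by apply: eq_bigr => i _; ring.
  rewrite sumrB -mulr_sumr exchange_big /= -/(fourier A t).
  rewrite (eq_bigr (fun i : 'I_n.+1 => (kappa_sum - smode (t + 1))%:C * (wv (- (i%:R * (t + 1))) * A i))); last first.
    by move=> i _; rewrite -mulr_sumr kapS//; ring.
  by rewrite -mulr_sumr -/(fourier A t) rmorphB /=; ring.
have sum2 : \sum_(j < n.+1 | j != 0) wv (- (j%:R * (t + 1))) *
      (\sum_(i < n.+1 | i != 0) (kap (i%:R - j%:R))%:C * (wv (1 * (i%:R + j%:R)) * (B j - B i))) =
    (smode t - s1 alpha n)%:C * \sum_(j < n.+1 | j != 0) wv (- (j%:R * (t - 1))) * B j.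
  rewrite (eq_bigr (fun j : 'I_n.+1 =>
     (kappa_sum - smode 1)%:C * (wv (- (j%:R * (t - 1))) * B j)
     - \sum_(i < n.+1 | i != 0) wv i%:R * B i * ((kap (i%:R - j%:R))%:C * wv (- (j%:R * t))))); last first.
    move=> j j0.
    have -> : (kappa_sum - smode 1)%:C * (wv (- (j%:R * (t - 1))) * B j) =
        \sum_(i < n.+1 | i != 0) wv (- (j%:R * t)) * B j * ((kap (i%:R - j%:R))%:C * wv (1 * i%:R)).
      rewrite -mulr_sumr kap_sum//.
      have -> : - (j%:R * (t - 1)) = - (j%:R * t) + 1 * j%:R by ring.
      by rewrite wvD; ring.
    rewrite -sumrB mulr_sumr; apply: eq_bigr => i _.
    have -> : wv (- (j%:R * (t + 1))) * ((kap (i%:R - j%:R))%:C * (wv (1 * (i%:R + j%:R)) * (B j - B i))) =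
      (kap (i%:R - j%:R))%:C * (wv (- (j%:R * (t + 1))) * wv (1 * (i%:R + j%:R))) * (B j - B i) by ring.
    rewrite -wvD.
    have -> : - (j%:R * (t + 1)) + 1 * (i%:R + j%:R) = - (j%:R * t) + 1 * i%:R by ring.
    by rewrite wvD mul1r; ring.
  rewrite sumrB -mulr_sumr exchange_big /=.
  rewrite [X in _ - X](eq_bigr (fun i : 'I_n.+1 => (kappa_sum - smode t)%:C * (wv (- (i%:R * (t - 1))) * B i)))
    => [|i _]; last first.
    rewrite -mulr_sumr kapS//.
    have -> : - (i%:R * (t - 1)) = i%:R + - (i%:R * t) by ring.
    by rewrite wvD; ring.
  by rewrite -mulr_sumr smode_s1 !rmorphB /=; ring.
have dl t' : mode t' -> \sum_(j < n.+1 | j != 0) wv (- (j%:R * t')) =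
    (if wv t' == 1 then n%:R else 0).
  move=> ht'; under eq_bigr do rewrite -mulrN.
  rewrite sum_wv_outer; last exact: modeN.
  suff -> : (wv (- t') == 1) = (wv t' == 1) by [].
  by apply/eqP/eqP => h; have := wvNM n t'; rewrite h ?mul1r ?mulr1.
have dlA : \sum_(j < n.+1 | j != 0) wv (- (j%:R * (t + 1))) * (A j - A 0) =
    fourier A t - A 0 * (if wv (t + 1) == 1 then n%:R else 0).
  rewrite -(dl _ mt1) mulr_sumr -sumrB; apply: eq_bigr => j _; ring.
have dlB : \sum_(j < n.+1 | j != 0) wv (- (j%:R * (t + 1))) * (wv (1 * (2 * j%:R)) * (B j - B 0)) =
    \sum_(j < n.+1 | j != 0) wv (- (j%:R * (t - 1))) * B j
    - B 0 * (if wv (t - 1) == 1 then n%:R else 0).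
  rewrite -(dl _ mtm) mulr_sumr -sumrB; apply: eq_bigr => j _.
  rewrite mulrA -wvD.
  have -> : - (j%:R * (t + 1)) + 1 * (2 * j%:R) = - (j%:R * (t - 1)) by ring.
  by ring.
transitivity ((mu + s1 alpha n)%:C * fourier A t +
  am%:C * ((smode (t + 1))%:C * fourier A t) - ap%:C * ((smode t - s1 alpha n)%:C *
     \sum_(j < n.+1 | j != 0) wv (- (j%:R * (t - 1))) * B j) +
  mu%:C * (am%:C * (fourier A t - A 0 * (if wv (t + 1) == 1 then n%:R else 0)) +
     ap%:C * (\sum_(j < n.+1 | j != 0) wv (- (j%:R * (t - 1))) * B j
    - B 0 * (if wv (t - 1) == 1 then n%:R else 0)))).
  rewrite -sum1 -sum2 -dlA -dlB.
  transitivity (\sum_(j < n.+1 | j != 0) ((mu + s1 alpha n)%:C * (wv (- (j%:R * (t + 1))) * A j)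
    + am%:C * (wv (- (j%:R * (t + 1))) * (\sum_(i < n.+1 | i != 0) (kap (i%:R - j%:R))%:C * (A j - A i)))
    - ap%:C * (wv (- (j%:R * (t + 1))) *
      (\sum_(i < n.+1 | i != 0) (kap (i%:R - j%:R))%:C * (wv (1 * (i%:R + j%:R)) * (B j - B i))))
    + mu%:C * (am%:C * (wv (- (j%:R * (t + 1))) * (A j - A 0))
       + ap%:C * (wv (- (j%:R * (t + 1))) * (wv (1 * (2 * j%:R)) * (B j - B 0)))))).
    apply: eq_bigr => j j0; rewrite pt_dfield_dir pull_op_outer//; last by left.
    rewrite (eq_bigr (fun i : 'I_n.+1 => am%:C * ((kap (i%:R - j%:R))%:C * (A j - A i))
     - ap%:C * ((kap (i%:R - j%:R))%:C * (wv (1 * (i%:R + j%:R)) * (B j - B i))))) => [|i _].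
      by rewrite sumrB -!mulr_sumr -/A -/(B j) -/(B 0); ring.
    by rewrite -/(B i) -/(B j) -/A; ring.
  rewrite big_split /= sumrB big_split /= -!mulr_sumr big_split /= -!mulr_sumr.
  by [].
have -> : conjc (pt w 0) = B 0 by [].
rewrite -/A /blockA /blockB.
have -> : ap = am + 1 by rewrite /half_succ /half_pred; field.
move: (am) (s1 alpha n) (smode t) (smode (t + 1)) => a S1 Sk Sks.
move: (\sum_(j < n.+1 | j != 0) _) (fourier A t) (A 0) (B 0) => T F A0 B0.
move: (if _ then _ else _) (if _ then _ else _) => d1 d2.
by rewrite !(rmorphD, rmorphM, rmorphB, rmorph1) /=; ring.
Qed.

Lemma center_dfield mu w :
  pt (dfield alpha (mu + s1 alpha n) (mass mu) (abar R n) w) 0 =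
  (mu + s1 alpha n + n%:R * am)%:C * pt w 0 - am%:C * fourier (pt w) (-1)
   - ap%:C * conjc (fourier (pt w) 1).
Proof.
rewrite pt_dfield_dir.
rewrite pull_op_center//; last by left.
have c1 : \sum_(i < n.+1 | i != 0) (pt w 0 - pt w i) = n%:R * pt w 0 - fourier (pt w) (-1).
  rewrite sumrB; congr (_ - _).
    by rewrite big_mkcond big_ord_recl /= add0r sumr_const card_ord mulr_natl.
  by apply: eq_bigr => i _; rewrite addNr mulr0 oppr0 wv0 mul1r.
have c2 : \sum_(i < n.+1 | i != 0) wv (1 * (2 * i%:R)) * (conjc (pt w 0) - conjc (pt w i)) =
    - conjc (fourier (pt w) 1).
  have := fourier_conj (pt w) (-1); rewrite opprK => ->.
  under eq_bigr do rewrite mulrBr.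
  rewrite sumrB -mulr_suml.
  have -> : \sum_(i < n.+1 | i != 0) wv (1 * (2 * i%:R)) = 0.
    rewrite (eq_bigr (fun i : 'I_n.+1 => wv (i%:R * 2%:R))) => [|i _]; last by congr wv; ring.
    rewrite sum_wv_outer ?wv_eq1//; last exact: mode_nat.
    by case: ifP => // /dvdn_leq; lia.
  rewrite mul0r sub0r; congr (- _); apply: eq_bigr => i _.
  by congr (wv _ * _); ring.
rewrite big_split -!mulr_sumr /= c1.
rewrite (eq_bigr (fun i : 'I_n.+1 => ap%:C * (wv (1 * (2 * i%:R)) * (conjc (pt w 0) - conjc (pt w i))))) => [|i _]; last by rewrite -mulrA.
rewrite -mulr_sumr c2 !(rmorphD, rmorphM, rmorph_nat) /=; ring.
Qed.

End Spectrum.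

(** * The blocks of the Hessian and their signs *)

Lemma det2_fun (F : comPzRingType) (f : nat -> nat -> F) :
  \det (\matrix_(i < 2, j < 2) f i j) = f 0%N 0%N * f 1%N 1%N - f 0%N 1%N * f 1%N 0%N.
Proof.
rewrite (expand_det_row _ ord0) !big_ord_recl big_ord0 /cofactor !det_mx11.
rewrite !mxE /= /bump /=; ring.
Qed.

Lemma det3_fun (F : comPzRingType) (f : nat -> nat -> F) :
  \det (\matrix_(i < 3, j < 3) f i j) =
  f 0%N 0%N * (f 1%N 1%N * f 2%N 2%N - f 1%N 2%N * f 2%N 1%N)
  - f 0%N 1%N * (f 1%N 0%N * f 2%N 2%N - f 1%N 2%N * f 2%N 0%N)
  + f 0%N 2%N * (f 1%N 0%N * f 2%N 1%N - f 1%N 1%N * f 2%N 0%N).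
Proof.
rewrite (expand_det_row _ ord0) !big_ord_recl big_ord0 /cofactor.
have E h : row' ord0 (col' h (\matrix_(i < 3, j < 3) f i j)) =
   \matrix_(i < 2, j < 2) f i.+1 (bump h j).
  by apply/matrixP => i j; rewrite !mxE.
rewrite !E !(det2_fun (fun i j => f i.+1 (bump _ j))) !mxE /= /bump /=; ring.
Qed.

Section Sigma.
Context {R : realType} {n : nat}.
Variables (alpha : R) (phi : R -> R).
Hypothesis n3 : (3 <= n)%N.
Hypothesis phiP : forall r : R, 0 < r -> is_derive r 1 phi (- r `^ (- alpha)).
Implicit Types (i j : 'I_n.+1) (c : 'I_2).
Local Notation wv := (@wv R n).
Local Notation am := (half_pred alpha).
Local Notation ap := (half_succ alpha).
Local Notation blockA := (@block_diag R n alpha).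
Local Notation blockB := (@block_off R n alpha).

Let n0 : (0 < n)%N. Proof. exact: leq_trans n3. Qed.
Let ii : 'i%C * 'i%C = -1 :> R[i]. Proof. by rewrite -expr2 sqr_i. Qed.

Let hc (z : 'cV[R[i]]_2) : R[i] := z 0 0 + 'i%C * z 1 0.
Let ac (z : 'cV[R[i]]_2) : R[i] := z 0 0 - 'i%C * z 1 0.

Lemma holo_antiholo_inj (X Y : cconfig R n) :
  holo X =1 holo Y -> antiholo X =1 antiholo Y -> X = Y.
Proof.
move=> h a; apply/matrixP => j c.
have E0 : X j 0 = Y j 0.
  have: 2 * X j 0 = 2 * Y j 0.
    have -> : 2 * X j 0 = holo X j + antiholo X j by rewrite /holo /antiholo; ring.
    by rewrite h a /holo /antiholo; ring.
  by apply: mulfI; rewrite pnatr_eq0.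
have E1 : X j 1 = Y j 1.
  have : 'i%C * X j 1 = 'i%C * Y j 1.
    by have := h j; rewrite /holo E0 => /addrI.
  by apply: mulfI; rewrite eq_complex /= negb_and oner_eq0 orbT.
have [->|c0] := eqVneq c 0; first by [].
suff -> : c = 1 by [].
by apply: val_inj; move: c0 (ltn_ord c); case: c => [[|[|]]].
Qed.

Let cn : R[i] := ((Num.sqrt n%:R)^-1)%:C.

Let cn0 : cn != 0.
Proof.
by rewrite /cn eq_complex /= negb_and invr_eq0 sqrtr_eq0 -ltNge ltr0n n0.
Qed.

Let wv_cs t : wv t = (cos (t * zeta R n))%:C + 'i%C * (sin (t * zeta R n))%:C.
Proof. by rewrite [LHS]complexE. Qed.

Let wave_entries k j z :
  wave n k j z 0 0 = cn * wv (j%:R * k%:R) *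
    ((cos (j%:R * zeta R n))%:C * z 0 0 - (sin (j%:R * zeta R n))%:C * z 1 0) /\
  wave n k j z 1 0 = cn * wv (j%:R * k%:R) *
    ((sin (j%:R * zeta R n))%:C * z 0 0 + (cos (j%:R * zeta R n))%:C * z 1 0).
Proof. by rewrite /wave !mxE !sum2 !mxE /= natrM mulNr. Qed.

Lemma hc_wave k j z :
  hc (wave n k j z) = wv ((k%:R + 1) * j%:R) * (cn * hc z).
Proof.
have [e0 e1] := wave_entries k j z; rewrite /hc e0 e1.
have -> : (k%:R + 1) * j%:R = j%:R * k%:R + j%:R :> R by ring.
rewrite wvD (wv_cs j%:R); move: (wv _) (cos _)%:C (sin _)%:C => w c s.
have -> : w * (c + 'i%C * s) * (cn * (z 0 0 + 'i%C * z 1 0)) =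
  w * cn * (c * z 0 0 + 'i%C * (s * z 0 0 + c * z 1 0) + ('i%C * 'i%C) * (s * z 1 0)) by ring.
by rewrite ii; ring.
Qed.

Lemma ac_wave k j z :
  ac (wave n k j z) = wv ((k%:R - 1) * j%:R) * (cn * ac z).
Proof.
have [e0 e1] := wave_entries k j z; rewrite /ac e0 e1.
have -> : (k%:R - 1) * j%:R = j%:R * k%:R + - j%:R :> R by ring.
rewrite wvD (wv_cs (- j%:R)) mulNr cosN sinN rmorphN /=.
move: (wv _) (cos _)%:C (sin _)%:C => w c s.
have -> : w * (c + 'i%C * - s) * (cn * (z 0 0 - 'i%C * z 1 0)) =
  w * cn * (c * z 0 0 - 'i%C * (s * z 0 0 + c * z 1 0) + ('i%C * 'i%C) * (s * z 1 0)) by ring.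
by rewrite ii; ring.
Qed.

Let hc_inj z z' : hc z = hc z' -> ac z = ac z' -> z = z'.
Proof.
move=> h a.
pose X := (\matrix_(j, c) (z c 0)) : cconfig R n.
pose Y := (\matrix_(j, c) (z' c 0)) : cconfig R n.
have : X = Y by apply: holo_antiholo_inj => j; rewrite /holo /antiholo !mxE.
by move=> /matrixP XY; apply/matrixP => c d; have := XY 0 c; rewrite !mxE (ord1 d).
Qed.

Lemma holo_hess mu (X : cconfig R n) j :
  holo (hess_act (V phi alpha mu) (abar R n) X) j = (mass mu j)%:C *
    pull_op alpha (mu + s1 alpha n) (mass mu) (abar R n) (dir 1) (holo X) (antiholo X) j.
Proof.
rewrite (hess_actE _ _ phiP)//; last exact: collision_free_abar.
have -> : pull_op alpha (mu + s1 alpha n) (mass mu) (abar R n) (dir 1) (holo X) (antiholo X) j =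
  holo (dfieldC alpha (mu + s1 alpha n) (mass mu) (abar R n) X) j.
  rewrite holo_dfieldC /pull_op; congr (_ - _).
  by apply: eq_bigr => i _; rewrite !dir_pt.
by rewrite /holo ![(\matrix_(_, _) (_ * _)) _ _]mxE; ring.
Qed.

Lemma antiholo_hess mu (X : cconfig R n) j :
  antiholo (hess_act (V phi alpha mu) (abar R n) X) j = (mass mu j)%:C *
    pull_op alpha (mu + s1 alpha n) (mass mu) (abar R n) (dir (-1)) (antiholo X) (holo X) j.
Proof.
rewrite (hess_actE _ _ phiP)//; last exact: collision_free_abar.
have -> : pull_op alpha (mu + s1 alpha n) (mass mu) (abar R n) (dir (-1)) (antiholo X) (holo X) j =
  antiholo (dfieldC alpha (mu + s1 alpha n) (mass mu) (abar R n) X) j.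
  rewrite antiholo_dfieldC /pull_op; congr (_ - _).
  by apply: eq_bigr => i _; rewrite !dir_conj.
by rewrite /antiholo ![(\matrix_(_, _) (_ * _)) _ _]mxE; ring.
Qed.

(** The matrix chosen by [xget] is determined because [T] is injective. *)
Let block_unique d (T : 'cV[R[i]]_d -> cconfig R n) (f : config R n -> R) a B :
  injective T -> (forall z, hess_act f a (T z) = T (B *m z)) -> block f a T = B.
Proof.
move=> Tinj hB; rewrite /block; apply: xget_unique => //= B' hB'.
apply/matrixP => i j; have : B' *m delta_mx j 0 = B *m delta_mx j 0 :> 'cV_d.
  by apply: Tinj; rewrite -hB -hB'.
move=> /matrixP /(_ i 0).
by rewrite -!colE !mxE.
Qed.

(** The block [B_k], obtained from the matrix with entries [blockA] and
    [blockB] by passing from the coordinates [z0 + i z1], [z0 - i z1] back to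
    [z0], [z1]. *)
Definition block_fun (mu t : R) (i j : nat) : R[i] :=
  let a := blockA mu t in let d := blockA mu (- t) in let b := blockB mu t in
  if i == 0%N then (if j == 0%N then ((a + d) / 2 + b)%:C else 'i%C * ((a - d) / 2)%:C)
  else (if j == 0%N then - ('i%C * ((a - d) / 2)%:C) else ((a + d) / 2 - b)%:C).

Definition block_mx2 mu t : 'M[R[i]]_2 := \matrix_(i < 2, j < 2) block_fun mu t i j.

Let two_half (a : R) : a%:C = (a / 2)%:C + (a / 2)%:C.
Proof. by rewrite -rmorphD; congr (_%:C); field. Qed.

Let block_mx2_coord mu t (z : 'cV[R[i]]_2) :
  hc (block_mx2 mu t *m z) = (blockA mu t)%:C * hc z + (blockB mu t)%:C * ac z /\
  ac (block_mx2 mu t *m z) = (blockA mu (- t))%:C * ac z + (blockB mu t)%:C * hc z.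
Proof.
rewrite /hc /ac !mxE !sum2 !mxE /block_fun /=.
move: (blockA mu t) (blockA mu (- t)) (blockB mu t) (z 0 0) (z 1 0) => a d b z0 z1.
rewrite (two_half a) (two_half d).
have -> : (a + d) / 2 = a / 2 + d / 2 by field.
have -> : (a - d) / 2 = a / 2 - d / 2 by field.
rewrite !(rmorphB, rmorphD) /=.
move: (a / 2)%:C (d / 2)%:C b%:C => {}a {}d {}b; split.
  have -> : (a + d + b) * z0 + 'i%C * (a - d) * z1 +
    'i%C * (- ('i%C * (a - d)) * z0 + (a + d - b) * z1) = (a + d + b) * z0 + 'i%C * (a - d) * z1
    - ('i%C * 'i%C) * (a - d) * z0 + 'i%C * (a + d - b) * z1 by ring.
  by rewrite ii; ring.
have -> : (a + d + b) * z0 + 'i%C * (a - d) * z1 -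
  'i%C * (- ('i%C * (a - d)) * z0 + (a + d - b) * z1) = (a + d + b) * z0 + 'i%C * (a - d) * z1
  + ('i%C * 'i%C) * (a - d) * z0 - 'i%C * (a + d - b) * z1 by ring.
by rewrite ii; ring.
Qed.

Let TkE k (z : 'cV[R[i]]_2) j c :
  Tk n k z j c = if j == 0 then 0 else wave n k j z c 0.
Proof. by rewrite mxE. Qed.

Let holo_Tk k z j : holo (Tk n k z) j = if j == 0 then 0 else wv ((k%:R + 1) * j%:R) * (cn * hc z).
Proof.
rewrite /holo !TkE; case: ifP => _; first by rewrite mulr0 addr0.
exact: hc_wave.
Qed.

Let antiholo_Tk k z j : antiholo (Tk n k z) j = if j == 0 then 0 else wv ((k%:R - 1) * j%:R) * (cn * ac z).
Proof.
rewrite /antiholo !TkE; case: ifP => _; first by rewrite mulr0 subr0.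
exact: ac_wave.
Qed.

Let ord_max_neq0 : (ord_max : 'I_n.+1) != 0.
Proof. by apply/eqP => /(congr1 val) /=; lia. Qed.

Let Tk_inj k : injective (@Tk R n k).
Proof.
move=> z z' zz'.
have h : holo (Tk n k z) ord_max = holo (Tk n k z') ord_max by rewrite zz'.
have a : antiholo (Tk n k z) ord_max = antiholo (Tk n k z') ord_max by rewrite zz'.
move: h a; rewrite !holo_Tk !antiholo_Tk (negPf ord_max_neq0).
by move=> /(mulfI (wv_neq0 _ _)) /(mulfI cn0) h /(mulfI (wv_neq0 _ _)) /(mulfI cn0) a; exact: hc_inj.
Qed.

Let sum_wv0 t : integral_mode n t -> wv t != 1 ->
  \sum_(j < n.+1 | j != 0) wv (t * j%:R) = 0.
Proof.
move=> ht t1; under eq_bigr do rewrite mulrC.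
by rewrite sum_wv_outer// (negPf t1).
Qed.

(** The hypotheses on [k] say that a wave of mode [k] exerts no net force on
    the central body. *)
Lemma Bk_eq k mu : wv (k%:R + 1) != 1 -> wv (k%:R - 1) != 1 ->
  Bk phi alpha n k mu = block_mx2 mu k%:R.
Proof.
move=> hp hm; apply: block_unique; first exact: Tk_inj.
have mk := mode_nat n0 k : integral_mode n (k%:R : R).
have m1 := mode1 n0 : integral_mode n (1 : R).
move=> z; have [eh ea] := block_mx2_coord mu k%:R z.
apply: holo_antiholo_inj => j.
  rewrite holo_hess holo_Tk; have [->|j0] := eqVneq j 0.
    rewrite pull_op_center//; last by left.
    rewrite holo_Tk antiholo_Tk eqxx mulr0 add0r.
    rewrite (eq_bigr (fun i : 'I_n.+1 => - (am%:C * cn * hc z + ap%:C * cn * ac z) * wv ((k%:R + 1) * i%:R))).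
      by rewrite -mulr_sumr sum_wv0 ?mulr0//; exact: modeD.
    move=> i i0; rewrite holo_Tk antiholo_Tk (negPf i0).
    have -> : (k%:R + 1) * i%:R = 1 * (2 * i%:R) + (k%:R - 1) * i%:R :> R by ring.
    by rewrite wvD; ring.
  rewrite (@pull_wave R n alpha n3 mu 1 k%:R (cn * hc z) (cn * ac z))//.
  - by rewrite holo_Tk antiholo_Tk eqxx !mulr0 addr0 mulr0 subr0 mul1r /mass (negPf j0) mul1r eh; ring.
  - by left.
  - by move=> i i0; rewrite holo_Tk (negPf i0).
  - by move=> i i0; rewrite antiholo_Tk (negPf i0).
rewrite antiholo_hess antiholo_Tk; have [->|j0] := eqVneq j 0.
  rewrite pull_op_center//; last by right.
  rewrite holo_Tk antiholo_Tk eqxx mulr0 add0r.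
  rewrite (eq_bigr (fun i : 'I_n.+1 => - (am%:C * cn * ac z + ap%:C * cn * hc z) * wv ((k%:R - 1) * i%:R))).
    by rewrite -mulr_sumr sum_wv0 ?mulr0//; exact: modeB.
  move=> i i0; rewrite holo_Tk antiholo_Tk (negPf i0).
  have -> : (k%:R - 1) * i%:R = -1 * (2 * i%:R) + (k%:R + 1) * i%:R :> R by ring.
  by rewrite wvD; ring.
rewrite (@pull_wave R n alpha n3 mu (-1) k%:R (cn * ac z) (cn * hc z))//.
- by rewrite holo_Tk antiholo_Tk eqxx !mulr0 addr0 mulr0 subr0 mulN1r /mass (negPf j0) mul1r ea; ring.
- by right.
- by move=> i i0; rewrite antiholo_Tk (negPf i0).
- by move=> i i0; rewrite holo_Tk (negPf i0) opprK.
Qed.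

Definition block_det mu t : R := blockA mu t * blockA mu (- t) - blockB mu t ^+ 2.
Local Notation det2 := block_det.

Lemma det_block_mx2 mu t : \det (block_mx2 mu t) = (det2 mu t)%:C.
Proof.
rewrite /block_mx2 (det2_fun (block_fun mu t)) /block_fun /det2 /=.
move: (blockA mu t) (blockA mu (- t)) (blockB mu t) => a d b.
have -> : 'i%C * ((a - d) / 2)%:C * - ('i%C * ((a - d) / 2)%:C) =
  - ('i%C * 'i%C) * (((a - d) / 2) ^+ 2)%:C by rewrite rmorphXn /=; ring.
by rewrite ii opprK mul1r -rmorphM -rmorphB; congr (_%:C); field.
Qed.

Lemma wv_neighbours_neq1 (k : nat) : (1 < k <= n./2)%N \/ k = n ->
  wv (k%:R + 1) != 1 /\ wv (k%:R - 1) != 1.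
Proof.
have half : (n./2.*2 <= n)%N by rewrite -{2}(odd_double_half n) leq_addl.
move=> hk; rewrite natr1.
have -> : k%:R - 1 = (k - 1)%N%:R :> R by rewrite natrB//; lia.
rewrite !wv_eq1//; split; apply/negP => h.
  by case: hk => [hk|kn]; [have := dvdn_leq _ h; lia|move: h; rewrite kn -addn1 dvdn_addr// => /dvdn_leq; lia].
case: hk => [hk|kn]; first by have := dvdn_leq _ h; lia.
by have := dvdn_leq _ h; lia.
Qed.

Lemma sigma_generic k mu : (1 < k)%N -> (k.*2 < n)%N ->
  sigma phi alpha n k mu = Num.sg (det2 mu k%:R).
Proof.
move=> k1 kn; rewrite /sigma.
have -> : (k == n) || (k.*2 == n) = false by apply/negP => /orP[]/eqP; lia.
have -> : (k == 1%N) = false by apply/negP => /eqP; lia.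
have [|hp hm] := @wv_neighbours_neq1 k; first by left; have := odd_double_half n; lia.
by rewrite Bk_eq// det_block_mx2.
Qed.

Lemma sigma_half k mu : (1 < k)%N -> k.*2 = n ->
  sigma phi alpha n k mu = Num.sg (blockA mu k%:R + blockB mu k%:R).
Proof.
move=> k1 kn; rewrite /sigma.
have -> : (k == n) || (k.*2 == n) by rewrite kn eqxx orbT.
have [|hp hm] := @wv_neighbours_neq1 k; first by left; have := odd_double_half n; lia.
rewrite Bk_eq// trmx_delta -rowE -colE !mxE /block_fun /=.
suff -> : blockA mu (- k%:R) = blockA mu k%:R by congr Num.sg; field.
have nE : n%:R = k%:R + k%:R :> R by rewrite -natrD addnn kn.
rewrite /block_diag; congr (_ + am * _); rewrite -(smodeDn n0); congr (mode_sum _ _ _).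
by rewrite nE; ring.
Qed.

Lemma sigma_n mu : sigma phi alpha n n mu = Num.sg ((alpha + 1) * (mu + s1 alpha n)).
Proof.
rewrite /sigma eqxx /=.
have [|hp hm] := @wv_neighbours_neq1 n; first by right.
rewrite Bk_eq// trmx_delta -rowE -colE !mxE /block_fun /=; congr Num.sg.
rewrite /block_diag /block_off.
have -> : mode_sum n alpha (n%:R + 1) = s1 alpha n by rewrite addrC (smodeDn n0) (smode1 n0).
have -> : mode_sum n alpha (- n%:R + 1) = s1 alpha n.
  by rewrite -(smodeDn n0) (_ : _ + _ = 1) ?(smode1 n0)//; ring.
have -> : mode_sum n alpha n%:R = 0 by rewrite -[n%:R]add0r (smodeDn n0) smode0.
by rewrite /half_pred /half_succ; field.
Qed.

(** The factor of [det B_1] other than [mu] and [mu + s1], which correspond to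
    the free central body and to the translations. *)
Definition reduced_det (mu : R) : R :=
  blockA mu 1 * (ap * mu + s1 alpha n + n%:R * am)
  - ap * mu * (ap * mu + ap * n%:R).
Local Notation ell := reduced_det.

Let t2n : R := Num.sqrt (2 * n%:R).

Let t2nE : t2n ^+ 2 = 2 * n%:R.
Proof. by rewrite sqr_sqrtr// mulr_ge0. Qed.

(** The block of the mode 1 in the basis of the central body and the two
    components. The constant [t2n] collects the normalisations [1 / sqrt 2] of
    [v1] and [1 / sqrt n] of the waves. *)
Definition b1_fun (mu : R) (i j : nat) : R[i] :=
  match i, j with
  | 0%N, 0%N => (mu * (mu + s1 alpha n + n%:R * am))%:C
  | 0%N, 1%N | 1%N, 0%N => (- (mu * t2n * alpha / 2))%:C
  | 0%N, _ => - ('i%C * (mu * t2n / 2)%:C)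
  | _, 0%N => 'i%C * (mu * t2n / 2)%:C
  | i'.+1, j'.+1 => block_fun mu 1 i' j'
  end.

Definition b1_mx mu : 'M[R[i]]_(1 + 2) := \matrix_(i < 3, j < 3) b1_fun mu i j.

Lemma det_b1_mx mu : \det (b1_mx mu) = (mu * (mu + s1 alpha n) * ell mu)%:C.
Proof.
rewrite /b1_mx (det3_fun (b1_fun mu)) /b1_fun /block_fun /ell /=.
have -> : blockA mu (- 1) = ap * mu + s1 alpha n.
  by rewrite /block_diag addNr smode0 mulr0 addr0.
have -> : blockB mu 1 = ap * mu by rewrite /block_off (smode1 n0) addrK.
move: (blockA mu 1) (s1 alpha n) => a S.
have hap : ap = (alpha + 1) / 2 by []. have ham : am = (alpha - 1) / 2 by [].
rewrite hap ham; apply/eqP; rewrite eq_complex; apply/andP; split; apply/eqP.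
  have := t2nE; move: t2n (n%:R : R) => t N tN.
  have -> : N = t ^+ 2 / 2 by rewrite tN mulrC mulKf// pnatr_eq0.
  by rewrite /=; field.
by rewrite /=; field.
Qed.

Let sq2 : R := Num.sqrt 2.

Let sq2_gt0 : 0 < sq2. Proof. by rewrite sqrtr_gt0. Qed.

Let sqn_gt0 : 0 < Num.sqrt (n%:R : R). Proof. by rewrite sqrtr_gt0 ltr0n. Qed.

Let sq2E : sq2 ^+ 2 = 2. Proof. by rewrite sqr_sqrtr. Qed.

Let t2n_prod : t2n = sq2 * Num.sqrt n%:R.
Proof. by rewrite /t2n sqrtrM. Qed.

Let T1E (z : 'cV[R[i]]_(1 + 2)) j c :
  T1 n z j c = if j == 0 then v1 R c 0 * usubmx z 0 0 else wave n 1 j (dsubmx z) c 0.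
Proof. by rewrite mxE. Qed.

Let v1E : v1 R 0 0 = (sq2^-1)%:C /\ v1 R 1 0 = (sq2^-1)%:C * 'i%C.
Proof. by rewrite /v1 !mxE /= mulr1. Qed.

Let holo_T1 z j : holo (T1 n z) j = if j == 0 then 0 else wv ((1 + 1) * j%:R) * (cn * hc (dsubmx z)).
Proof.
rewrite /holo !T1E; case: ifP => _; last exact: hc_wave.
have [-> ->] := v1E.
have -> : (sq2^-1)%:C * usubmx z 0 0 + 'i%C * ((sq2^-1)%:C * 'i%C * usubmx z 0 0) =
  (sq2^-1)%:C * usubmx z 0 0 * (1 + 'i%C * 'i%C) by ring.
by rewrite ii subrr mulr0.
Qed.

Let antiholo_T1 z j : antiholo (T1 n z) j =
  if j == 0 then sq2%:C * usubmx z 0 0 else wv ((1 - 1) * j%:R) * (cn * ac (dsubmx z)).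
Proof.
rewrite /antiholo !T1E; case: ifP => _; last exact: ac_wave.
have [-> ->] := v1E.
have -> : (sq2^-1)%:C * usubmx z 0 0 - 'i%C * ((sq2^-1)%:C * 'i%C * usubmx z 0 0) =
  (sq2^-1)%:C * usubmx z 0 0 * (1 - 'i%C * 'i%C) by ring.
rewrite ii opprK mulrAC; congr (_ * _); rewrite -[1 + 1](rmorph_nat (real_complex R) 2).
rewrite -rmorphM; congr (_%:C); rewrite -sq2E; field; exact: lt0r_neq0.
Qed.

Let T1_inj : injective (@T1 R n).
Proof.
move=> z z' zz'.
have h : holo (T1 n z) ord_max = holo (T1 n z') ord_max by rewrite zz'.
have a : antiholo (T1 n z) ord_max = antiholo (T1 n z') ord_max by rewrite zz'.
have a0 : antiholo (T1 n z) 0 = antiholo (T1 n z') 0 by rewrite zz'.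
move: h a a0; rewrite !holo_T1 !antiholo_T1 (negPf ord_max_neq0) eqxx.
move=> /(mulfI (wv_neq0 _ _)) /(mulfI cn0) h /(mulfI (wv_neq0 _ _)) /(mulfI cn0) a.
have s0 : sq2%:C != 0 by rewrite eq_complex /= negb_and gt_eqF.
move=> /(mulfI s0) u; rewrite -[z]vsubmxK -[z']vsubmxK; congr col_mx.
  by apply/matrixP => i j; rewrite (ord1 i) (ord1 j).
exact: hc_inj.
Qed.

Let b1_coord mu (z : 'cV[R[i]]_(1 + 2)) :
  [/\ usubmx (b1_mx mu *m z) 0 0 = (mu * (mu + s1 alpha n + n%:R * am))%:C * usubmx z 0 0
     - (mu * t2n / 2)%:C * (ap%:C * hc (dsubmx z) + am%:C * ac (dsubmx z)),
   hc (dsubmx (b1_mx mu *m z)) = (blockA mu 1)%:C * hc (dsubmx z)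
     + (blockB mu 1)%:C * ac (dsubmx z) - (mu * ap * t2n)%:C * usubmx z 0 0 &
   ac (dsubmx (b1_mx mu *m z)) = (blockA mu (- 1))%:C * ac (dsubmx z)
     + (blockB mu 1)%:C * hc (dsubmx z) - (mu * am * t2n)%:C * usubmx z 0 0].
Proof.
pose u := usubmx z 0 0; pose w := dsubmx z.
have E (i : 'I_(1 + 2)) : (b1_mx mu *m z) i 0 =
    b1_fun mu i 0 * u + b1_fun mu i 1 * w 0 0 + b1_fun mu i 2 * w 1 0.
  rewrite mxE !big_ord_recl big_ord0 addr0 addrA /u /w !mxE.
  by congr (_ * _ + _ * _ + _ * _); congr (z _ _); apply: val_inj.
have eu : usubmx (b1_mx mu *m z) 0 0 =
    b1_fun mu 0 0 * u + b1_fun mu 0 1 * w 0 0 + b1_fun mu 0 2 * w 1 0.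
  by rewrite [LHS]mxE E.
have ew0 : dsubmx (b1_mx mu *m z) 0 0 =
    b1_fun mu 1 0 * u + b1_fun mu 1 1 * w 0 0 + b1_fun mu 1 2 * w 1 0.
  by rewrite [LHS]mxE E.
have ew1 : dsubmx (b1_mx mu *m z) 1 0 =
    b1_fun mu 2 0 * u + b1_fun mu 2 1 * w 0 0 + b1_fun mu 2 2 * w 1 0.
  by rewrite [LHS]mxE E.
have [eh ea] := block_mx2_coord mu 1 w.
have bE : (block_mx2 mu 1 *m w) 0 0 = b1_fun mu 1 1 * w 0 0 + b1_fun mu 1 2 * w 1 0 /\
    (block_mx2 mu 1 *m w) 1 0 = b1_fun mu 2 1 * w 0 0 + b1_fun mu 2 2 * w 1 0.
  by split; rewrite !mxE sum2 !mxE.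
have -> : hc (dsubmx (b1_mx mu *m z)) =
    (b1_fun mu 1 0 + 'i%C * b1_fun mu 2 0) * u + hc (block_mx2 mu 1 *m w).
  by rewrite /hc ew0 ew1 bE.1 bE.2; ring.
have -> : ac (dsubmx (b1_mx mu *m z)) =
    (b1_fun mu 1 0 - 'i%C * b1_fun mu 2 0) * u + ac (block_mx2 mu 1 *m w).
  by rewrite /ac ew0 ew1 bE.1 bE.2; ring.
rewrite eh ea eu -/u -/w /b1_fun; split.
- have -> : (- (mu * t2n * alpha / 2))%:C = - ((mu * t2n / 2)%:C * (ap + am)%:C).
    by rewrite -rmorphM -rmorphN; congr (_%:C); rewrite /half_succ /half_pred; field.
  have e1 : ap%:C - am%:C = 1 :> R[i].
    by rewrite -rmorphB /= /half_succ /half_pred (_ : _ - _ = 1)//; field.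
  rewrite /hc /ac rmorphD /=.
  have -> : ap%:C * (w 0 0 + 'i%C * w 1 0) + am%:C * (w 0 0 - 'i%C * w 1 0) =
    (ap%:C + am%:C) * w 0 0 + (ap%:C - am%:C) * 'i%C * w 1 0 by ring.
  rewrite e1; move: (mu * t2n / 2)%:C => q; ring.
- have -> : (- (mu * t2n * alpha / 2))%:C + 'i%C * ('i%C * (mu * t2n / 2)%:C) = - (mu * ap * t2n)%:C.
    rewrite mulrA ii mulN1r -!rmorphN -?rmorphD; congr (_%:C); rewrite /half_succ.
    by field.
  by ring.
- have -> : (- (mu * t2n * alpha / 2))%:C - 'i%C * ('i%C * (mu * t2n / 2)%:C) = - (mu * am * t2n)%:C.
    rewrite mulrA ii mulN1r -!rmorphN -?rmorphD; congr (_%:C); rewrite /half_pred.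
    by field.
  by ring.
Qed.

Lemma B1_eq mu : B1 phi alpha n mu = b1_mx mu.
Proof.
apply: block_unique; first exact: T1_inj.
have m1 := mode1 n0 : integral_mode n (1 : R).
move=> z; have [eu eh ea] := b1_coord mu z.
set u := usubmx z 0 0 in eu eh ea *; set w := dsubmx z in eu eh ea *.
have cs : cn * t2n%:C = sq2%:C.
  by rewrite /cn t2n_prod -rmorphM; congr (_%:C); field; exact: lt0r_neq0.
have wv2 : wv (1 + 1) != 1.
  by rewrite (_ : 1 + 1 = 2%:R :> R)// wv_eq1//; apply/negP => /dvdn_leq; lia.
apply: holo_antiholo_inj => j.
  rewrite holo_hess holo_T1; have [->|j0] := eqVneq j 0.
    rewrite pull_op_center//; last by left.
    rewrite holo_T1 antiholo_T1 eqxx mulr0 add0r.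
    rewrite (eq_bigr (fun i : 'I_n.+1 => (ap%:C * (sq2%:C * u - cn * ac w) - am%:C * cn * hc w) * wv ((1 + 1) * i%:R))).
      by rewrite -mulr_sumr sum_wv0 ?mulr0//; exact: modeD.
    move=> i i0; rewrite holo_T1 antiholo_T1 (negPf i0) subrr mul0r wv0 -/u -/w.
    have -> : 1 * (2 * i%:R) = (1 + 1) * i%:R :> R by ring.
    by ring.
  rewrite (@pull_wave R n alpha n3 mu 1 1 (cn * hc w) (cn * ac w))//.
  - have -> : 1 * (2 * j%:R) = (1 + 1) * j%:R :> R by ring.
    rewrite holo_T1 antiholo_T1 eqxx mulr0 add0r /mass (negPf j0) !mul1r eh -/u -/w.
    by rewrite -cs !rmorphM /=; ring.
  - by left.
  - by move=> i i0; rewrite holo_T1 (negPf i0).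
  - by move=> i i0; rewrite antiholo_T1 (negPf i0).
rewrite antiholo_hess antiholo_T1; have [->|j0] := eqVneq j 0.
  rewrite pull_op_center//; last by right.
  rewrite holo_T1 antiholo_T1 eqxx -/u -/w.
  rewrite (eq_bigr (fun i : 'I_n.+1 => (am%:C * (sq2%:C * u - cn * ac w) - ap%:C * cn * hc w))).
    rewrite big_mkcond big_ord_recl /= add0r sumr_const card_ord -[_ *+ n]mulr_natl.
    rewrite /mass eqxx eu -/u -/w.
    have cnn : n%:R * cn = sq2%:C * (t2n / 2)%:C.
      rewrite /cn t2n_prod -rmorphM -(rmorph_nat (real_complex R)) -rmorphM; congr (_%:C).
      have := sqr_sqrtr (ler0n R n); move: (Num.sqrt _) sqn_gt0 => s s0 sE.
      rewrite -sE; have -> : sq2 * (sq2 * s / 2) = sq2 ^+ 2 / 2 * s by ring.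
      by rewrite sq2E; field; exact: lt0r_neq0.
    have -> : n%:R * (am%:C * (sq2%:C * u - cn * ac w) - ap%:C * cn * hc w) =
      n%:R * am%:C * sq2%:C * u - n%:R * cn * (am%:C * ac w + ap%:C * hc w) by ring.
    rewrite cnn.
    have -> : (mu * t2n / 2) = mu * (t2n / 2) by rewrite mulrA.
    by rewrite !(rmorphM, rmorphD, rmorph_nat) /=; ring.
  move=> i i0; rewrite holo_T1 antiholo_T1 (negPf i0) subrr mul0r wv0 -/u -/w.
  have e1 : wv (-1 * (2 * i%:R)) * wv ((1 + 1) * i%:R) = 1.
    by rewrite -wvD (_ : _ + _ = 0) ?wv0//; ring.
  have -> : am%:C * (sq2%:C * u - 1 * (cn * ac w)) +
    ap%:C * wv (-1 * (2 * i%:R)) * (0 - wv ((1 + 1) * i%:R) * (cn * hc w)) =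
    am%:C * (sq2%:C * u - cn * ac w) -
    ap%:C * (wv (-1 * (2 * i%:R)) * wv ((1 + 1) * i%:R)) * (cn * hc w) by ring.
  by rewrite e1; ring.
rewrite (@pull_wave R n alpha n3 mu (-1) 1 (cn * ac w) (cn * hc w))//.
- rewrite holo_T1 antiholo_T1 eqxx mulr0 addr0 mulN1r /mass (negPf j0) mul1r ea -/u -/w.
  by rewrite subrr mul0r wv0 -cs !rmorphM /=; ring.
- by right.
- by move=> i i0; rewrite antiholo_T1 (negPf i0).
- by move=> i i0; rewrite holo_T1 (negPf i0) opprK.
Qed.

Lemma sigma_1 mu : sigma phi alpha n 1 mu = Num.sg (mu * (mu + s1 alpha n) * ell mu).
Proof.
rewrite /sigma.
have -> : (1%N == n) || (1.*2 == n) = false by apply/negP => /orP[]/eqP; lia.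
by rewrite B1_eq det_b1_mx.
Qed.

End Sigma.

(** * The symmetry groups and their fixed spaces *)

Section ModIndex.
Variable n : nat.
Hypothesis n0 : (0 < n)%N.

Lemma mod_indexE m : mod_index n m = (if (n %| m)%N then n else m %% n)%N :> nat.
Proof.
by rewrite /mod_index inordK//; case: ifP => // _; rewrite ltnS ltnW// ltn_pmod.
Qed.

Lemma mod_index_neq0 m : mod_index n m != 0.
Proof.
apply/eqP => /(congr1 val); rewrite /= mod_indexE; case: ifP => h; first by lia.
by move=> h'; move: h; rewrite /dvdn h' eqxx.
Qed.

Lemma mod_index_mod m : mod_index n m = m %[mod n].
Proof.
by rewrite mod_indexE; case: ifP => [h|]; rewrite ?modn_mod// modnn; move: h => /eqP.
Qed.

Lemma mod_index_uniq (i j : 'I_n.+1) : i != 0 -> j != 0 -> i = j %[mod n] -> i = j.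
Proof.
move=> i0 j0.
have E (a : 'I_n.+1) : a != 0 -> mod_index n a = a.
  move=> a0; apply: val_inj; rewrite /= mod_indexE.
  have := ltn_ord a; rewrite ltnS leq_eqVlt => /orP[/eqP ->|an]; first by rewrite dvdnn.
  have ap : (0 < a)%N by rewrite lt0n.
  by rewrite gtnNdvd// modn_small.
move=> h; rewrite -(E i)// -(E j)//; apply: val_inj; rewrite /= !mod_indexE /dvdn.
by rewrite h.
Qed.

Definition body_shift (r : nat) (j : 'I_n.+1) : 'I_n.+1 :=
  if j == 0 then 0 else mod_index n (j + r).

Definition body_refl (j : 'I_n.+1) : 'I_n.+1 :=
  if j == 0 then 0 else mod_index n (n - j).

Lemma body_shift_eq0 r j : (body_shift r j == 0) = (j == 0).
Proof.
by rewrite /body_shift; case: ifP; rewrite ?eqxx// (negPf (mod_index_neq0 _)).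
Qed.

Lemma body_refl_eq0 j : (body_refl j == 0) = (j == 0).
Proof.
by rewrite /body_refl; case: ifP; rewrite ?eqxx// (negPf (mod_index_neq0 _)).
Qed.

Lemma body_shift_inj r : injective (body_shift r).
Proof.
move=> i j ij; have : (i == 0) = (j == 0) by rewrite -(body_shift_eq0 r) ij body_shift_eq0.
move: ij; rewrite /body_shift; case: eqVneq => [->|i0].
  by move=> _ /esym/eqP ->.
case: eqVneq => // j0 h _; apply: mod_index_uniq => //.
have : i + r = j + r %[mod n] by rewrite -(mod_index_mod (i + r)) h mod_index_mod.
by move=> /eqP; rewrite eqn_modDr => /eqP.
Qed.

Lemma body_refl_inj : injective body_refl.
Proof.
move=> i j ij; have : (i == 0) = (j == 0) by rewrite -body_refl_eq0 ij body_refl_eq0.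
move: ij; rewrite /body_refl; case: eqVneq => [->|i0].
  by move=> _ /esym/eqP ->.
case: eqVneq => // j0 h _; apply: mod_index_uniq => //.
have H : n - i = n - j %[mod n] by rewrite -(mod_index_mod (n - i)) h mod_index_mod.
have [hi hj] := (ltn_ord i, ltn_ord j).
have : i + j + (n - i) = i + j + (n - j) %[mod n].
  by apply/eqP; rewrite eqn_modDl; apply/eqP.
have -> : (i + j + (n - i) = j + n)%N by lia.
have -> : (i + j + (n - j) = i + n)%N by lia.
by rewrite !modnDr => ->.
Qed.

Lemma body_shift0 j : body_shift 0 j = j.
Proof.
rewrite /body_shift; case: eqVneq => [->//|j0]; rewrite addn0.
by apply: mod_index_uniq; rewrite ?mod_index_neq0// mod_index_mod.
Qed.

Lemma body_shiftD r s j : body_shift r (body_shift s j) = body_shift (r + s) j.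
Proof.
rewrite {1 3}/body_shift body_shift_eq0; case: eqVneq => // j0.
apply: mod_index_uniq; rewrite ?mod_index_neq0// !mod_index_mod.
rewrite /body_shift (negPf j0) -modnDml mod_index_mod modnDml.
by congr (_ %% _)%N; lia.
Qed.

End ModIndex.

Section Symmetry.
Context {R : realType} {n : nat}.
Variable alpha : R.
Hypothesis n0 : (0 < n)%N.
Implicit Types (x w : config R n) (i j : 'I_n.+1) (c : 'I_2).
Local Notation wv := (@wv R n).
Local Notation mode := (@integral_mode R n).

Lemma config_eq x y : pt x =1 pt y -> x = y.
Proof.
move=> h; apply/matrixP => j c; have [h0 h1] := h j.
have [->//|c0] := eqVneq c 0; suff -> : c = 1 by [].
by apply: val_inj; move: c0 (ltn_ord c); case: c => [[|[|]]].
Qed.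

Lemma pt_rot_sym h x j :
  pt (rot_sym h x) j = cis (- (2 * pi / h%:R)) * pt x (body_shift (n %/ h) j).
Proof. exact: pt_config_of. Qed.

Lemma pt_refl_sym x j : pt (refl_sym x) j = conjc (pt x (body_refl j)).
Proof. exact: pt_config_of. Qed.

Lemma cis_wv h : (h %| n)%N -> cis (- (2 * pi / h%:R)) = wv (- (n %/ h)%:R).
Proof.
move=> hn; have h0 : (0 < h)%N by apply: dvdn_gt0 hn.
rewrite /wv; congr cis; rewrite /zeta mulNr; congr (- _).
have nE : n%:R = (n %/ h)%:R * h%:R :> R by rewrite -natrM divnK.
have q0 : ((n %/ h)%:R : R) != 0 by rewrite pnatr_eq0 -lt0n divn_gt0// dvdn_leq.
by rewrite nE; field; rewrite q0 pnatr_eq0 -lt0n h0.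
Qed.

(** The equations for the two generators pass to compositions and inverses. *)
Lemma E_fixed h x : E h x <-> rot_sym h x = x /\ refl_sym x = x.
Proof.
split=> [Ex|[rx sx]].
  by split; apply: Ex; apply: gen_in; [left|right].
move=> g; elim=> {g} [|f [->|->]|f g _ fx _ gx|f g _ fx fg gf] //=.
  by rewrite gx.
by rewrite -{1}fx fg.
Qed.

Lemma rot_sym_linear h : linear (@rot_sym R n h).
Proof.
move=> k u v; apply: config_eq => j.
have ptD (a : R) (y z : config R n) i : pt (a *: y + z) i = a%:C * pt y i + pt z i.
  by rewrite /pt !mxE; simpc.
by rewrite ptD !pt_rot_sym ptD; ring.
Qed.

Lemma refl_sym_linear : linear (@refl_sym R n).
Proof.
move=> k u v; apply: config_eq => j.
have ptD (a : R) (y z : config R n) i : pt (a *: y + z) i = a%:C * pt y i + pt z i.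
  by rewrite /pt !mxE; simpc.
by rewrite ptD !pt_refl_sym ptD conjcD conjcM conjc_real.
Qed.

HB.instance Definition _ h :=
  GRing.isLinear.Build _ _ _ _ (@rot_sym R n h) (rot_sym_linear h).
HB.instance Definition _ :=
  GRing.isLinear.Build _ _ _ _ (@refl_sym R n) refl_sym_linear.

Definition fixed_vspace (h : nat) : {vspace config R n} :=
  (fixedSpace (linfun (@rot_sym R n h)) :&: fixedSpace (linfun (@refl_sym R n)))%VS.

Lemma mem_fixed h x : reflect (E h x) (x \in fixed_vspace h).
Proof.
apply: (iffP idP) => [|/E_fixed[rx sx]].
  by rewrite memv_cap => /andP[/fixedSpaceP + /fixedSpaceP]; rewrite !lfunE => rx sx; apply/E_fixed.
by rewrite memv_cap; apply/andP; split; apply/fixedSpaceP; rewrite lfunE.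
Qed.

Lemma wv_mod_index t m : mode t -> wv (t * (mod_index n m)%:R) = wv (t * m%:R).
Proof.
move=> ht; have H a : wv (t * a%:R) = wv (t * (a %% n)%N%:R).
  rewrite {1}(divn_eq a n) natrD natrM.
  have -> : t * ((a %/ n)%:R * n%:R + (a %% n)%:R) = (a %/ n)%:R * (n%:R * t) + t * (a %% n)%:R by ring.
  by rewrite wvD wv_exp ht expr1n mul1r.
by rewrite H mod_index_mod// -H.
Qed.

Lemma abar_fixed h : (h %| n)%N -> abar R n \in fixed_vspace h.
Proof.
move=> hn; have m1 := mode1 n0 : mode (1 : R).
apply/mem_fixed/E_fixed; split; apply: config_eq => j.
  rewrite pt_rot_sym cis_wv// !pt_abar body_shift_eq0//.
  rewrite /body_shift; case: eqVneq => [_|j0]; first by rewrite mulr0.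
  have := wv_mod_index (j + n %/ h) m1; rewrite !mul1r => ->.
  by rewrite -wvD natrD; congr wv; ring.
rewrite pt_refl_sym !pt_abar body_refl_eq0//.
rewrite /body_refl; case: eqVneq => [_|j0]; first exact: conjc0.
rewrite wvJ -mulN1r wv_mod_index; last exact: modeN.
have := ltn_ord j; rewrite ltnS => jn.
rewrite natrB// (_ : _ * _ = j%:R + - n%:R); last by ring.
by rewrite wvD -wvJ wvn// rmorph1 mulr1.
Qed.

(** ** Equivariance of the field *)

Lemma pt_field om m x j : pt (field alpha om m x) j =
  om%:C * pt x j - \sum_i (m i * rho alpha (sqdist x i j))%:C * (pt x j - pt x i).
Proof.
have H (f : 'I_n.+1 -> R) (g : 'I_n.+1 -> R[i]) :
    (\sum_i f i * complex.Re (g i)) +i* (\sum_i f i * complex.Im (g i)) = \sum_i (f i)%:C * g i.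
  elim/big_rec3: _ => // i a b s _ <-; case: (g i) => u v; simpc; congr (_ +i* _); ring.
rewrite -H /pt !mxE; simpc; congr (_ +i* _); congr (_ - _); apply: eq_bigr => i _ /=; ring.
Qed.

(** Here [g] is a linear isometry of the plane and [s] a permutation of bodies
    of equal masses; both respect distances, and so the forces. *)
Lemma field_equivariant om m x y (s : 'I_n.+1 -> 'I_n.+1) (g : R[i] -> R[i]) :
  injective s -> (forall i, m (s i) = m i) ->
  {morph g : u v / u - v} -> (forall (r : R) u, g (r%:C * u) = r%:C * g u) ->
  (forall u, g u * conjc (g u) = u * conjc u) ->
  (forall j, pt y j = g (pt x (s j))) ->
  forall j, pt (field alpha om m y) j = g (pt (field alpha om m x) (s j)).
Proof.
move=> sinj ms gB gZ gN hy j.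
have g0 : g 0 = 0 by have := gB 0 0; rewrite subr0 subrr.
have gD : {morph g : u v / u + v}.
  by move=> u v; rewrite -[v in u + v]opprK gB -[- v]sub0r gB g0 sub0r opprK.
rewrite !pt_field gB gZ -hy (big_morph g gD g0) [in RHS](reindex_inj sinj) /=.
congr (_ - _); apply: eq_bigr => i _; rewrite gZ gB -!hy ms; congr ((_ * rho _ _)%:C * _).
by apply: complexI; rewrite !sqdist_pt !hy -gB gN.
Qed.

Lemma field_fixed h om m x : (forall i j, i != 0 -> j != 0 -> m i = m j) ->
  x \in fixed_vspace h -> field alpha om m x \in fixed_vspace h.
Proof.
move=> hm /mem_fixed/E_fixed[rx sx]; apply/mem_fixed/E_fixed; split; apply: config_eq => j.
  rewrite pt_rot_sym; apply/esym.
  apply: (@field_equivariant om m x x (body_shift (n %/ h)) ( *%R (cis (- (2 * pi / h%:R))))).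
  - exact: body_shift_inj.
  - move=> i; have [->|i0] := eqVneq i 0; first by rewrite /body_shift eqxx.
    by apply: hm => //; rewrite body_shift_eq0.
  - by move=> u v; ring.
  - by move=> r u; ring.
  - move=> u; rewrite conjcM cisJ opprK mulrACA -cisD addNr cis0 mul1r//.
  - by move=> i; rewrite -pt_rot_sym rx.
rewrite pt_refl_sym; apply/esym.
apply: (@field_equivariant om m x x (@body_refl n) conjc).
- exact: body_refl_inj.
- move=> i; have [->|i0] := eqVneq i 0; first by rewrite /body_refl eqxx.
  by apply: hm => //; rewrite body_refl_eq0.
- by move=> u v; rewrite conjcB.
- by move=> r u; rewrite conjcM conjc_real.
- by move=> u; rewrite conjcK mulrC.
- by move=> i; rewrite -pt_refl_sym sx.
Qed.

(** ** Fourier coefficients of symmetric configurations *)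

Lemma fixed_center_real h x : x \in fixed_vspace h -> conjc (pt x 0) = pt x 0.
Proof.
by move=> /mem_fixed/E_fixed[_ sx]; rewrite -{2}sx pt_refl_sym /body_refl eqxx.
Qed.

(** The origin is the only point fixed by a nontrivial rotation. *)
Lemma fixed_center0 h x : (1 < h)%N -> (h %| n)%N -> x \in fixed_vspace h -> pt x 0 = 0.
Proof.
move=> h1 hn /mem_fixed/E_fixed[rx _].
have : pt x 0 = wv (- (n %/ h)%:R) * pt x 0.
  by rewrite -{1}rx pt_rot_sym cis_wv// /body_shift eqxx.
move=> /eqP; rewrite -subr_eq0 -{1}[pt x 0]mul1r -mulrBl mulf_eq0 => /orP[|/eqP//].
rewrite subr_eq0 => /eqP/(congr1 conjc); rewrite wvJ opprK conjc1 => /esym/eqP.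
rewrite wv_eq1// => /dvdn_leq; rewrite divn_gt0 ?(ltnW h1)// dvdn_leq// => /(_ isT).
by rewrite leqNgt ltn_Pdiv.
Qed.

(** In the turning frame the reflection conjugates the Fourier coefficients.
    *)
Lemma fixed_fourier_real h x t : mode t -> x \in fixed_vspace h ->
  conjc (fourier (pt x) t) = fourier (pt x) t.
Proof.
move=> ht /mem_fixed/E_fixed[_ sx].
have mt : mode (t + 1) by apply: modeD => //; exact: mode1.
rewrite conjc_sum [in RHS]/fourier [RHS](reindex_inj (body_refl_inj n0)).
apply: eq_big => [j|j j0]; first by rewrite body_refl_eq0.
rewrite conjcM wvJ -{1}sx pt_refl_sym conjcK; congr (_ * _).
rewrite /body_refl (negPf j0) opprK mulrC.
rewrite [_ * (t + 1)]mulrC -[- (_ * _)]mulNr wv_mod_index; last exact: modeN.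
have := ltn_ord j; rewrite ltnS => jn.
rewrite natrB// (_ : - (t + 1) * _ = (t + 1) * j%:R + - (n%:R * (t + 1))); last by ring.
by rewrite wvD -(wvJ n (n%:R * _)) mt rmorph1 mulr1.
Qed.

(** In the turning frame the rotation multiplies the coefficient [m] by a root
    of unity which is 1 only when [h] divides [m]. *)
Lemma fixed_fourier0 h x (m : nat) : (h %| n)%N -> ~~ (h %| m)%N ->
  x \in fixed_vspace h -> fourier (pt x) m%:R = 0.
Proof.
move=> hn hm /mem_fixed/E_fixed[rx _].
have mm := mode_nat n0 m : mode (m%:R : R).
have mt : mode (m%:R + 1) by apply: modeD => //; exact: mode1.
set r := (n %/ h)%N.
have H : fourier (pt x) m%:R = wv (r%:R * m%:R) * fourier (pt x) m%:R.
  rewrite [in RHS]/fourier [in RHS](reindex_inj (body_shift_inj n0 (r := r))) mulr_sumr.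
  apply: eq_big => [j|j j0]; first by rewrite body_shift_eq0.
  rewrite -{1}rx pt_rot_sym cis_wv// -/r !mulrA -!wvD; congr (_ * _).
  have E : wv (- ((mod_index n (j + r))%:R * (m%:R + 1))) = wv (- (m%:R + 1) * (j + r)%:R).
    by rewrite -wv_mod_index; [congr wv; ring|exact: modeN].
  by rewrite [RHS]wvD /body_shift (negPf j0) E -wvD natrD; congr wv; ring.
move/eqP: H; rewrite -subr_eq0 -{1}[fourier _ _]mul1r -mulrBl mulf_eq0 => /orP[|/eqP//].
rewrite subr_eq0 -natrM eq_sym wv_eq1//.
have h0 : (0 < h)%N by apply: dvdn_gt0 hn.
have nE : n = (r * h)%N by rewrite /r divnK.
rewrite {1}nE dvdn_pmul2l ?(negPf hm)//.
by rewrite /r divn_gt0// dvdn_leq.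
Qed.

(** ** Inclusions between the groups *)

(** The rotation of order [p] is the power [h / p] of the rotation of order
    [h]. *)
Lemma Dtilde_dvd p h : (p %| h)%N -> (h %| n)%N -> @Dtilde R n p `<=` @Dtilde R n h.
Proof.
move=> ph hn.
have pn : (p %| n)%N by apply: dvdn_trans hn.
have p0 : (0 < p)%N by apply: dvdn_gt0 pn.
have h0 : (0 < h)%N by apply: dvdn_gt0 hn.
suff H : @Dtilde R n h (@rot_sym R n p).
  move=> f; elim=> {f} [|f [->|->]|f g _ If _ Ig|f g _ If fg gf].
  - exact: gen_id.
  - exact: H.
  - by apply: gen_in; right.
  - exact: gen_comp.
  - exact: gen_inv If fg gf.
have IT k : @Dtilde R n h (iter k (@rot_sym R n h)).
  elim: k => [|k IH]; first exact: gen_id.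
  by apply: (@gen_comp _ _ (@rot_sym R n h)) => //; apply: gen_in; left.
suff -> : @rot_sym R n p = iter (h %/ p) (@rot_sym R n h) by [].
apply/funext => x; apply: config_eq => j.
have E k i : pt (iter k (rot_sym h) x) i =
    wv (- (k * (n %/ h))%:R) * pt x (body_shift (k * (n %/ h)) i).
  elim: k i => [|k IH] i; first by rewrite mul0n oppr0 wv0 mul1r body_shift0.
  rewrite iterS pt_rot_sym cis_wv// IH mulrA -wvD body_shiftD// addnC -mulSn.
  by congr (wv _ * _); rewrite mulSn natrD; ring.
rewrite E pt_rot_sym cis_wv//.
suff -> : (h %/ p * (n %/ h) = n %/ p)%N by [].
by apply/eqP; rewrite -(eqn_pmul2r p0) [in eqbRHS]divnK// mulnAC divnK// mulnC divnK.
Qed.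

End Symmetry.

(** * The linearised field on symmetric variations *)

Section Degeneracy.
Context {R : realType} {n : nat}.
Variables (alpha : R).
Hypothesis n3 : (3 <= n)%N.
Implicit Types (x w : config R n) (i j : 'I_n.+1) (c : 'I_2).
Local Notation wv := (@wv R n).
Local Notation am := (half_pred alpha).
Local Notation ap := (half_succ alpha).
Local Notation S := (s1 alpha n).
Local Notation blockA := (@block_diag R n alpha).
Local Notation blockB := (@block_off R n alpha).
Local Notation det2 := (@block_det R n alpha).
Local Notation ell := (@reduced_det R n alpha).
Local Notation smode := (mode_sum n alpha).
Local Notation mode := (@integral_mode R n).
Local Notation DF mu := (dfield alpha (mu + s1 alpha n) (mass mu) (abar R n)).

Let n0 : (0 < n)%N. Proof. exact: leq_trans n3. Qed.

Let ap_am : ap = am + 1. Proof. by rewrite /half_succ /half_pred; field. Qed.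
Let m1 : mode 1. Proof. exact: mode1. Qed.

(** All blocks depend on [mu] through the rank one matrix with constant entry
    [ap * mu], so that their determinants are affine in [mu]. *)
Lemma blockA_shift mu nu t : blockA (mu + nu) t = blockA mu t + ap * nu.
Proof. by rewrite /block_diag; ring. Qed.

Lemma blockB_shift mu nu t : blockB (mu + nu) t = blockB mu t + ap * nu.
Proof. by rewrite /block_off; ring. Qed.

Lemma blockBN mu t : blockB mu (- t) = blockB mu t.
Proof. by rewrite /block_off smodeN. Qed.

Lemma det2_shift mu nu t :
  det2 (mu + nu) t = det2 mu t + ap * nu * (blockA mu t + blockA mu (- t) - 2 * blockB mu t).
Proof. by rewrite /block_det !blockA_shift blockB_shift; ring. Qed.

(** After the elimination of the central body the block of the mode 1 is
    [[blockA mu 1, ap * mu], [ap * (mu + n), ap * mu + S + n * am]], with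
    determinant [ell mu]. A change [nu] of [mu] adds [ap * nu] to the four
    entries, so that the slope of the determinant is the sum of the diagonal
    entries minus the sum of the others. *)
Definition reduced_slope (mu : R) : R :=
  blockA mu 1 + (ap * mu + S + n%:R * am) - ap * mu - ap * (mu + n%:R).
Local Notation ell_slope := reduced_slope.

Lemma ell_shift mu nu : ell (mu + nu) = ell mu + ap * nu * ell_slope mu.
Proof. by rewrite /reduced_det /ell_slope blockA_shift; ring. Qed.

Lemma blockA_1N mu : blockA mu (- 1) = ap * mu + S.
Proof. by rewrite /block_diag addNr smode0 mulr0 addr0. Qed.

Lemma blockB_1 mu : blockB mu 1 = ap * mu.
Proof. by rewrite /block_off (smode1 n0) addrK. Qed.

Lemma fourierDn (f : 'I_n.+1 -> R[i]) t : fourier f (t + n%:R) = fourier f t.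
Proof.
apply: eq_bigr => j _; congr (_ * _).
have -> : - (j%:R * (t + n%:R + 1)) = - (j%:R * (t + 1)) + - (n%:R * j%:R) by ring.
by rewrite wvD -(wvJ n (n%:R * _)) (mode_nat n0 j) rmorph1 mulr1.
Qed.

Lemma wv_eq1N t : (wv (- t) == 1) = (wv t == 1).
Proof. by apply/eqP/eqP => h; have := wvNM n t; rewrite h ?mul1r ?mulr1. Qed.

Lemma fourier_dfield_generic h mu w t : mode t -> w \in fixed_vspace h ->
  wv (t + 1) != 1 -> wv (t - 1) != 1 ->
  fourier (pt (DF mu w)) t =
  (blockA mu t)%:C * fourier (pt w) t + (blockB mu t)%:C * fourier (pt w) (- t).
Proof.
move=> ht wW hp hm; rewrite (fourier_dfield alpha n3)// (negPf hp) (negPf hm) !mulr0 addr0 mulr0 subr0.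
by rewrite (fixed_fourier_real n0 _ wW)//; exact: modeN.
Qed.

(** The combination [fourier (pt w) (- 1) - n%:R * pt w 0] is invariant under
    the translations of the plane. *)
Lemma fourier_dfield_1 h mu w : w \in fixed_vspace h ->
  fourier (pt (DF mu w)) 1 = (blockA mu 1)%:C * fourier (pt w) 1 +
    (ap * mu)%:C * (fourier (pt w) (- 1) - n%:R * pt w 0).
Proof.
move=> wW; rewrite (fourier_dfield alpha n3)// blockB_1 subrr wv0 eqxx.
have -> : (wv (1 + 1) == 1) = false.
  by rewrite (_ : 1 + 1 = 2%:R :> R)// wv_eq1//; apply/negP => /dvdn_leq; lia.
rewrite (fixed_fourier_real n0 _ wW); last exact: modeN.
by rewrite (fixed_center_real wW) rmorphM /=; ring.
Qed.

Lemma fourier_dfield_N1 h mu w : w \in fixed_vspace h ->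
  fourier (pt (DF mu w)) (- 1) = (ap * mu)%:C * fourier (pt w) 1 +
    (ap * mu + S)%:C * (fourier (pt w) (- 1) - n%:R * pt w 0) + (mu + S)%:C * (n%:R * pt w 0).
Proof.
move=> wW; rewrite (fourier_dfield alpha n3) ?blockBN ?blockA_1N ?blockB_1; last exact: modeN.
rewrite addNr wv0 eqxx opprK.
have -> : (wv (- 1 - 1) == 1) = false.
  by rewrite -opprD wv_eq1N (_ : 1 + 1 = 2%:R :> R)// wv_eq1//; apply/negP => /dvdn_leq; lia.
rewrite (fixed_fourier_real n0 _ wW)// (fixed_center_real wW) ap_am.
by rewrite !(rmorphM, rmorphD, rmorph1) /=; ring.
Qed.

Lemma center_dfield_fixed h mu w : w \in fixed_vspace h ->
  pt (DF mu w) 0 = (mu + S)%:C * pt w 0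
    - am%:C * (fourier (pt w) (- 1) - n%:R * pt w 0) - ap%:C * fourier (pt w) 1.
Proof.
move=> wW; rewrite center_dfield// (fixed_fourier_real n0 _ wW)//.
by rewrite !(rmorphM, rmorphD, rmorph_nat) /=; ring.
Qed.

Lemma solve2 (a b c d : R) (u v : R[i]) : a * d - b * c != 0 ->
  a%:C * u + b%:C * v = 0 -> c%:C * u + d%:C * v = 0 -> u = 0 /\ v = 0.
Proof.
move=> dt e1 e2; have dt0 : (a * d - b * c)%:C != 0 by rewrite eq_complex /= negb_and dt.
split; apply: (mulfI dt0); rewrite mulr0 rmorphB !rmorphM /=.
  by rewrite -[RHS](_ : d%:C * (a%:C * u + b%:C * v) - b%:C * (c%:C * u + d%:C * v) = 0);
    [ring|rewrite e1 e2; ring].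
by rewrite -[RHS](_ : a%:C * (c%:C * u + d%:C * v) - c%:C * (a%:C * u + b%:C * v) = 0);
    [ring|rewrite e1 e2; ring].
Qed.

Lemma mode_generic_inj h mu w k : (1 < k)%N -> (k.*2 < n)%N -> det2 mu k%:R != 0 ->
  w \in fixed_vspace h -> fourier (pt (DF mu w)) k%:R = 0 ->
  fourier (pt (DF mu w)) (- k%:R) = 0 ->
  fourier (pt w) k%:R = 0 /\ fourier (pt w) (- k%:R) = 0.
Proof.
move=> k1 kn dt wW.
have [|hp hm] := @wv_neighbours_neq1 R n n3 k; first by left; have := odd_double_half n; lia.
have mk := mode_nat n0 k : mode (k%:R : R).
rewrite (fourier_dfield_generic mu mk wW)// (fourier_dfield_generic mu (modeN mk) wW).
- rewrite blockBN opprK [X in _ -> X = 0 -> _]addrC; apply: solve2.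
  by rewrite -expr2.
- by rewrite -wv_eq1N opprD opprK.
- by rewrite -wv_eq1N opprD !opprK.
Qed.

(** The modes [n / 2] and [- n / 2] coincide. *)
Lemma fourier_halfN w k : k.*2 = n -> fourier (pt w) (- k%:R) = fourier (pt w) k%:R.
Proof.
move=> kn; have nE : n%:R = k%:R + k%:R :> R by rewrite -natrD addnn kn.
by rewrite -fourierDn; congr (fourier _ _); rewrite nE; ring.
Qed.

Lemma fourier_dfield_half h mu w k : (1 < k)%N -> k.*2 = n -> w \in fixed_vspace h ->
  fourier (pt (DF mu w)) k%:R = (blockA mu k%:R + blockB mu k%:R)%:C * fourier (pt w) k%:R.
Proof.
move=> k1 kn wW.
have [|hp hm] := @wv_neighbours_neq1 R n n3 k; first by left; have := odd_double_half n; lia.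
rewrite (fourier_dfield_generic mu (mode_nat n0 k) wW)// fourier_halfN//.
by rewrite -mulrDl; congr (_ * _); exact/esym/rmorphD.
Qed.

(** Subtracting [n] times the equation of the central body from that of the
    mode [- 1] leaves a system of size 2 and determinant [ell mu] in two
    translation invariant unknowns; the central body is then found from its
    own equation, where the rotation rate does not vanish. *)
Lemma mode_1_inj h mu w : ell mu != 0 -> mu + S != 0 -> w \in fixed_vspace h ->
  fourier (pt (DF mu w)) 1 = 0 -> fourier (pt (DF mu w)) (- 1) = 0 -> pt (DF mu w) 0 = 0 ->
  [/\ fourier (pt w) 1 = 0, fourier (pt w) (- 1) = 0 & pt w 0 = 0].
Proof.
move=> l0 om0 wW; rewrite (fourier_dfield_1 mu wW) (fourier_dfield_N1 mu wW) (center_dfield_fixed mu wW).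
set c := fourier (pt w) 1; set q := fourier (pt w) (-1) - _ => e1 e2 e3.
have [] := @solve2 (blockA mu 1) (ap * mu) (ap * (mu + n%:R)) (ap * mu + S + n%:R * am) c q.
- suff -> : blockA mu 1 * (ap * mu + S + n%:R * am) - ap * mu * (ap * (mu + n%:R)) = ell mu by [].
  by rewrite /reduced_det; ring.
- exact: e1.
- transitivity ((ap * mu)%:C * c + (ap * mu + S)%:C * q + (mu + S)%:C * (n%:R * pt w 0)
    - n%:R * ((mu + S)%:C * pt w 0 - am%:C * q - ap%:C * c)); last by rewrite e2 e3 mulr0 subr0.
  by rewrite !(rmorphM, rmorphD, rmorph_nat) /=; ring.
move=> c0 q0; have w0 : pt w 0 = 0.
  move/eqP: e3; rewrite c0 q0 !mulr0 !subr0 mulf_eq0 => /orP[|/eqP//].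
  by rewrite eq_complex /= (negPf om0).
by split=> //; move: q0; rewrite /q w0 mulr0 subr0.
Qed.

(** By Fourier inversion, the modes above [n / 2] being the opposites of those
    below. *)
Lemma config_eq0 w : pt w 0 = 0 -> fourier (pt w) 0 = 0 ->
  (forall k, (1 <= k)%N -> (k.*2 <= n)%N ->
     fourier (pt w) k%:R = 0 /\ fourier (pt w) (- k%:R) = 0) -> w = 0.
Proof.
move=> w0 f0 hk; apply: config_eq => j.
have -> : pt (0 : config R n) j = 0 by rewrite /pt !mxE.
have [->//|j0] := eqVneq j 0; apply: (fourier_inversion n0) => // m mn.
have [->//|m0] := posnP m.
have [h|h] := leqP m.*2 n; first by have [] := hk m m0 h.
have [||_] := hk (n - m)%N; [lia|lia|].
rewrite natrB; last exact: ltnW.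
by rewrite -fourierDn opprB subrK.
Qed.

Hypothesis alpha1 : 1 <= alpha.

Let ap_gt0 : 0 < ap. Proof. by rewrite /half_succ divr_gt0// addr_gt0// (lt_le_trans ltr01). Qed.
Let am_ge0 : 0 <= am. Proof. by rewrite /half_pred divr_ge0// subr_ge0. Qed.

Lemma mode_0_inj h mu w : mu + S != 0 -> w \in fixed_vspace h ->
  fourier (pt (DF mu w)) 0 = 0 -> fourier (pt w) 0 = 0.
Proof.
move=> om0 wW.
have w1 : wv 1 != 1.
  by rewrite (_ : 1 = 1%:R :> R)// wv_eq1// dvdn1; apply/eqP; lia.
rewrite (fourier_dfield_generic mu (mode_nat n0 0) wW); last 2 first.
- by rewrite add0r.
- by rewrite sub0r wv_eq1N.
rewrite oppr0 -mulrDl -rmorphD => /eqP; rewrite mulf_eq0 => /orP[|/eqP//].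
rewrite /block_diag /block_off add0r (smode1 n0) smode0 subr0.
have -> : ap * mu + S + am * S + ap * (mu + S) = 2 * ap * (mu + S) by rewrite ap_am; ring.
have h0 : 2 * ap * (mu + S) != 0.
  by apply: mulf_neq0 => //; apply: mulf_neq0; [rewrite pnatr_eq0|exact: lt0r_neq0].
by rewrite eq_complex /= (negPf h0).
Qed.

(** At [mu = - S] the diagonal entries are [am * X] and [am * Y] with [`|X +
    Y| <= 2 * smode k], by the bound on second differences, and the other two
    are [- ap * smode k]. Hence the determinant is at most [(am ^ 2 - ap ^ 2)
    * smode k ^ 2]. *)
Lemma det2_omega0 k : (1 < k)%N -> (k.*2 <= n)%N ->
  det2 (- S) k%:R < 0 /\
  (k.*2 = n -> blockA (- S) k%:R + blockB (- S) k%:R < 0).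
Proof.
move=> k1 kn.
have sk : 0 < smode k%:R.
  by apply: smode_gt0 => //; apply/negP => /dvdn_leq; lia.
have := smode_second_difference n0 alpha k%:R.
set X := mode_sum n alpha (k%:R + 1) - _; set Y := mode_sum n alpha (k%:R - 1) - _ => XY.
have aE : blockA (- S) k%:R = am * X.
  by rewrite /block_diag /X (smode1 n0) ap_am; ring.
have dE : blockA (- S) (- k%:R) = am * Y.
  rewrite /block_diag /Y (smode1 n0) -smodeN opprD opprK ap_am; ring.
have bE : blockB (- S) k%:R = - ap * smode k%:R by rewrite /block_off; ring.
move: XY; rewrite ler_norml => /andP[XY1 XY2]; split.
  rewrite /block_det aE dE bE ap_am; move: sk am_ge0 XY1 XY2.
  move: (mode_sum n alpha k%:R) (half_pred alpha) => s a s0 a0 h1 h2.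
  have h : X * Y <= s ^+ 2.
    have e1 : 0 <= 2 * s - (X + Y) by lra.
    have e2 : 0 <= 2 * s + (X + Y) by lra.
    by have := mulr_ge0 e1 e2; have := sqr_ge0 (X - Y); nra.
  have h' : a ^+ 2 * (X * Y) <= a ^+ 2 * s ^+ 2 by rewrite ler_wpM2l// sqr_ge0.
  have h'' : 0 < (2 * a + 1) * s ^+ 2 by rewrite mulr_gt0// ?exprn_gt0//; lra.
  nra.
move=> kn'; rewrite aE bE.
have YX : Y = X.
  rewrite /X /Y; congr (_ - _); rewrite -smodeN -(smodeDn n0); congr (mode_sum _ _ _).
  by rewrite -kn' -addnn natrD; ring.
move: sk am_ge0 XY1 XY2; rewrite YX ap_am.
move: (mode_sum n alpha k%:R) (half_pred alpha) => s a s0 a0 h1 h2.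
by have : a * X <= a * s; [rewrite ler_wpM2l//; lra | nra].
Qed.

End Degeneracy.

(** * The pencil of fields and real Fourier modes *)

Section Kernel.
Context {R : realType} {n : nat}.
Variables (alpha : R).
Hypothesis n3 : (3 <= n)%N.
Implicit Types (x w : config R n) (i j : 'I_n.+1) (c : 'I_2).
Local Notation wv := (@wv R n).
Local Notation S := (s1 alpha n).
Local Notation mode := (@integral_mode R n).
Local Notation DF mu := (dfield alpha (mu + s1 alpha n) (mass mu) (abar R n)).

Let n0 : (0 < n)%N. Proof. exact: leq_trans n3. Qed.
Let m1 : mode 1. Proof. exact: mode1. Qed.

(** ** The affine dependence on [mu] *)

Definition field0 : config R n -> config R n := field alpha S (mass 0).
Definition field1 : config R n -> config R n := field alpha 1 (fun i => (i == 0)%:R).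

Lemma mass_affine (mu : R) i : mass mu i = mass 0 i + mu * (i == 0)%:R.
Proof. by rewrite /mass; case: ifP => _ /=; ring. Qed.

Lemma massfieldE mu x : massfield alpha mu x = field0 x + mu *: field1 x.
Proof.
apply/matrixP => j c; rewrite !mxE.
have -> : \sum_i mass mu i * (rho alpha (sqdist x i j) * (x j c - x i c)) =
    \sum_i mass 0 i * (rho alpha (sqdist x i j) * (x j c - x i c)) +
    mu * \sum_i (i == 0)%:R * (rho alpha (sqdist x i j) * (x j c - x i c)).
  by rewrite mulr_sumr -big_split; apply: eq_bigr => i _ /=; rewrite mass_affine; ring.
by ring.
Qed.

Lemma dfieldE mu w : DF mu w =
  dfield alpha S (mass 0) (abar R n) w +
  mu *: dfield alpha 1 (fun i : 'I_n.+1 => (i == 0)%:R) (abar R n) w.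
Proof.
apply/matrixP => j c; rewrite !mxE.
under eq_bigr do rewrite mass_affine mulrDl.
rewrite big_split /=.
under [X in _ - (_ + X)]eq_bigr do rewrite -mulrA.
by rewrite -mulr_sumr; ring.
Qed.

Lemma massfield_abar mu : massfield alpha mu (abar R n) = 0.
Proof.
apply: config_eq => j; rewrite pt_field.
have -> : pt (0 : config R n) j = 0 by rewrite /pt !mxE.
have sum_w0 : \sum_(i < n.+1 | i != 0) wv i%:R = 0.
  rewrite (eq_bigr (fun i : 'I_n.+1 => wv (i%:R * 1))) => [|i _]; last by rewrite mulr1.
  by rewrite sum_wv_outer// (_ : 1 = 1%:R :> R)// wv_eq1// dvdn1; case: eqP => //; lia.
have rho1 : rho alpha 1 = 1 by rewrite /rho powR1.
rewrite (bigD1 0)//=; have [->|j0] := eqVneq j 0.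
  rewrite subrr mulr0 add0r pt_abar eqxx mulr0 sub0r.
  rewrite (eq_bigr (fun i : 'I_n.+1 => - wv i%:R)) ?sumrN ?sum_w0 ?oppr0// => i i0.
  by rewrite sqdistC sqdist_abar0// rho1 pt_abar (negPf i0) /mass (negPf i0) mulr1 sub0r mul1r.
rewrite sqdist_abar0// rho1 !pt_abar eqxx (negPf j0) subr0 mulr1.
have E : \sum_(i < n.+1 | i != 0) (mass mu i * rho alpha (sqdist (abar R n) i j))%:C *
    (wv j%:R - pt (abar R n) i) = S%:C * wv j%:R.
  rewrite (eq_bigr (fun i : 'I_n.+1 => wv j%:R * (kappa n alpha (i%:R - j%:R))%:C -
     (kappa n alpha (i%:R - j%:R))%:C * wv (1 * i%:R))); last first.
    move=> i i0; rewrite sqdist_abar// /mass (negPf i0) !mul1r pt_abar (negPf i0) /kappa; ring.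
  rewrite sumrB -mulr_sumr (kap_sum0 alpha n3) (kap_sum alpha n3 j m1) mul1r (smode1 n0).
  by rewrite rmorphB /=; ring.
rewrite E /mass eqxx rmorphD /=; ring.
Qed.

(** ** Kernel vectors *)

(** A superposition of the modes [k] and [- k] with real coefficients and a
    displacement of the central body along the real axis, which is the general
    form of a symmetric configuration in these modes. *)
Definition mode_config (k : nat) (v1 v2 u0 : R) : config R n :=
  config_of (fun j => if j == 0 then u0%:C else
     v1%:C * wv ((k%:R + 1) * j%:R) + v2%:C * wv ((1 - k%:R) * j%:R)).

Lemma mode_config_fixed k h v1 v2 u0 : (h %| k)%N -> (h %| n)%N ->
  (h != 1%N -> u0 = 0) -> mode_config k v1 v2 u0 \in fixed_vspace h.
Proof.
move=> hk hn hw; apply/mem_fixed/E_fixed.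
have mk := mode_nat n0 k : mode (k%:R : R).
have mp : mode (k%:R + 1) by exact: modeD.
have mm : mode (1 - k%:R) by exact: modeB.
split; apply: config_eq => j.
  rewrite pt_rot_sym (cis_wv n0 hn) !pt_config_of body_shift_eq0//.
  have [j0|j0] := eqVneq j 0.
    have [h1|h1] := eqVneq h 1%N; first by rewrite h1 divn1 -wvJ wvn// rmorph1 mul1r.
    by rewrite hw// mulr0.
  have kr : wv (k%:R * (n %/ h)%:R) = 1.
    rewrite -natrM; apply/eqP; rewrite wv_eq1//.
    by rewrite -{1}(divnK hn) mulnC dvdn_pmul2r// divn_gt0 ?(dvdn_gt0 _ hn)// dvdn_leq.
  have krN : wv (- (k%:R * (n %/ h)%:R)) = 1 by rewrite -wvJ kr rmorph1.
  rewrite /body_shift (negPf j0) !wv_mod_index// natrD mulrDr mulrCA [X in _ + X]mulrCA -!wvD.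
  have -> : - (n %/ h)%:R + (k%:R + 1) * (j%:R + (n %/ h)%:R) =
    (k%:R + 1) * j%:R + k%:R * (n %/ h)%:R :> R by ring.
  have -> : - (n %/ h)%:R + (1 - k%:R) * (j%:R + (n %/ h)%:R) =
    (1 - k%:R) * j%:R + - (k%:R * (n %/ h)%:R) :> R by ring.
  by rewrite (wvD _ _ (k%:R * _)) (wvD _ _ (- (k%:R * _))) kr krN !mulr1.
rewrite pt_refl_sym !pt_config_of body_refl_eq0//.
have [j0|j0] := eqVneq j 0; first exact: conjc_real.
rewrite /body_refl (negPf j0) !wv_mod_index// conjcD !conjcM !conjc_real !wvJ.
have := ltn_ord j; rewrite ltnS => jn; rewrite natrB//.
have H t : mode t -> wv (- (t * (n%:R - j%:R))) = wv (t * j%:R).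
  move=> ht; have -> : - (t * (n%:R - j%:R)) = t * j%:R + - (n%:R * t) by ring.
  by rewrite wvD -(wvJ n (n%:R * t)) ht rmorph1 mulr1.
by rewrite !H.
Qed.

Lemma fourier_mode_config k v1 v2 u0 t : mode t ->
  fourier (pt (mode_config k v1 v2 u0)) t =
  v1%:C * (if wv (t - k%:R) == 1 then n%:R else 0) +
  v2%:C * (if wv (t + k%:R) == 1 then n%:R else 0).
Proof.
move=> ht; have mk := mode_nat n0 k : mode (k%:R : R).
rewrite /fourier (eq_bigr (fun j : 'I_n.+1 => v1%:C * wv (j%:R * (- (t - k%:R))) +
   v2%:C * wv (j%:R * (- (t + k%:R))))); last first.
  move=> j j0; rewrite pt_config_of (negPf j0) mulrDr mulrCA [X in _ + X]mulrCA -!wvD.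
  by congr (_ * wv _ + _ * wv _); ring.
rewrite big_split -!mulr_sumr /= !sum_wv_outer ?wv_eq1N//.
- by apply: modeN; exact: modeD.
- by apply: modeN; exact: modeB.
Qed.

Let wv_sub_eq1 (j k : nat) : (j.*2 <= n)%N -> (k.*2 <= n)%N ->
  (wv (j%:R - k%:R) == 1) = (j == k).
Proof.
move=> jn kn; have [kj|jk] := leqP k j.
  rewrite -natrB// wv_eq1//; apply/idP/eqP => [|->]; last by rewrite subnn dvdn0.
  by have [h|h] := posnP (j - k)%N; [lia|move=> /dvdn_leq; lia].
rewrite -opprB wv_eq1N -natrB ?(ltnW jk)// wv_eq1//.
by apply/idP/eqP => [/dvdn_leq|]; lia.
Qed.

Let wv_add_eq1 (j k : nat) : (j.*2 <= n)%N -> (0 < k)%N -> (k.*2 <= n)%N ->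
  (wv (j%:R + k%:R) == 1) = (j == k) && (k.*2 == n).
Proof.
move=> jn k0 kn; rewrite -natrD wv_eq1//.
apply/idP/andP => [/dvdn_leq h|[/eqP -> /eqP nE]]; last by rewrite addnn nE.
by split; apply/eqP; lia.
Qed.

Let wv_addN (s t : R) : (wv (- s - t) == 1) = (wv (s + t) == 1).
Proof. by rewrite -opprD wv_eq1N. Qed.

Let wv_subN (s t : R) : (wv (- s + t) == 1) = (wv (s - t) == 1).
Proof. by rewrite addrC -opprB wv_eq1N. Qed.

Lemma fourier_mode_config_off k v1 v2 u0 (j : nat) : (0 < k)%N -> (k.*2 <= n)%N ->
  (j.*2 <= n)%N -> j <> k ->
  fourier (pt (mode_config k v1 v2 u0)) j%:R = 0 /\
  fourier (pt (mode_config k v1 v2 u0)) (- j%:R) = 0.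
Proof.
move=> k0 kn jn /eqP jk; have mj := mode_nat n0 j : mode (j%:R : R).
rewrite !fourier_mode_config//; last exact: modeN.
by rewrite wv_addN wv_subN wv_sub_eq1// wv_add_eq1// (negPf jk) /= !mulr0 addr0.
Qed.

Lemma fourier_mode_config_on k v1 v2 u0 : (0 < k)%N -> (k.*2 < n)%N ->
  fourier (pt (mode_config k v1 v2 u0)) k%:R = v1%:C * n%:R /\
  fourier (pt (mode_config k v1 v2 u0)) (- k%:R) = v2%:C * n%:R.
Proof.
move=> k0 kn; have mk := mode_nat n0 k : mode (k%:R : R).
rewrite !fourier_mode_config//; last exact: modeN.
rewrite wv_addN addNr subrr wv0 eqxx wv_add_eq1 ?(ltnW kn)//.
by rewrite (ltn_eqF kn) andbF !mulr0 addr0 add0r.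
Qed.

Lemma fourier_mode_config_half k v1 v2 u0 : (0 < k)%N -> k.*2 = n ->
  fourier (pt (mode_config k v1 v2 u0)) k%:R = (v1 + v2)%:C * n%:R.
Proof.
move=> k0 kn; have mk := mode_nat n0 k : mode (k%:R : R).
rewrite fourier_mode_config// subrr wv0 eqxx wv_add_eq1 ?kn// !eqxx /=.
by rewrite rmorphD mulrDl.
Qed.

Lemma pt_mode_config0 k v1 v2 u0 : pt (mode_config k v1 v2 u0) 0 = u0%:C.
Proof. by rewrite pt_config_of eqxx. Qed.

Lemma fourier_dfield_off mu w (j : nat) : (j.*2 <= n)%N ->
  fourier (pt w) j%:R = 0 -> fourier (pt w) (- j%:R) = 0 -> (j = 1%N -> pt w 0 = 0) ->
  fourier (pt (DF mu w)) j%:R = 0 /\ fourier (pt (DF mu w)) (- j%:R) = 0.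
Proof.
move=> jn fp fm h0; have mj := mode_nat n0 j : mode (j%:R : R).
rewrite !(fourier_dfield alpha n3)//; last exact: modeN.
rewrite opprK fp fm conjc0 !mulr0 !addr0 !sub0r.
have [j1|/eqP j1] := eqVneq j 1%N; first by rewrite h0// conjc0 !mulr0 !mul0r !addr0 !mulr0 oppr0.
have e1 : (wv (j%:R + 1) == 1) = false.
  by rewrite (wv_add_eq1 (k := 1))//; [case: eqP|lia].
have e2 : (wv (j%:R - 1) == 1) = false.
  by rewrite (wv_sub_eq1 (k := 1))//; [case: eqP|lia].
by rewrite wv_addN wv_subN e1 e2 !mulr0 addr0 mulr0 oppr0.
Qed.

End Kernel.

(** * Simple kernels at the roots of the blocks *)

Section Main.
Context {R : realType} {n : nat}.
Variables (alpha : R) (phi : R -> R).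
Hypothesis n3 : (3 <= n)%N.
Hypothesis alpha1 : 1 <= alpha.
Hypothesis phiP : forall r : R, 0 < r -> is_derive r 1 phi (- r `^ (- alpha)).
Implicit Types (x w v : config R n) (i : 'I_n.+1) (c : 'I_2) (j k h p : nat).
Local Notation am := (half_pred alpha).
Local Notation ap := (half_succ alpha).
Local Notation S := (s1 alpha n).
Local Notation blockA := (@block_diag R n alpha).
Local Notation blockB := (@block_off R n alpha).
Local Notation det2 := (@block_det R n alpha).
Local Notation ell := (@reduced_det R n alpha).
Local Notation ell_slope := (@reduced_slope R n alpha).
Local Notation mode := (@integral_mode R n).
Local Notation DF mu := (dfield alpha (mu + s1 alpha n) (mass mu) (abar R n)).

Let n0 : (0 < n)%N. Proof. exact: leq_trans n3. Qed.
Let ap_gt0 : 0 < ap. Proof. by rewrite /half_succ divr_gt0// addr_gt0// (lt_le_trans ltr01). Qed.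
Let nC0 : n%:R != 0 :> R[i]. Proof. by rewrite pnatr_eq0 -lt0n. Qed.
Let nR0 : n%:R != 0 :> R. Proof. by rewrite pnatr_eq0 -lt0n. Qed.

Lemma pt_lin (a : R) x y i : pt (a *: x + y) i = a%:C * pt x i + pt y i.
Proof. by rewrite /pt !mxE; simpc. Qed.

Lemma fourier_lin (a : R) x y t :
  fourier (pt (a *: x + y)) t = a%:C * fourier (pt x) t + fourier (pt y) t.
Proof.
rewrite /fourier mulr_sumr -big_split; apply: eq_bigr => i _ /=.
by rewrite pt_lin; ring.
Qed.

(** The linear form that is exchanged for the parameter: the bifurcation
    problem lets [mu] vary by [kernel_coord k w] instead of letting [w] move
    along the kernel. The correction by the central body for [k = 1] makes it
    invariant under translations. *)
Definition kernel_coord k w : R :=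
  complex.Re (fourier (pt w) k%:R + fourier (pt w) (- k%:R)
              - (k == 1%N)%:R * n%:R * pt w 0).

Lemma kernel_coord_linear k : linear (kernel_coord k).
Proof.
move=> a x y; rewrite -[a *: kernel_coord k x]/(a * kernel_coord k x) /kernel_coord !fourier_lin pt_lin.
rewrite -Re_realM -ReD; congr complex.Re; ring.
Qed.

HB.instance Definition _ k :=
  GRing.isLinear.Build _ _ _ _ (kernel_coord k) (kernel_coord_linear k).

Lemma kernel_coordE h k w : w \in fixed_vspace h ->
  (kernel_coord k w)%:C =
  fourier (pt w) k%:R + fourier (pt w) (- k%:R) - (k == 1%N)%:R * n%:R * pt w 0.
Proof.
move=> wW; have mk := mode_nat n0 k : mode (k%:R : R).
apply/esym/conjc_fix; rewrite conjcB conjcD !conjcM !conjc_nat.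
by rewrite !(fixed_fourier_real n0 _ wW)//; [rewrite (fixed_center_real wW)|exact: modeN].
Qed.

(** The data of [crandall_rabinowitz] on the mode [k]: a kernel vector [v]
    concentrated on that mode, and the injectivity there of the problem
    bordered by [kernel_coord k] and by the derivative in [mu], which is [DF
    (mu + 1) v] as [DF mu v = 0]. *)
Definition simple_kernel h k (mu : R) v :=
  [/\ v \in fixed_vspace h, v != 0, DF mu v = 0,
   (forall j, (j.*2 <= n)%N -> j <> k ->
      fourier (pt v) j%:R = 0 /\ fourier (pt v) (- j%:R) = 0) /\
   (k <> 1%N -> pt v 0 = 0) &
   forall w, w \in fixed_vspace h ->
     let y := kernel_coord k w *: DF (mu + 1) v + DF mu w in
     fourier (pt y) k%:R = 0 -> fourier (pt y) (- k%:R) = 0 -> (k = 1%N -> pt y 0 = 0) ->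
     [/\ fourier (pt w) k%:R = 0, fourier (pt w) (- k%:R) = 0 & k = 1%N -> pt w 0 = 0]].

Let off_center h mu v k : v \in fixed_vspace h -> k <> 1%N ->
  (forall j, (j.*2 <= n)%N -> j <> k ->
      fourier (pt v) j%:R = 0 /\ fourier (pt v) (- j%:R) = 0) -> pt v 0 = 0 ->
  pt (DF mu v) 0 = 0.
Proof.
move=> vW k1 off v0; rewrite (center_dfield_fixed alpha n3 mu vW) v0.
have [| |-> ->] := off 1%N; [lia|exact/nesym|].
by rewrite !mulr0 !subr0 mulr0 subr0.
Qed.

Let kernel_eq0 h mu v k : (0 < k)%N -> v \in fixed_vspace h ->
  (forall j, (j.*2 <= n)%N -> j <> k ->
      fourier (pt v) j%:R = 0 /\ fourier (pt v) (- j%:R) = 0) ->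
  (k <> 1%N -> pt v 0 = 0) ->
  fourier (pt (DF mu v)) k%:R = 0 -> fourier (pt (DF mu v)) (- k%:R) = 0 ->
  (k = 1%N -> pt (DF mu v) 0 = 0) -> DF mu v = 0.
Proof.
move=> k0 vW off v0 e1 e2 e3.
have off' j : (j.*2 <= n)%N -> j <> k ->
    fourier (pt (DF mu v)) j%:R = 0 /\ fourier (pt (DF mu v)) (- j%:R) = 0.
  move=> jn jk; have [f1 f2] := off j jn jk.
  apply: fourier_dfield_off => // j1; apply: v0; lia.
apply: (config_eq0 n3).
- have [k1|k1] := eqVneq k 1%N; first exact: e3.
  by apply: (off_center mu vW _ off); [exact/eqP|exact/v0/eqP].
- by have [] := off' 0%N _ _; [|lia|].
- move=> j j0 jn; have [->|/eqP jk] := eqVneq j k; first by [].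
  exact: off'.
Qed.

Let fourier_neq0 v t : fourier (pt v) t != 0 -> v != 0.
Proof.
apply: contra => /eqP ->; apply/eqP; apply: big1 => i _.
by rewrite (_ : pt 0 i = 0) ?mulr0// /pt !mxE.
Qed.

(** The block [[a, b], [b, d]] is singular and [(d - b, a - b)] is in its
    kernel. Since [mu] enters the four entries by the same multiple, the
    derivative in [mu] maps this vector to a multiple of [(1, 1)], with factor
    [q] proportional to the slope [s = a + d - 2 b] of the determinant. The
    bordered matrix adds [q] to the four entries; its determinant is [q * s].
    *)
Lemma simple_kernel_generic h k mu : (1 < k)%N -> (k.*2 < n)%N ->
  (h %| k)%N -> (h %| n)%N -> det2 mu k%:R = 0 ->
  blockA mu k%:R + blockA mu (- k%:R) - 2 * blockB mu k%:R != 0 ->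
  exists v, simple_kernel h k mu v.
Proof.
move=> k1 kn hk hn dt slope.
set a := blockA mu k%:R in slope; set d := blockA mu (- k%:R) in slope.
set b := blockB mu k%:R in slope.
have adb : a * d - b * b = 0 by rewrite -dt /block_det expr2.
have k0 : (0 < k)%N by lia.
have kn' : (k.*2 <= n)%N by lia.
have k1' : k <> 1%N by lia.
pose v := mode_config k (d - b) (a - b) 0 : config R n.
have vW : v \in fixed_vspace h by apply: mode_config_fixed.
have mk := mode_nat n0 k : mode (k%:R : R).
have [fp fm] := @fourier_mode_config_on R n n3 k (d - b) (a - b) 0 k0 kn.
have off j : (j.*2 <= n)%N -> j <> k ->
    fourier (pt v) j%:R = 0 /\ fourier (pt v) (- j%:R) = 0.
  exact: fourier_mode_config_off.
have v0 : pt v 0 = 0 by rewrite pt_mode_config0.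
have [|hp hm] := @wv_neighbours_neq1 R n n3 k; first by left; have := odd_double_half n; lia.
have E nu w : w \in fixed_vspace h ->
    fourier (pt (DF (mu + nu) w)) k%:R =
      (a + ap * nu)%:C * fourier (pt w) k%:R + (b + ap * nu)%:C * fourier (pt w) (- k%:R) /\
    fourier (pt (DF (mu + nu) w)) (- k%:R) =
      (b + ap * nu)%:C * fourier (pt w) k%:R + (d + ap * nu)%:C * fourier (pt w) (- k%:R).
  move=> wW; rewrite -blockA_shift -blockA_shift -blockB_shift; split.
    exact: (fourier_dfield_generic alpha n3 _ mk wW).
  rewrite (fourier_dfield_generic alpha n3 _ (modeN mk) wW) ?blockBN ?opprK.
  - by rewrite addrC.
  - by rewrite -wv_eq1N opprD opprK.
  - by rewrite -wv_eq1N opprD !opprK.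
have E0 w : w \in fixed_vspace h -> fourier (pt (DF mu w)) k%:R =
      a%:C * fourier (pt w) k%:R + b%:C * fourier (pt w) (- k%:R) /\
    fourier (pt (DF mu w)) (- k%:R) =
      b%:C * fourier (pt w) k%:R + d%:C * fourier (pt w) (- k%:R).
  by move=> wW; have := E 0 w wW; rewrite !addr0 mulr0 !addr0.
have [E0p E0m] := E0 v vW; have [E1p E1m] := E 1 v vW.
move: E0p E0m E1p E1m; rewrite -/v in fp fm; rewrite fp fm => E0p E0m E1p E1m.
have Zp : fourier (pt (DF mu v)) k%:R = 0.
  by rewrite E0p !mulrA -!rmorphM -mulrDl -rmorphD (_ : _ + _ = 0) ?mul0r//; rewrite -adb; ring.
have Zm : fourier (pt (DF mu v)) (- k%:R) = 0.
  by rewrite E0m !mulrA -!rmorphM -mulrDl -rmorphD (_ : _ + _ = 0) ?mul0r//; rewrite -adb; ring.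
pose s := a + d - 2 * b.
have D1p : fourier (pt (DF (mu + 1) v)) k%:R = (ap * n%:R * s)%:C.
  rewrite E1p !mulrA -!rmorphM -mulrDl -rmorphD -(rmorph_nat (real_complex R)) -rmorphM.
  congr (_%:C); transitivity ((a * d - b * b) * n%:R + ap * n%:R * s); last by rewrite adb mul0r add0r.
  by rewrite /s; ring.
have D1m : fourier (pt (DF (mu + 1) v)) (- k%:R) = (ap * n%:R * s)%:C.
  rewrite E1m !mulrA -!rmorphM -mulrDl -rmorphD -(rmorph_nat (real_complex R)) -rmorphM.
  congr (_%:C); transitivity ((a * d - b * b) * n%:R + ap * n%:R * s); last by rewrite adb mul0r add0r.
  by rewrite /s; ring.
exists v; split => //.
- apply/eqP => vz; have : fourier (pt v) k%:R + fourier (pt v) (- k%:R) = 0.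
    by rewrite vz /fourier !big1 ?addr0// => i _; rewrite (_ : pt 0 i = 0) ?mulr0// /pt !mxE.
  rewrite fp fm -mulrDl -rmorphD => /eqP; rewrite mulf_eq0 (negPf nC0) orbF => /eqP/complexI sz.
  by move/eqP: slope; apply; rewrite -sz; ring.
- by apply: (kernel_eq0 k0 vW off).
move=> w wW y; rewrite /y !fourier_lin D1p D1m (kernel_coordE k wW) (negPf (_ : k != 1%N)); last exact/eqP.
have [-> ->] := E0 w wW; rewrite !mul0r subr0.
set u1 := fourier (pt w) k%:R; set u2 := fourier (pt w) (- k%:R) => e1 e2 _.
set q := ap * n%:R * s in e1 e2.
have [] := @solve2 R (a + q) (b + q) (b + q) (d + q) u1 u2.
- have -> : (a + q) * (d + q) - (b + q) * (b + q) = (a * d - b * b) + q * s by rewrite /s; ring.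
  rewrite adb add0r /q; apply: mulf_neq0 => //; apply: mulf_neq0 => //.
  by apply: mulf_neq0 => //; exact: lt0r_neq0.
- by rewrite -[RHS]e1 !rmorphD /=; ring.
- by rewrite -[RHS]e2 !rmorphD /=; ring.
by move=> -> ->; split=> // k1''; case: k1'.
Qed.

(** The modes [k] and [- k] coincide and their block has a single entry. *)
Lemma simple_kernel_half h k mu : (1 < k)%N -> k.*2 = n ->
  (h %| k)%N -> (h %| n)%N -> blockA mu k%:R + blockB mu k%:R = 0 ->
  exists v, simple_kernel h k mu v.
Proof.
move=> k1 kn hk hn ab.
have k0 : (0 < k)%N by lia.
have kn' : (k.*2 <= n)%N by lia.
have k1' : k <> 1%N by lia.
pose v := mode_config k 1 0 0 : config R n.
have vW : v \in fixed_vspace h by apply: mode_config_fixed.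
have fp : fourier (pt v) k%:R = n%:R.
  by rewrite (fourier_mode_config_half n3)// addr0 mul1r.
have off j : (j.*2 <= n)%N -> j <> k ->
    fourier (pt v) j%:R = 0 /\ fourier (pt v) (- j%:R) = 0.
  exact: fourier_mode_config_off.
have v0 : pt v 0 = 0 by rewrite pt_mode_config0.
have E nu w : w \in fixed_vspace h ->
    fourier (pt (DF (mu + nu) w)) k%:R = (2 * ap * nu)%:C * fourier (pt w) k%:R.
  move=> wW; rewrite (fourier_dfield_half alpha n3 _ k1 kn wW) blockA_shift blockB_shift.
  congr (_%:C * _); transitivity (blockA mu k%:R + blockB mu k%:R + 2 * ap * nu); first by ring.
  by rewrite ab add0r.
have E0 w : w \in fixed_vspace h -> fourier (pt (DF mu w)) k%:R = 0.
  by move=> wW; have := E 0 w wW; rewrite addr0 mulr0 mul0r.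
exists v; split => //.
- by apply: (@fourier_neq0 v k%:R); rewrite fp.
- by apply: (kernel_eq0 k0 vW off) => //; rewrite ?(fourier_halfN n3)// E0.
move=> w wW y; rewrite /y !fourier_lin (kernel_coordE k wW) (negPf (_ : k != 1%N)); last exact/eqP.
rewrite E0// E// fp !mul0r subr0 (fourier_halfN n3)// addr0 => /eqP.
rewrite !mulf_eq0 (negPf nC0) orbF => e1 _ _.
have -> : fourier (pt w) k%:R = 0.
  move: e1; rewrite -mulr2n mulrn_eq0 /= => /orP[/eqP//|].
  rewrite eq_complex /= mulr1 mulf_eq0 (gt_eqF ap_gt0) pnatr_eq0 //.
by split=> // k1''; case: k1'.
Qed.

(** The argument of [simple_kernel_generic] applied to the reduced block of
    the mode 1. The displacement [u0] of the central body follows from its own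
    equation, as the rotation rate does not vanish. *)
Lemma simple_kernel_one mu : mu + S != 0 -> ell mu = 0 -> ell_slope mu != 0 ->
  exists v, simple_kernel 1 1 mu v.
Proof.
move=> om l0 slope.
set a := blockA mu 1 in slope; pose b := ap * mu; pose c := ap * (mu + n%:R).
pose d := ap * mu + S + n%:R * am.
have adbc : a * d - b * c = 0.
  by rewrite -l0 /reduced_det /a /b /c /d; ring.
have sE : ell_slope mu = a + d - b - c by [].
pose s := a + d - b - c.
have s0 : s != 0 by rewrite /s -sE.
pose v1 := d - b; pose q := a - c.
pose u0 := n%:R * (am * q + ap * v1) / (mu + S).
have u0E : (mu + S) * u0 = n%:R * (am * q + ap * v1) by rewrite /u0 mulrC divfK.
pose v := mode_config 1 v1 (q + u0) u0 : config R n.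
have vW : v \in fixed_vspace 1 by apply: mode_config_fixed => //; rewrite ?dvd1n// eqxx.
have kn : (1.*2 < n)%N by lia.
have [] := @fourier_mode_config_on R n n3 1 v1 (q + u0) u0 isT kn.
rewrite -/v => fp fm.
have v0 : pt v 0 = u0%:C by rewrite pt_mode_config0.
have off j : (j.*2 <= n)%N -> j <> 1%N ->
    fourier (pt v) j%:R = 0 /\ fourier (pt v) (- j%:R) = 0.
  by move=> jn j1; apply: fourier_mode_config_off => //; lia.
pose Q w := fourier (pt w) (- 1) - n%:R * pt w 0.
have E1 nu w : w \in fixed_vspace 1 -> fourier (pt (DF (mu + nu) w)) 1 =
    (a + ap * nu)%:C * fourier (pt w) 1 + (b + ap * nu)%:C * Q w.
  by move=> wW; rewrite (fourier_dfield_1 alpha n3 _ wW) blockA_shift (mulrDr ap).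
have E2 nu w : w \in fixed_vspace 1 -> fourier (pt (DF (mu + nu) w)) (- 1) =
    (b + ap * nu)%:C * fourier (pt w) 1 + (b + S + ap * nu)%:C * Q w
    + (mu + S + nu)%:C * (n%:R * pt w 0).
  move=> wW; rewrite (fourier_dfield_N1 alpha n3 _ wW) mulrDr.
  by congr (_ * _ + _%:C * _ + _%:C * _); rewrite /b; ring.
have E3 nu w : w \in fixed_vspace 1 -> pt (DF (mu + nu) w) 0 =
    (mu + S + nu)%:C * pt w 0 - am%:C * Q w - ap%:C * fourier (pt w) 1.
  move=> wW; rewrite (center_dfield_fixed alpha n3 _ wW).
  by congr (_%:C * _ - _ - _); ring.
have Z w : w \in fixed_vspace 1 -> [/\ fourier (pt (DF mu w)) 1 =
    a%:C * fourier (pt w) 1 + b%:C * Q w,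
    fourier (pt (DF mu w)) (- 1) =
    b%:C * fourier (pt w) 1 + (b + S)%:C * Q w + (mu + S)%:C * (n%:R * pt w 0) &
    pt (DF mu w) 0 = (mu + S)%:C * pt w 0 - am%:C * Q w - ap%:C * fourier (pt w) 1].
  move=> wW; have := E1 0 w wW; have := E2 0 w wW; have := E3 0 w wW.
  by rewrite mulr0 !addr0 => -> -> ->.
have Qv : Q v = (n%:R * q)%:C.
  by rewrite /Q fm v0 (rmorphD _ q) (rmorphM _ n%:R) rmorph_nat /=; ring.
have fp' : fourier (pt v) 1 = (n%:R * v1)%:C by rewrite fp rmorphM rmorph_nat mulrC.
have nC : n%:R = (n%:R : R)%:C by rewrite rmorph_nat.
have cdq : c * v1 + d * q = 0.
  by transitivity (a * d - b * c); [rewrite /v1 /q; ring|exact: adbc].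
have abq : a * v1 + b * q = 0.
  by transitivity (a * d - b * c); [rewrite /v1 /q; ring|exact: adbc].
have vs : v1 + q = s by rewrite /v1 /q /s; ring.
have [Z1 Z2 Z3] : [/\ fourier (pt (DF mu v)) 1 = 0, fourier (pt (DF mu v)) (- 1) = 0 &
    pt (DF mu v) 0 = 0].
  have [-> -> ->] := Z v vW; rewrite fp' Qv v0 nC; split.
  - rewrite -!rmorphM -rmorphD (_ : _ + _ = 0)//.
    by transitivity (n%:R * (a * v1 + b * q)); [ring|rewrite abq mulr0].
  - rewrite -!rmorphM -!rmorphD (_ : _ + _ = 0)//.
    transitivity (n%:R * (b * v1 + (b + S) * q + (mu + S) * u0)); first by ring.
    rewrite u0E; transitivity (n%:R * (c * v1 + d * q)); last by rewrite cdq mulr0.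
    by rewrite /c /d /b; ring.
  - rewrite -!rmorphM -!rmorphB u0E (_ : _ - _ = 0)//; ring.
have D1 : fourier (pt (DF (mu + 1) v)) 1 = (n%:R * ap * s)%:C.
  rewrite E1// fp' Qv -!rmorphM -rmorphD; congr (_%:C).
  transitivity (n%:R * (a * v1 + b * q) + n%:R * ap * (v1 + q)); first by ring.
  by rewrite abq vs mulr0 add0r.
have D2 : fourier (pt (DF (mu + 1) v)) (- 1) - n%:R * pt (DF (mu + 1) v) 0 = (n%:R * ap * s)%:C.
  rewrite E2// E3// fp' Qv v0 nC -!(rmorphM, rmorphB, rmorphD); congr (_%:C).
  transitivity (n%:R * (c * v1 + d * q) + n%:R * ap * (v1 + q)).
    by rewrite /c /d /b; ring.
  by rewrite cdq vs mulr0 add0r.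
exists v; split => //.
- apply/eqP => vz; have : fourier (pt v) 1 + Q v = 0.
    have pt0 (i : 'I_n.+1) : pt (0 : config R n) i = 0 by rewrite /pt !mxE.
    by rewrite vz /Q /fourier !big1 ?pt0 ?mulr0 ?subr0 ?addr0// => j _; rewrite pt0 mulr0.
  rewrite fp' Qv -rmorphD -mulrDr vs => /complexI/eqP.
  by rewrite mulf_eq0 (negPf s0) orbF (negPf nR0).
- by apply: (@kernel_eq0 1 mu v 1).
move=> w wW y; rewrite /y !fourier_lin pt_lin (kernel_coordE 1 wW) eqxx mul1r.
have [-> -> ->] := Z w wW; rewrite D1.
set f1 := fourier (pt w) 1; set th := f1 + _ - _ => e1 e2 /(_ erefl) e3.
have thE : th = f1 + Q w by rewrite /th /Q addrA.
pose g := n%:R * ap * s.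
have [] := @solve2 R (a + g) (b + g) (c + g) (d + g) f1 (Q w).
- have -> : (a + g) * (d + g) - (b + g) * (c + g) = (a * d - b * c) + g * s by rewrite /s; ring.
  rewrite adbc add0r /g; apply: mulf_neq0 => //; apply: mulf_neq0 => //.
  by apply: mulf_neq0 => //; exact: lt0r_neq0.
- by rewrite -[RHS]e1 thE -/g !rmorphD /=; ring.
- transitivity ((th * fourier (pt (DF (mu + 1) v)) (- 1) +
      (b%:C * f1 + (b + S)%:C * Q w + (mu + S)%:C * (n%:R * pt w 0))) -
     n%:R * (th * pt (DF (mu + 1) v) 0 + ((mu + S)%:C * pt w 0 - am%:C * Q w - ap%:C * f1)));
   last by rewrite e2 e3 mulr0 subr0.
  transitivity (th * (fourier (pt (DF (mu + 1) v)) (- 1) - n%:R * pt (DF (mu + 1) v) 0) +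
     (c%:C * f1 + d%:C * Q w)); last by rewrite /c /d /b !(rmorphM, rmorphD, rmorph_nat) /=; ring.
  by rewrite D2 -/g thE !rmorphD /=; ring.
move=> f10 Q0; have w0 : pt w 0 = 0.
  move/eqP: e3; rewrite thE f10 Q0 addr0 mul0r add0r !mulr0 !subr0 mulf_eq0 => /orP[|/eqP//].
  by rewrite eq_complex /= (negPf om).
by split=> //; move: Q0; rewrite /Q w0 mulr0 subr0.
Qed.

End Main.

(** * Changes of sign *)

Section SignChange.
Context {R : realType}.
Implicit Types (s g : R -> R) (t : R).

(** Near a point where a continuous function is not zero its sign is constant.
    *)
Lemma changes_sign_root s g t : {for t, continuous g} ->
  (forall u, s u = Num.sg (g u)) -> changes_sign s t -> g t = 0.
Proof.
move=> gc sE [e e0 he]; apply/eqP/negP => /negP gt0.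
have : \forall u \near t, Num.sg (g u) = Num.sg (g t).
  have := gt0; rewrite neq_lt => /orP[g0|g0].
    by apply: filterS (cvgr_lt _ gc _ g0) => u /=; move=> gu; rewrite !ltr0_sg.
  by apply: filterS (cvgr_gt _ gc _ g0) => u /=; move=> gu; rewrite !gtr0_sg.
move=> /nbhs_ballP[d /= d0 hd]; pose r := Num.min d e / 2.
have r0 : 0 < r by rewrite divr_gt0// lt_min d0 e0.
have rm : r < Num.min d e by rewrite /r; have : 0 < Num.min d e by [rewrite lt_min d0 e0]; lra.
move: rm; rewrite lt_min => /andP[rd re].
have : s (t - r) * s (t + r) < 0 by apply: he; apply/andP; split; lra.
rewrite !sE !hd.
- by rewrite -expr2 ltNge sqr_ge0.
- by rewrite /ball /= opprD addrA subrr sub0r normrN gtr0_norm.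
- by rewrite /ball /= opprB addrC subrK gtr0_norm.
Qed.

Lemma changes_sign_neq0 s t : changes_sign s t -> exists u, s u != 0.
Proof.
move=> [e e0 he]; exists (t - e / 2); apply/eqP => s0.
have : s (t - e / 2) * s (t + e / 2) < 0 by apply: he; apply/andP; split; lra.
by rewrite s0 mul0r ltxx.
Qed.

Lemma affine_continuous (a b t : R) : {for t, continuous (fun u => a + b * u)}.
Proof. by apply: cvgD; [exact: cvg_cst|apply: cvgM; [exact: cvg_cst|exact: cvg_id]]. Qed.

(** If the slope were 0 the function would vanish identically. *)
Lemma changes_sign_affine s g t c : (forall u, s u = Num.sg (g u)) ->
  (forall u, g (t + u) = g t + c * u) -> changes_sign s t -> g t = 0 /\ c != 0.
Proof.
move=> sE ga cs.
have gE : g = fun u => (g t - c * t) + c * u.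
  by apply/funext => u; rewrite -{1}(subrKC t u) ga; ring.
have g0 : g t = 0.
  apply: changes_sign_root sE cs; rewrite gE; exact: affine_continuous.
split=> //; have [u] := changes_sign_neq0 cs.
by apply: contraNneq => c0; rewrite sE -(subrKC t u) ga g0 c0 mul0r addr0 sgr0.
Qed.

End SignChange.

(** * Injectivity of the linearised problems *)

Section Injectivity.
Context {R : realType} {n : nat}.
Variables (alpha : R) (phi : R -> R).
Hypothesis n3 : (3 <= n)%N.
Hypothesis alpha1 : 1 <= alpha.
Hypothesis phiP : forall r : R, 0 < r -> is_derive r 1 phi (- r `^ (- alpha)).
Implicit Types (x w v : config R n) (i : 'I_n.+1) (c : 'I_2) (j k h p : nat).
Local Notation S := (s1 alpha n).
Local Notation DF mu := (dfield alpha (mu + s1 alpha n) (mass mu) (abar R n)).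
Local Notation sigma := (sigma phi alpha n).

Let n0 : (0 < n)%N. Proof. exact: leq_trans n3. Qed.

Lemma mode_inj h mu w j : mu + S != 0 -> (0 < j)%N -> (j.*2 <= n)%N -> sigma j mu != 0 ->
  w \in fixed_vspace h -> fourier (pt (DF mu w)) j%:R = 0 ->
  fourier (pt (DF mu w)) (- j%:R) = 0 -> (j = 1%N -> pt (DF mu w) 0 = 0) ->
  [/\ fourier (pt w) j%:R = 0, fourier (pt w) (- j%:R) = 0 & j = 1%N -> pt w 0 = 0].
Proof.
move=> om j0 jn sj wW e1 e2 e3.
have [j1|/eqP j1] := eqVneq j 1%N.
  move: sj e1 e2 (e3 j1); rewrite j1 (sigma_1 n3 phiP) sgr_eq0 mulf_eq0 negb_or => /andP[_ l0] f1 f2 f3.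
  by have [] := mode_1_inj n3 l0 om wW f1 f2 f3.
have [jn'|jn'] := eqVneq j.*2 n.
  have j2 : (1 < j)%N by lia.
  move: sj; rewrite (sigma_half n3 phiP)// sgr_eq0 => sj.
  have f0 : fourier (pt w) j%:R = 0.
    move/eqP: e1; rewrite (fourier_dfield_half alpha n3 _ j2 jn' wW) mulf_eq0.
    by rewrite eq_complex /= (negPf sj) => /eqP.
  by split=> //; rewrite (fourier_halfN n3).
have jn2 : (j.*2 < n)%N by rewrite ltn_neqAle jn'.
have j2 : (1 < j)%N by lia.
move: sj; rewrite (sigma_generic n3 phiP)// sgr_eq0 => sj.
by have [] := mode_generic_inj n3 j2 jn2 sj wW e1 e2.
Qed.

(** The mode [- j] is the mode [n - j], and [h] divides neither of [j] and [n
    - j]. *)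
Lemma fixed_off h w j : (h %| n)%N -> ~~ (h %| j)%N -> (j.*2 <= n)%N -> w \in fixed_vspace h ->
  [/\ fourier (pt w) j%:R = 0, fourier (pt w) (- j%:R) = 0 & j = 1%N -> pt w 0 = 0].
Proof.
move=> hn hj jn wW; split.
- exact: fixed_fourier0 wW.
- have -> : fourier (pt w) (- j%:R) = fourier (pt w) (n - j)%N%:R.
    by rewrite -(fourierDn n3) natrB; [congr fourier; ring|lia].
  by apply: fixed_fourier0 wW => //; rewrite dvdn_subr//; lia.
- move=> j1; apply: fixed_center0 wW => //.
  have := dvdn_gt0 n0 hn; case: (h) hj => [|[|]]//; by rewrite dvd1n.
Qed.

(** Only the mode 0 is left; it is nondegenerate when the rotation rate is not
    zero. *)
Lemma modes_eq0 h mu w : mu + S != 0 -> w \in fixed_vspace h ->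
  fourier (pt (DF mu w)) 0 = 0 ->
  (forall j, (0 < j)%N -> (j.*2 <= n)%N ->
    [/\ fourier (pt w) j%:R = 0, fourier (pt w) (- j%:R) = 0 & j = 1%N -> pt w 0 = 0]) ->
  w = 0.
Proof.
move=> om wW f0 fj; apply: (config_eq0 n3).
- by have [||_ _] := fj 1%N; [|lia|exact].
- exact: (mode_0_inj n3 alpha1 om wW f0).
- by move=> j j0 jn; have [] := fj j j0 jn.
Qed.

(** Each mode is either forbidden by one of the two symmetries or different
    from [k], hence nondegenerate. *)
Lemma symmetric_inj h p k mu w : mu + S != 0 ->
  (h %| n)%N -> (p %| n)%N -> ~~ ((h %| k) && (p %| k))%N ->
  (forall j, (0 < j)%N -> (j.*2 <= n)%N -> (h %| j)%N -> j <> k -> sigma j mu != 0) ->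
  w \in fixed_vspace h -> w \in fixed_vspace p -> DF mu w = 0 -> w = 0.
Proof.
move=> om hn pn hpk sj wh wp Dw.
have pt0 i : pt (0 : config R n) i = 0 by rewrite /pt !mxE.
have f0 t : fourier (pt (DF mu w)) t = 0.
  by rewrite Dw /fourier big1// => i _; rewrite pt0 mulr0.
apply: (modes_eq0 om wh) => // j j0 jn.
have [hj|hj] := boolP (h %| j)%N; last exact: (fixed_off hn hj jn wh).
have [pj|pj] := boolP (p %| j)%N; last exact: (fixed_off pn pj jn wp).
apply: (mode_inj om j0 jn _ wh) => //; last by rewrite Dw.
by apply: sj => // jk; move: hpk; rewrite -jk hj pj.
Qed.

(** The kernel vector does not contribute to the modes other than [k], which
    are forbidden or nondegenerate. *)
Lemma bordered_inj h k mu v w : (0 < k)%N -> (k.*2 <= n)%N -> (h %| n)%N ->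
  simple_kernel alpha h k mu v -> mu + S != 0 ->
  (forall j, (0 < j)%N -> (j.*2 <= n)%N -> (h %| j)%N -> j <> k -> sigma j mu != 0) ->
  w \in fixed_vspace h ->
  kernel_coord k w *: DF (mu + 1) v + DF mu w = 0 -> w = 0.
Proof.
move=> k0 kn hn [vW vn0 Dv [off v0] inj] om sj wW e0.
have pt0 i : pt (0 : config R n) i = 0 by rewrite /pt !mxE.
have f0 t : fourier (pt (0 : config R n)) t = 0.
  by rewrite /fourier big1// => i _; rewrite pt0 mulr0.
have offD j : (j.*2 <= n)%N -> j <> k ->
    [/\ fourier (pt (DF mu w)) j%:R = 0, fourier (pt (DF mu w)) (- j%:R) = 0
      & j = 1%N -> pt (DF mu w) 0 = 0].
  move=> jn jk; have [a1 a2] := off j jn jk.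
  have v0' : j = 1%N -> pt v 0 = 0 by move=> j1; apply: v0; lia.
  have [b1 b2] := fourier_dfield_off alpha n3 (mu + 1) jn a1 a2 v0'.
  split.
  - by have := f0 j%:R; rewrite -e0 fourier_lin b1 mulr0 add0r.
  - by have := f0 (- j%:R); rewrite -e0 fourier_lin b2 mulr0 add0r.
  move=> j1; have := pt0 0; rewrite -e0 pt_lin (center_dfield_fixed alpha n3 _ vW).
  move: a1 a2; rewrite j1 => -> ->.
  by rewrite v0'// !mulr0 !subr0 !mulr0 subr0 mulr0 add0r.
apply: (modes_eq0 om wW).
  by have [] := offD 0%N; [|lia|].  
move=> j j0 jn; have [hj|hj] := boolP (h %| j)%N; last exact: (fixed_off hn hj jn wW).
have [->|/eqP jk] := eqVneq j k; first by apply: inj; rewrite // e0 ?f0.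
have [d1 d2 d3] := offD j jn jk.
by apply: (mode_inj om j0 jn _ wW d1 d2 d3); exact: sj.
Qed.

End Injectivity.

(** * Roots of the signs of the blocks *)

Section Bifurcation.
Context {R : realType} {n : nat}.
Variables (alpha : R) (phi : R -> R).
Hypothesis n3 : (3 <= n)%N.
Hypothesis alpha1 : 1 <= alpha.
Hypothesis phiP : forall r : R, 0 < r -> is_derive r 1 phi (- r `^ (- alpha)).
Implicit Types (x w v e : config R n) (i : 'I_n.+1) (c : 'I_2) (j k h p : nat).
Local Notation S := (s1 alpha n).
Local Notation sigma := (sigma phi alpha n).
Local Notation blockA := (@block_diag R n alpha).
Local Notation blockB := (@block_off R n alpha).
Local Notation det2 := (@block_det R n alpha).
Local Notation ell := (@reduced_det R n alpha).
Local Notation ell_slope := (@reduced_slope R n alpha).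
Local Notation abar := (abar R n).

Lemma field0_abar : field0 alpha abar = 0.
Proof. by have := massfield_abar alpha n3 0; rewrite massfieldE scale0r addr0. Qed.

Lemma field1_abar : field1 alpha abar = 0.
Proof. by have := massfield_abar alpha n3 1; rewrite massfieldE scale1r field0_abar add0r. Qed.

Lemma changes_sign_half k mu : (1 < k)%N -> k.*2 = n -> changes_sign (sigma k) mu ->
  blockA mu k%:R + blockB mu k%:R = 0.
Proof.
move=> k1 kn cs; pose g nu := blockA nu k%:R + blockB nu k%:R : R.
have ga u : g (mu + u) = g mu + 2 * half_succ alpha * u.
  by rewrite /g blockA_shift blockB_shift; ring.
by have [] := changes_sign_affine (fun u => sigma_half n3 phiP u k1 kn) ga cs.
Qed.

Lemma changes_sign_generic k mu : (1 < k)%N -> (k.*2 < n)%N -> changes_sign (sigma k) mu ->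
  det2 mu k%:R = 0 /\
  blockA mu k%:R + blockA mu (- k%:R) - 2 * blockB mu k%:R != 0.
Proof.
move=> k1 kn cs.
have ga u := etrans (det2_shift (n:=n) alpha mu u k%:R) (congr1 (fun z => _ + z) (mulrAC _ _ _)).
have [->] := changes_sign_affine (fun u => sigma_generic n3 phiP u k1 kn) ga cs.
by rewrite mulf_eq0 negb_or => /andP[].
Qed.

(** The sign is [- 1] at the value of [mu] for which the rotation rate
    vanishes, by [det2_omega0]. *)
Lemma sigma_root_omega k mu : (1 < k)%N -> (k.*2 <= n)%N ->
  changes_sign (sigma k) mu -> mu + S != 0.
Proof.
move=> k1 kn cs; apply/eqP => om; have muE : mu = - S by apply/eqP; rewrite -addr_eq0 om.
have [d2 dh] := det2_omega0 n3 alpha1 k1 kn.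
have [kn'|kn'] := eqVneq k.*2 n.
  by have := dh kn'; rewrite -muE changes_sign_half// ltxx.
have kn2 : (k.*2 < n)%N by rewrite ltn_neqAle kn'.
by move: d2; rewrite -muE; have [->] := changes_sign_generic k1 kn2 cs; rewrite ltxx.
Qed.

Lemma sign_change_simple_kernel k mu : (0 < k)%N -> (k.*2 <= n)%N ->
  changes_sign (sigma k) mu -> mu + S != 0 -> (k = 1%N -> mu != 0) ->
  exists v, simple_kernel alpha (gcdn k n) k mu v.
Proof.
move=> k0 kn cs om mu0.
have hk := dvdn_gcdl k n; have hn := dvdn_gcdr k n.
have [k1|k1] := eqVneq k 1%N.
  move: cs (mu0 k1); rewrite k1 gcd1n => cs m0.
  have c1 t : {for t, continuous (fun u => ell u : R)}.
    rewrite (_ : (fun u => ell u) = fun u => ell 0 + half_succ alpha * ell_slope 0 * u).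
      exact: affine_continuous.
    by apply/funext => u; rewrite -{1}(add0r u) ell_shift; ring.
  have : mu * (mu + S) * ell mu = 0.
    apply: (changes_sign_root (g := fun u => u * (u + S) * ell u) _ _ cs) => [|u].
      apply: cvgM; last exact: c1.
      by apply: cvgM; [exact: cvg_id|apply: cvgD; [exact: cvg_id|exact: cvg_cst]].
    exact: sigma_1.
  move=> /eqP; rewrite !mulf_eq0 (negPf om) (negPf m0) /= => /eqP l0.
  apply: simple_kernel_one => //.
  have [u] := changes_sign_neq0 cs; rewrite (sigma_1 n3 phiP); apply: contraNneq => sl.
  by rewrite -(subrKC mu u) ell_shift l0 sl mulr0 addr0 mulr0 sgr0.
have k2 : (1 < k)%N by lia.
have [kn'|kn'] := eqVneq k.*2 n.
  by apply: simple_kernel_half => //; exact: changes_sign_half.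
have kn2 : (k.*2 < n)%N by rewrite ltn_neqAle kn'.
by have [h0 sl] := changes_sign_generic k2 kn2 cs; apply: simple_kernel_generic.
Qed.

End Bifurcation.

(** * Zeros of the field near the polygon *)

Section Local.
Context {R : realType} {n : nat}.
Variables (alpha : R) (phi : R -> R).
Hypothesis n3 : (3 <= n)%N.
Hypothesis alpha1 : 1 <= alpha.
Hypothesis phiP : forall r : R, 0 < r -> is_derive r 1 phi (- r `^ (- alpha)).
Implicit Types (x w v e : config R n) (i : 'I_n.+1) (c : 'I_2) (j k h p : nat).
Local Notation S := (s1 alpha n).
Local Notation DF mu := (dfield alpha (mu + s1 alpha n) (mass mu) (abar R n)).
Local Notation sigma := (sigma phi alpha n).
Local Notation abar := (abar R n).

Let n0 : (0 < n)%N. Proof. exact: leq_trans n3. Qed.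

Let cf_abar : collision_free abar. Proof. exact: collision_free_abar. Qed.

Lemma massfield_gradV0 mu x : massfield alpha mu x = 0 -> gradV alpha mu x = 0.
Proof. by move=> F0; apply/matrixP => j c; rewrite mxE F0 !mxE mulr0. Qed.

(** At [mu = 0] the gradient does not see the row of the central body; this
    row vanishes by the rotation symmetry. *)
Lemma gradV_massfield0 p mu x : (1 < p)%N -> (p %| n)%N -> x \in fixed_vspace p ->
  gradV alpha mu x = 0 -> massfield alpha mu x = 0.
Proof.
move=> p1 pn xp g0; apply: config_eq => j.
have -> : pt (0 : config R n) j = 0 by rewrite /pt !mxE.
have [->|j0] := eqVneq j 0.
  apply: (fixed_center0 n0 p1 pn); apply: (field_fixed alpha n0 _ _ xp).
  by move=> i i' i0 i'0; rewrite /mass (negPf i0) (negPf i'0).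
have H c : massfield alpha mu x j c = 0.
  by have := congr1 (fun M : config R n => M j c) g0; rewrite mxE [RHS]mxE /mass (negPf j0) mul1r.
by rewrite /pt !H.
Qed.

Lemma isolated_symmetric h p k mu : mu + S != 0 ->
  (h %| n)%N -> (p %| n)%N -> ~~ (p %| k)%N ->
  (forall j, (0 < j)%N -> (j.*2 <= n)%N -> (h %| j)%N -> j <> k -> sigma j mu != 0) ->
  \forall xm \near (abar, mu), rel_equilibrium phi alpha xm.2 xm.1 ->
    E h xm.1 -> xm.1 <> abar -> ~ E p xm.1.
Proof.
move=> om hn pn pk sj.
have p1 : (1 < p)%N by case: p pn pk => [|[|]]//; rewrite ?dvd0n ?dvd1n// => /eqP nE; move: n0; rewrite nE.
have inj w : w \in (fixed_vspace h :&: fixed_vspace p)%VS ->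
    dfield alpha S (mass 0) abar w + mu *: dfield alpha 1 (fun i => (i == 0)%:R) abar w = 0 ->
    w = 0.
  rewrite memv_cap => /andP[wh wp]; rewrite -dfieldE.
  by apply: (symmetric_inj n3 alpha1 phiP om hn pn _ sj wh wp); rewrite (negPf pk) andbF.
have [d d0 hd] := isolated_zero (strict_diff_field _ _ _ cf_abar) (strict_diff_field _ _ _ cf_abar)
  (field0_abar alpha n3) (field1_abar alpha n3) inj.
apply/nbhs_ballP; exists d => // -[x nu] [/= bx bnu] req /mem_fixed xh xa /mem_fixed xp.
have [cf g0] := (rel_equilibriumP phiP nu x).1 req.
apply: xa; apply: (hd x nu).
- by rewrite memv_cap !rpredB ?abar_fixed.
- by move: bx; rewrite -ball_normE /= distrC.
- by move: bnu; rewrite -ball_normE /= distrC.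
- by rewrite -massfieldE; exact: gradV_massfield0 xp g0.
Qed.

Lemma bifurcation h k mu v : (0 < k)%N -> (k.*2 <= n)%N -> (h %| n)%N ->
  simple_kernel alpha h k mu v -> mu + S != 0 ->
  (forall j, (0 < j)%N -> (j.*2 <= n)%N -> (h %| j)%N -> j <> k -> sigma j mu != 0) ->
  forall eps : R, 0 < eps -> exists x nu, [/\ x - abar \in fixed_vspace h, x != abar,
    `|x - abar| < eps, `|nu - mu| < eps & massfield alpha nu x = 0].
Proof.
move=> k0 kn hn ker om sj eps eps0; have [vW v0 Dv _ _] := ker.
have stable (om' : R) (m : 'I_n.+1 -> R) : (forall i i', i != 0 -> i' != 0 -> m i = m i') ->
    forall x, x - abar \in fixed_vspace h -> field alpha om' m x \in fixed_vspace h.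
  move=> hm x xa; apply: field_fixed => //.
  by rewrite -[x](subrK abar) rpredD ?abar_fixed.
have s0 : forall x, x - abar \in fixed_vspace h -> field0 alpha x \in fixed_vspace h.
  by apply: stable => i i' i0 i'0; rewrite /mass (negPf i0) (negPf i'0).
have s1 : forall x, x - abar \in fixed_vspace h -> field1 alpha x \in fixed_vspace h.
  by apply: stable => i i' i0 i'0; rewrite (negPf i0) (negPf i'0).
have Dv0 : dfield alpha S (mass 0) abar v +
    mu *: dfield alpha 1 (fun i => (i == 0)%:R) abar v = 0 by rewrite -dfieldE.
have D1v : DF (mu + 1) v = dfield alpha 1 (fun i => (i == 0)%:R) abar v.
  by rewrite dfieldE scalerDl scale1r addrA Dv0 add0r.
have inj w : w \in fixed_vspace h -> dfield alpha S (mass 0) abar w +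
    mu *: dfield alpha 1 (fun i => (i == 0)%:R) abar w +
    kernel_coord k w *: dfield alpha 1 (fun i => (i == 0)%:R) abar v = 0 -> w = 0.
  move=> wW e0; apply: (bordered_inj n3 alpha1 phiP k0 kn hn ker om sj wW).
  by rewrite D1v addrC dfieldE.
have [x [nu [xW xa xe nue F]]] := crandall_rabinowitz (strict_diff_field _ _ _ cf_abar)
  (strict_diff_field _ _ _ cf_abar) (field0_abar alpha n3) (field1_abar alpha n3) s0 s1 vW v0
  Dv0 inj eps0.
by exists x, nu; split=> //; rewrite massfieldE.
Qed.

End Local.

(** * Branches of relative equilibria *)

Section Explicit.
Context {R : realType} {n : nat}.
Variables (alpha : R).
Implicit Types (x y w v e : config R n) (i : 'I_n.+1) (c : 'I_2) (j k h p : nat).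

Lemma field_translate m x y : (forall i i' c, y i c = y i' c) ->
  field alpha 0 m (x + y) = field alpha 0 m x.
Proof.
move=> yc; apply/matrixP => j c; rewrite mxE [RHS]mxE !mul0r; congr (_ - _).
have dE i c' : (x + y) j c' - (x + y) i c' = x j c' - x i c'.
  by rewrite !mxE (yc j i c'); ring.
apply: eq_bigr => i _; rewrite dE; congr (_ * (rho _ _ * _)).
by apply: eq_bigr => c' _; rewrite dE.
Qed.

Lemma field_scale m (s : R) x : 0 < s ->
  field alpha 0 m (s *: x) = (s * rho alpha (s ^+ 2)) *: field alpha 0 m x.
Proof.
move=> s0; apply/matrixP => j c; rewrite !mxE !mul0r !sub0r mulrN mulr_sumr; congr (- _).
apply: eq_bigr => i _; rewrite !mxE -mulrBr.
have -> : sqdist (s *: x) i j = s ^+ 2 * sqdist x i j.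
  by rewrite /sqdist mulr_sumr; apply: eq_bigr => c' _; rewrite !mxE -mulrBr exprMn.
by rewrite {1}/rho powRM ?sqr_ge0 ?sqdist_ge0// -/(rho _ _) -/(rho _ _); ring.
Qed.

(** A central body without mass exerts no force. *)
Lemma field_massless om m x y (j : 'I_n.+1) c : m 0 = 0 -> j != 0 ->
  (forall i c', i != 0 -> x i c' = y i c') -> field alpha om m x j c = field alpha om m y j c.
Proof.
move=> m0 j0 xy; rewrite !mxE xy//; congr (_ - _); apply: eq_bigr => i _.
have [->|i0] := eqVneq i 0; first by rewrite m0 !mul0r.
rewrite !xy//; congr (_ * (rho _ _ * _)).
by apply: eq_bigr => c' _; rewrite !xy.
Qed.

End Explicit.

Section Closure.
Context {R : realType} {n : nat}.
Variables (alpha : R) (phi : R -> R).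
Hypothesis n3 : (3 <= n)%N.
Hypothesis alpha1 : 1 <= alpha.
Hypothesis phiP : forall r : R, 0 < r -> is_derive r 1 phi (- r `^ (- alpha)).
Implicit Types (x w v e : config R n) (i : 'I_n.+1) (c : 'I_2) (j k h p : nat).
Local Notation S := (s1 alpha n).
Local Notation sigma := (sigma phi alpha n).
Local Notation abar := (abar R n).

Let n0 : (0 < n)%N. Proof. exact: leq_trans n3. Qed.

Definition branch h (mu : R) (P : set (config R n)) := forall eps : R, 0 < eps ->
  exists x nu, [/\ x - abar \in fixed_vspace h, x != abar, `|x - abar| < eps,
    `|nu - mu| < eps & gradV alpha nu x = 0 /\ P x].

Lemma branch_closure h mu P : (h %| n)%N -> branch h mu P ->
  closure [set xm : config R n * R | [/\ rel_equilibrium phi alpha xm.2 xm.1,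
    E h xm.1, xm.1 <> abar & P xm.1]] (abar, mu).
Proof.
move=> hn fam B /nbhs_ballP[d /= d0 hB].
have /nbhs_ballP[d1 /= d10 hcf] := collision_free_near (collision_free_abar (R := R) n0).
have eps0 : 0 < Num.min d d1 by rewrite lt_min d0 d10.
have [x [nu [xW xa xe nue [g0 Px]]]] := fam _ eps0.
move: xe nue; rewrite !lt_min => /andP[xd xd1] /andP[nd nd1].
have bx r : `|x - abar| < r -> ball abar r x by rewrite -ball_normE /= distrC.
exists (x, nu); split; last first.
  by apply: hB; split; [exact: bx|rewrite -ball_normE /= distrC].
split=> //=; last exact/eqP.
- by apply/(rel_equilibriumP phiP); split=> //; apply: hcf; exact: bx.
- by apply/mem_fixed; rewrite -[x](subrK abar) rpredD ?abar_fixed.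
Qed.

Lemma line_branch h mu e P : e \in fixed_vspace h -> e != 0 ->
  (forall t : R, 0 < t -> gradV alpha mu (abar + t *: e) = 0 /\ P (abar + t *: e)) ->
  branch h mu P.
Proof.
move=> eW e0 g0 eps eps0; have ne0 : 0 < `|e| by rewrite normr_gt0.
pose t := eps / (2 * `|e|); have t0 : 0 < t by rewrite divr_gt0// mulr_gt0.
exists (abar + t *: e), mu; rewrite addrAC subrr add0r; split.
- by rewrite rpredZ.
- by rewrite -subr_eq0 addrAC subrr add0r scaler_eq0 negb_or (gt_eqF t0).
- rewrite normrZ gtr0_norm// /t.
  have -> : eps / (2 * `|e|) * `|e| = eps / 2 by field; rewrite gt_eqF.
  lra.
- by rewrite subrr normr0.
- exact: g0.
Qed.

(** Where the rotation rate vanishes the field is homogeneous, so that the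
    homothetic polygons are zeros too. *)
Lemma homothety_branch mu : mu + S = 0 -> branch n mu setT.
Proof.
move=> om; apply: (@line_branch n mu abar); first exact: abar_fixed.
  apply/eqP => a0; have := collision_free_abar (R := R) n0 (i := ord0) (j := ord_max).
  rewrite a0 /sqdist big1 ?eqxx => [h|c _]; last by rewrite !mxE subrr expr2 mulr0.
  by have := h _; rewrite -val_eqE /= eq_sym -lt0n => /(_ n0).
move=> t t0; split=> //; apply: massfield_gradV0.
rewrite -{1}[abar]scale1r -scalerDl /massfield om field_scale ?addr_gt0//.
by have := massfield_abar alpha n3 mu; rewrite /massfield om => ->; rewrite scaler0.
Qed.

(** For [mu = 0] the central body neither acts on the others nor contributes
    to the gradient: it can be put anywhere. *)
Lemma central_branch : branch 1 0 setT.
Proof.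
pose e : config R n := mode_config 1 0 0 1.
have e0 i c : i != 0 -> e i c = 0.
  by move=> i0; rewrite mxE (negPf i0) !mul0r addr0; case: ifP.
apply: (@line_branch 1 0 e).
- by apply: mode_config_fixed.
- apply/eqP => ez; have : pt e 0 = 0 by rewrite ez /pt !mxE.
  by rewrite pt_mode_config0 => /eqP; rewrite oner_eq0.
move=> t t0; split=> //; apply/matrixP => j c; rewrite mxE [RHS]mxE.
have [->|j0] := eqVneq j 0; first by rewrite /mass eqxx mul0r.
rewrite (@field_massless _ _ _ _ _ _ abar)// ?/mass ?eqxx//.
  by have := massfield_abar alpha n3 0; rewrite /massfield => ->; rewrite mxE mulr0.
by move=> i c' i0; rewrite mxE [X in _ + X]mxE e0// mulr0 addr0.
Qed.

(** Where the rotation rate vanishes the field depends on the differences of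
    positions only. The displaced central body rules out any rotation
    symmetry. *)
Lemma translation_branch mu : mu + S = 0 -> branch 1 mu [set x | pt x 0 != 0].
Proof.
move=> om; pose e : config R n := mode_config 1 0 1 1.
have e1 i : pt e i = 1.
  by rewrite pt_config_of; case: eqP => //; rewrite mul0r add0r subrr mul0r wv0 mulr1.
apply: (@line_branch 1 mu e).
- by apply: mode_config_fixed.
- apply/eqP => ez; have : pt e 0 = 0 by rewrite ez /pt !mxE.
  by rewrite e1 => /eqP; rewrite oner_eq0.
move=> t t0; split.
  apply: massfield_gradV0; rewrite /massfield om field_translate.
    by have := massfield_abar alpha n3 mu; rewrite /massfield om.
  move=> i i' c; rewrite !mxE; congr (_ * _).
  by have := etrans (e1 i) (esym (e1 i')); rewrite !pt_config_of => ->.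
rewrite /= addrC pt_lin e1 pt_abar eqxx addr0 mulr1.
by rewrite eq_complex /= negb_and (gt_eqF t0).
Qed.

Lemma kernel_branch k mu : (0 < k)%N -> (k.*2 <= n)%N ->
  changes_sign (sigma k) mu -> mu + S != 0 -> (k = 1%N -> mu != 0) ->
  (forall j, (0 < j)%N -> (j.*2 <= n)%N -> (gcdn k n %| j)%N -> j <> k -> sigma j mu != 0) ->
  branch (gcdn k n) mu setT.
Proof.
move=> k0 kn cs om mu0 sj eps eps0.
have [v ker] := sign_change_simple_kernel n3 alpha1 phiP k0 kn cs om mu0.
have [x [nu [xW xa xe nue F0]]] :=
  bifurcation n3 alpha1 phiP k0 kn (dvdn_gcdr k n) ker om sj eps0.
by exists x, nu; split=> //; split=> //; exact: massfield_gradV0.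
Qed.

(** A group [Dtilde p] larger than [Dtilde h] has an order [p] that does not
    divide [k], which forbids the degenerate mode. There are finitely many
    such [p]. *)
Lemma no_larger_symmetry k mu :
  (k = n \/ mu + S != 0) ->
  (forall j, (0 < j)%N -> (j.*2 <= n)%N -> (gcdn k n %| j)%N -> j <> k -> sigma j mu != 0) ->
  \forall xm \near (abar, mu), rel_equilibrium phi alpha xm.2 xm.1 ->
    E (gcdn k n) xm.1 -> xm.1 <> abar -> ~ exists p : nat,
    [/\ (p %| n)%N, @Dtilde R n (gcdn k n) `<` @Dtilde R n p & @E R n p xm.1].
Proof.
move=> kom sj; pose h := gcdn k n; have hn : (h %| n)%N := dvdn_gcdr k n.
have larger p : (p %| n)%N -> @Dtilde R n h `<` @Dtilde R n p -> ~~ (p %| k)%N.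
  move=> pn lt; apply/negP => pk; have ph : (p %| h)%N by rewrite dvdn_gcd pk.
  by case: lt => _; apply; exact: Dtilde_dvd.
have near_p (q : 'I_n.+1) : \forall xm \near (abar, mu), (q %| n)%N -> ~~ (q %| k)%N ->
    rel_equilibrium phi alpha xm.2 xm.1 -> E h xm.1 -> xm.1 <> abar -> ~ E q xm.1.
  have [qn|qn] := boolP (q %| n)%N; last by apply: (@filterE _ (nbhs (abar, mu))) => xm; rewrite ?(negPf qn).
  have [qk|qk] := boolP (q %| k)%N; first by apply: (@filterE _ (nbhs (abar, mu))) => xm; rewrite ?qk.
  have om : mu + S != 0 by case: kom => // kE; move: qk; rewrite kE qn.
  have := isolated_symmetric n3 alpha1 phiP om hn qn qk sj.
  by apply: filterS => xm H _ _; exact: H.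
apply: (@filterS _ (nbhs (abar, mu)) _ _ _ _ (@filter_forall _ _ _ (nbhs (abar, mu)) _ near_p)) => xm H req Eh xa [p [pn lt Ep]].
have pn' : (p < n.+1)%N by rewrite ltnS dvdn_leq.
exact: (H (Ordinal pn') pn (larger p pn lt) req Eh xa).
Unshelve. all: by end_near. Qed.

End Closure.

(** * Bifurcation with maximal symmetry *)

Lemma closure_near {T : topologicalType} (A B : set T) (a : T) :
  (\forall x \near a, A x -> B x) -> closure A a -> closure B a.
Proof.
move=> AB clA N nN; have [x [Ax [Nx ABx]]] := clA _ (filterI nN AB).
by exists x; split=> //; exact: ABx.
Qed.

Theorem theorem14 (R : realType) (alpha : R) (phi : R -> R) (n k : nat)
    (mu0 : R)
    (halpha : 1 <= alpha)
    (hphi : forall r : R, 0 < r -> is_derive r 1 phi (- r `^ (- alpha)))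
    (hn : (3 <= n)%N)
    (hk : (1 <= k <= n./2)%N \/ k = n)
    (hsign : changes_sign (sigma phi alpha n k) mu0)
    (hother : forall j : nat, (1 <= j)%N -> (j.*2 <= n)%N ->
       (gcdn k n %| j)%N -> j <> k -> sigma phi alpha n j mu0 != 0) :
  let h := gcdn k n in
  let larger (x : 'M[R]_(n.+1, 2)) := exists p : nat,
    [/\ (p %| n)%N, @Dtilde R n h `<` @Dtilde R n p & @E R n p x] in
  closure [set xm : 'M[R]_(n.+1, 2) * R |
      [/\ rel_equilibrium phi alpha xm.2 xm.1, @E R n h xm.1,
          xm.1 <> abar R n & ~ larger xm.1]] (abar R n, mu0) /\
  ((k, mu0) <> (1%N, - s1 alpha n) ->
   \forall xm \near (abar R n, mu0),
     rel_equilibrium phi alpha xm.2 xm.1 -> @E R n h xm.1 ->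
     xm.1 <> abar R n -> ~ larger xm.1).
Proof.
move=> h larger; have n0 : (0 < n)%N by exact: leq_trans hn.
have hn' : (h %| n)%N := dvdn_gcdr k n.
have omega_neq0 : (k, mu0) <> (1%N, - s1 alpha n) -> k = n \/ mu0 + s1 alpha n != 0.
  case: hk => [/andP[k0 k2] kmu|]; last by left.
  right; have kn : (k.*2 <= n)%N by have := odd_double_half n; lia.
  have [k1|k1] := eqVneq k 1%N.
    by rewrite addr_eq0; apply/eqP => mE; apply: kmu; rewrite k1 mE.
  by apply: (sigma_root_omega hn halpha hphi _ kn hsign); lia.
have local : (k, mu0) <> (1%N, - s1 alpha n) -> \forall xm \near (abar R n, mu0),
    rel_equilibrium phi alpha xm.2 xm.1 -> @E R n h xm.1 -> xm.1 <> abar R n -> ~ larger xm.1.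
  by move=> /omega_neq0 om; apply: (no_larger_symmetry hn halpha hphi om hother).
split=> //.
have from_branch : (k, mu0) <> (1%N, - s1 alpha n) -> @branch R n alpha h mu0 setT -> closure
    [set xm : 'M[R]_(n.+1, 2) * R | [/\ rel_equilibrium phi alpha xm.2 xm.1,
      @E R n h xm.1, xm.1 <> abar R n & ~ larger xm.1]] (abar R n, mu0).
  move=> kmu br; apply: (closure_near _ (branch_closure hn hphi hn' br)).
  apply: (@filterS _ (nbhs (abar R n, mu0)) _ _ _ _ (local kmu)) => xm H [req Eh xa _].
  by split=> //; exact: H.
(* The mode 0 is degenerate where the rotation rate vanishes. *)
have [kn|kn] := eqVneq k n.
  have hE : h = n by rewrite /h kn gcdnn.
  apply: from_branch; first by rewrite kn => -[n1]; move: hn; rewrite n1.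
  rewrite hE; apply: (homothety_branch hn).
  have := changes_sign_root (g := fun u => (alpha + 1) * (u + s1 alpha n)) _ _ hsign.
  have ap0 : alpha + 1 != 0 by rewrite gt_eqF// addr_gt0// (lt_le_trans ltr01).
  move=> H; apply/eqP; suff : (alpha + 1) * (mu0 + s1 alpha n) == 0.
    by rewrite mulf_eq0 (negPf ap0).
  apply/eqP; apply: H => [|u]; last by rewrite kn; exact: sigma_n.
  by apply: cvgM; [exact: cvg_cst|apply: cvgD; [exact: cvg_id|exact: cvg_cst]].
have [k0 k2] : (0 < k)%N /\ (k.*2 <= n)%N.
  by case: hk => [/andP[? ?]|/eqP]; [have := odd_double_half n; lia|rewrite (negPf kn)].
(* The only case in which the symmetry is not restricted by the local
   analysis. *)
have [[k1 muE]|kmu] := pselect ((k, mu0) = (1%N, - s1 alpha n)).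
  have hE : h = 1%N by rewrite /h k1 gcd1n.
  have om : mu0 + s1 alpha n = 0 by rewrite muE addNr.
  have := branch_closure hn hphi (dvd1n n) (translation_branch hn om).
  apply: closureS => -[x nu] [/= req E1 xa x0]; rewrite hE; split=> // -[p [pn lt Ep]].
  move/eqP: x0; apply; have p1 : (1 < p)%N.
    case: (p) pn lt => [|[|]]//; first by rewrite dvd0n => /eqP nE; move: n0; rewrite nE.
    by rewrite hE => _ [_]; case.
  by apply: fixed_center0 n0 _ _ p1 pn _; apply/mem_fixed.
apply: from_branch => //.
have [[k1 m0]|km] := pselect (k = 1%N /\ mu0 = 0).
  by rewrite /h k1 gcd1n m0; exact: central_branch.
apply: (kernel_branch hn halpha hphi k0 k2 hsign) => //.
- by case: (omega_neq0 kmu) => // /eqP; rewrite (negPf kn).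
- by move=> k1; apply/eqP => m0; apply: km.
Qed.
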